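(* Let $a,b>0$ and $\mu,\nu>\frac12$. Then the function $$x\mapsto\zeta_{\mu,\nu,a,b}(x)=\frac{2^{\mu+\nu}\Gamma(\mu+1)\Gamma(\nu+1)}{a^{\mu}b^{\nu}}\,e^{-(a+b)\sqrt{x}}x^{-\frac{\mu+\nu}{2}}I_{\mu}(a\sqrt{x})I_{\nu}(b\sqrt{x}),\qquad x>0,$$ is the Laplace transform of an infinitely divisible distribution on $(0,\infty)$, which is not a generalized gamma convolution.
   Context: $I_\mu$ is the modified Bessel function of the first kind, and $\Gamma$ is the Euler gamma function. The Laplace transform of a probability distribution $\lambda$ on $[0,\infty)$ is $x\mapsto\int_0^\infty e^{-xt}d\lambda(t)$. A probability distribution $\lambda$ on $[0,\infty)$ is infinitely divisible if for every $n\in\mathbb{N}$ there is a probability distribution $\lambda_n$ on $[0,\infty)$ with $\int_0^\infty e^{-xt}d\lambda(t)=\left[\int_0^\infty e^{-xt}d\lambda_n(t)\right]^n$ for all $x>0$. A probability distribution on $[0,\infty)$ is a generalized gamma convolution if its Laplace transform has the form $L(s)=\exp\left(-\alpha s+\int_0^\infty \ln\left(\frac{t}{s+t}\right)dm(t)\right)$, $s\ge 0$, with $\alpha\ge0$ and $m$ a non-negative measure. *)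

(* Defs.v *)
From HB Require Import structures.
From mathcomp Require Import all_boot all_order all_algebra.
From mathcomp Require Import all_classical all_reals all_analysis.
Set Implicit Arguments.
Unset Strict Implicit.
Unset Printing Implicit Defensive.
Import Order.TTheory GRing.Theory Num.Theory.
Import numFieldNormedType.Exports.
Local Open Scope classical_set_scope.
Local Open Scope ring_scope.

(* Euler's integral; it converges for [0 < x], the only case of interest. *)
Definition Gamma (R : realType) (x : R) : R :=
  \int[lebesgue_measure]_(t in `]0, +oo[) (t `^ (x - 1) * expR (- t)).

(* Meant for [0 < z] and [-1 < mu], where the series converges and [Gamma] is
   evaluated only at positive reals. *)
Definition besselI (R : realType) (mu z : R) : R :=
  limn (series (fun k : nat =>
    (z / 2) `^ (2 * k%:R + mu) / (k`!%:R * Gamma (k%:R + mu + 1)))).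

(* A distribution on [0, +oo[ is represented by a probability measure on the
   Borel sets of R that gives mass 1 to [0, +oo[. *)
Definition supported_nonneg (R : realType)
    (P : probability (measurableTypeR R) R) : Prop :=
  P `[0, +oo[%classic = 1%E.

(* The integrand is bounded by 1 for [0 <= x], so the real-valued integral is
   the genuine one there. *)
Definition laplace (R : realType) (P : probability (measurableTypeR R) R)
    (x : R) : R :=
  \int[P]_(t in `[0, +oo[) expR (- (x * t)).

Definition infinitely_divisible (R : realType)
    (P : probability (measurableTypeR R) R) : Prop :=
  supported_nonneg P /\
  forall n : nat, (0 < n)%N ->
    exists Pn : probability (measurableTypeR R) R,
      supported_nonneg Pn /\
      forall x : R, 0 < x -> laplace P x = laplace Pn x ^+ n.

(* The measure [m] is arbitrary, possibly infinite.  The integrand is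
   nonpositive, so the integral is well defined in [-oo, 0], and the equation
   of extended reals forces it to be finite, since [expeR -oo = 0] and the
   Laplace transform is positive; for the same reason [m] cannot charge 0, where
   [ln (t / (s + t))] is to be read as -oo, and the integral is over ]0, +oo[. *)
Definition generalized_gamma_convolution (R : realType)
    (P : probability (measurableTypeR R) R) : Prop :=
  supported_nonneg P /\
  exists (alpha : R) (m : {measure set (measurableTypeR R) -> \bar R}),
    0 <= alpha /\
    forall s : R, 0 <= s ->
      ((laplace P s)%:E =
       expeR ((- (alpha * s))%:E +
              \int[m]_(t in `]0%R, +oo[) (ln (t / (s + t)))%:E))%E.

Definition zeta (R : realType) (mu nu a b x : R) : R :=
  2 `^ (mu + nu) * Gamma (mu + 1) * Gamma (nu + 1) / (a `^ mu * b `^ nu)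
  * expR (- ((a + b) * Num.sqrt x)) * x `^ (- ((mu + nu) / 2))
  * besselI mu (a * Num.sqrt x) * besselI nu (b * Num.sqrt x).

(* Main.v *)
Require Import Defs.
From HB Require Import structures.
From mathcomp Require Import all_boot all_order all_algebra.
From mathcomp Require Import all_classical all_reals all_analysis.
From mathcomp Require Import measurable_realfun.
From mathcomp Require Import complex.
From mathcomp Require Import ring lra zify.
Import Order.TTheory GRing.Theory Num.Theory.
Import numFieldNormedType.Exports.
Local Open Scope classical_set_scope.
Local Open Scope ring_scope.

Set Implicit Arguments.
Unset Strict Implicit.
Unset Printing Implicit Defensive.

(* Write F_mu(x) = sum_k x^k / (4^k k! (mu+1)_k), so that
   zeta(x) = e^{-a sqrt x} F_mu(a^2 x) e^{-b sqrt x} F_nu(b^2 x).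
   F_mu is a limit of polynomials with nonpositive real roots,
   hence F_mu(x) = prod_i (1 + tau_i x) with tau_i >= 0.  For mu > 1/2, Sturm
   comparison of z^(mu + 1/2) F_mu(-z^2) with the sine shows that the positive
   zeros of F_mu(-z^2) are simple, at distance at least pi from each other and
   from 0, so N(u) = #{i | 1 <= tau_i u} is at most sqrt u / pi.  Therefore
   sqrt x - ln F_mu(x) = int_0^oo x/(x+u) (sqrt u / pi - N(u)) du/u
   has a nonnegative density; x/(x+u) is 1 minus the Laplace transform of an
   exponential distribution, so zeta and all its roots are limits of compound
   Poisson Laplace transforms.

   If zeta were the transform of a generalized gamma convolution with data
   (alpha, m), the measure m plus the atoms 1/(a^2 tau_i), 1/(b^2 tau_i') would
   have the same logarithmic potential, up to the linear term alpha x, as the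
   absolutely continuous measure representing (a + b) sqrt x.  Differentiating
   in x identifies the integrals of u^n, n >= 2, u = c/(c+t), and the functions
   u^2 (4u(1-u))^k tend to a multiple of the indicator of t = c; thus the
   measures have the same atoms, a contradiction. *)

(** The real-rooted polynomials come from an operator: for c > 0, q + x q' / c inherits nonpositive
    real roots from q and multiplies the k-th coefficient by 1 + k / c. Applied to (1 + x / M)^M
    with c = mu + 1, mu + 2, ..., these multipliers telescope to (mu + n + 1)_k / (mu + 1)_k, which
    produces the factor 1 / (mu + 1)_k of the coefficients of F_mu. The bound 1/2 on mu is felt
    twice: it makes F_mu(z^2) at most sinh z / z coefficient by coefficient, and it makes mu^2 - 1/4
    positive in the Sturm comparison. Limits are the recurring obstacle. For laws, partial products
    of transforms belong to sums of independent nonnegative variables, so their distribution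
    functions decrease and converge pointwise without any selection principle. For roots, all sorted
    inverse roots converge along one ultrafilter, and the growth of F_mu forces a decay like 1 /
    i^2, so that no factor is lost; zeros and multiplicities are carried over as inequalities. *)

(** * Improper integrals and probability densities *)

Lemma eseries_EFin (R : realType) (u : R^nat) (l : R) :
  series u @ \oo --> l -> (\sum_(n <oo) (u n)%:E = l%:E)%E.
Proof.
move=> ul; apply/cvg_lim => //.
rewrite [X in X @ _](_ : _ = EFin \o series u); last first.
  by apply/funext => n /=; rewrite sumEFin.
by apply: cvg_EFin => //; exact: nearW.
Qed.

Lemma is_derive_continuous (R : realType) (f : R -> R) (x df : R) :
  is_derive x 1 f df -> {for x, continuous f}.
Proof.
by move=> fd; apply: differentiable_continuous; apply/derivable1_diffP; apply: ex_derive.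
Qed.

(** Both ends are improper: the integrand may be singular at [a], as u^(-1/2) is at 0. The
    closed-interval version is applied on the sets [I n], and monotone convergence moves the left
    end to [a]. *)
Lemma ge0_FTC_oy (R : realType) (f F : R -> R) (a l0 l : R) :
  (forall x, a < x -> 0 <= f x) ->
  (forall x, a < x -> {for x, continuous f}) ->
  (forall x, a < x -> is_derive x 1 F (f x)) ->
  F x @[x --> a^'+] --> l0 -> F x @[x --> +oo] --> l ->
  (\int[lebesgue_measure]_(x in `]a, +oo[) (f x)%:E = (l - l0)%:E)%E.
Proof.
move=> f0 cf dF Fa Fl.
pose I n : set R := `[a + n.+1%:R^-1, +oo[%classic.
have aI n x : I n x -> a < x.
  rewrite /I/= in_itv/= andbT; apply: lt_le_trans.
  by rewrite ltrDl invr_gt0.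
have IE : `]a, +oo[%classic = \bigcup_n I n.
  apply/seteqP; split => x; last by move=> [n _ /aI]; rewrite /= in_itv/= andbT.
  rewrite /= in_itv/= andbT => ax.
  have xa0 : 0 < x - a by rewrite subr_gt0.
  exists (Num.truncn (x - a)^-1) => //; rewrite /I/= in_itv/= andbT -lerBrDl.
  rewrite -[leRHS]invrK lef_pV2 ?posrE ?invr_gt0 ?ltr0n//.
  exact/ltW/truncnS_gt.
have cfI n : {within I n, continuous f}.
  apply: continuous_in_subspaceT => x; rewrite inE => /aI; exact: cf.
have IL n : (\int[lebesgue_measure]_(x in I n) (f x)%:E =
    l%:E - (F (a + n.+1%:R^-1))%:E)%E.
  have an : a < a + n.+1%:R^-1 by rewrite ltrDl invr_gt0.
  apply: ge0_continuous_FTC2y => //.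
  - by move=> x ax; apply: f0; exact: lt_le_trans ax.
  - exact: cfI.
  - by move=> x ax; apply: ex_derive; apply: dF; exact: lt_trans ax.
  - apply: cvg_at_right_filter.
    exact/is_derive_continuous/dF.
  - move=> x; rewrite in_itv/= andbT => ax; rewrite derive1E.
    by apply: derive_val; apply: dF; exact: lt_trans ax.
rewrite IE.
have := @ge0_nondecreasing_set_cvg_integral _ (measurableTypeR R) R I (EFin \o f) lebesgue_measure.
have ndI : nondecreasing_seq I.
  move=> m n mn; apply/subsetPset; apply: subset_itvr.
  by rewrite bnd_simp lerD2l lef_pV2 ?posrE// ler_nat.
move=> /(_ ndI).
have mI i : measurable (I i) by exact: measurable_itv.
have mfI i : measurable_fun (I i) (EFin \o f).
  by apply/measurable_EFinP; exact: subspace_continuous_measurable_fun.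
have f0I i x : I i x -> (0 <= (EFin \o f) x)%E by move/aI => /f0; rewrite lee_fin.
move=> /(_ mI mfI f0I) cvI.
apply: (cvg_unique _ cvI); first exact: ereal_hausdorff.
rewrite (_ : (fun i => _) = (fun i => (l - F (a + i.+1%:R^-1))%:E)); last first.
  by apply/funext => n; rewrite /comp IL.
apply: cvg_EFin; first exact: nearW.
apply: cvgB; first exact: cvg_cst.
move/cvg_at_rightP : Fa; apply; split => [n|]; first by rewrite ltrDl invr_gt0.
rewrite -[X in _ --> X]addr0; apply: cvgD; first exact: cvg_cst.
exact: cvg_harmonic.
Qed.

Lemma integral_exp_tail (R : realType) (a x : R) : 0 < x ->
  (\int[lebesgue_measure]_(s in `]a, +oo[) (x * expR (- (x * s)))%:E =
   (expR (- (x * a)))%:E)%E.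
Proof.
move=> x0.
have d (s : R) : is_derive s 1 (fun s => - expR (- (x * s))) (x * expR (- (x * s))).
  apply: is_derive_eq; rewrite /GRing.scale/=; ring.
have c (s : R) : {for s, continuous (fun s => expR (- (x * s)))}.
  apply: (@is_derive_continuous _ _ _ (expR (- (x * s)) * (- x))).
  by apply: is_derive_eq; rewrite /GRing.scale/=; ring.
rewrite (@ge0_FTC_oy _ _ (fun s => - expR (- (x * s))) _ (- expR (- (x * a))) 0)//.
- by rewrite opprK add0r.
- by move=> s _; rewrite mulr_ge0 ?expR_ge0 ?ltW.
- by move=> s _; apply: continuousM; [exact: cvg_cst|exact: c].
- by apply: cvg_at_right_filter; apply: cvgN; exact: c.
- rewrite -oppr0; apply: cvgN.
  apply: (cvg_comp (fun s => x * s) (fun s => expR (- s)) _ (@cvgr_expR R)).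
  by apply: gt0_cvgMry.
Qed.

Lemma measurable_invr (R : realType) : measurable_fun [set: R] (fun x : R => x^-1).
Proof.
(* The right-hand side is built from measurable functions and agrees with the inverse also at 0,
   where both are 0. *)
rewrite (_ : (fun x => _) = (fun x : R => x * (x ^+ 2) `^ (-1))).
  apply: measurable_funM => //.
  by apply: (measurableT_comp (measurable_powR _)); exact: measurable_funX.
apply/funext => x; rewrite powR_inv1 ?sqr_ge0//.
by have [->|x0] := eqVneq x 0; [rewrite invr0 mul0r|field].
Qed.

Lemma cvg_series_eseries (R : realType) (u : R^nat) (l : R) :
  (forall n, 0 <= u n) -> (\sum_(n <oo) (u n)%:E = l%:E)%E ->
  series u @ \oo --> l.
Proof.
move=> u0 ul.
have cv : (EFin \o series u) n @[n --> \oo] --> l%:E.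
  rewrite -ul (_ : EFin \o series u = fun n => (\sum_(0 <= k < n) (u k)%:E)%E).
    by apply: is_cvg_ereal_nneg_natsum => k _; rewrite lee_fin.
  by apply/funext => n /=; rewrite sumEFin.
by move/fine_cvg: cv.
Qed.

Section density.
Context d (T : measurableType d) (R : realType) (mu : {measure set T -> \bar R}).
Variables (w : T -> R) (w0 : forall x, 0 <= w x)
  (mw : measurable_fun setT w) (w1 : (\int[mu]_x (w x)%:E = 1)%E).
Local Open Scope ereal_scope.

(** The hypotheses on [w] are arguments of the constant, so that the measure and probability
    structures can be attached to it. *)
Definition density_measure & (forall x, 0 <= w x)%R & measurable_fun setT w &
  \int[mu]_x (w x)%:E = 1 := fun A : set T => \int[mu]_(x in A) (w x)%:E.

Local Notation dm := (density_measure w0 mw w1).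

Let mwE D : measurable_fun D (EFin \o w).
Proof. by apply: measurable_funTS; exact/measurable_EFinP. Qed.

Let dm0 : dm set0 = 0. Proof. exact: integral_set0. Qed.

Let dm_ge0 A : 0 <= dm A. Proof. by apply: integral_ge0 => x _; rewrite lee_fin. Qed.

Let dm_sigma_additive : semi_sigma_additive dm.
Proof.
move=> /= F mF tF mUF; rewrite /density_measure; apply: cvg_toP.
  apply: ereal_nondecreasing_is_cvgn => m n mn.
  apply: lee_sum_nneg_natr => // k _ _; apply: integral_ge0 => x _.
  by rewrite lee_fin.
rewrite ge0_integral_bigcup//=.
by move=> x _; rewrite lee_fin.
Qed.

HB.instance Definition _ := isMeasure.Build _ _ _ dm dm0 dm_ge0 dm_sigma_additive.

Let dmT : dm setT = 1. Proof. exact: w1. Qed.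

HB.instance Definition _ := @Measure_isProbability.Build _ _ R dm dmT.

Definition density_probability : probability T R := dm.

Import HBNNSimple.

Lemma integral_density (f : T -> \bar R) : (forall x, 0 <= f x) ->
  measurable_fun setT f ->
  \int[density_probability]_x f x = \int[mu]_x (f x * (w x)%:E).
Proof.
move=> f0 mf.
pose h := nnsfun_approx measurableT mf.
have hc x : (h n x)%:E @[n --> \oo] --> f x by exact: cvg_nnsfun_approx.
have hnd x a b : (a <= b)%N -> (h a x <= h b x)%R.
  by move=> ab; exact/lefP/nd_nnsfun_approx.
have mh n : measurable_fun setT (EFin \o h n : T -> \bar R).
  by apply/measurable_EFinP.
rewrite [LHS](eq_integral (fun x => limn (fun n => (h n x)%:E))); last first.
  by move=> x _; apply/esym/cvg_lim; [exact: ereal_hausdorff|exact: hc].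
rewrite monotone_convergence//; last 2 first.
- by move=> n x _; rewrite lee_fin.
- by move=> x _ a b ab; rewrite lee_fin; exact: hnd.
have fwE x : f x * (w x)%:E = limn (fun n => (h n x)%:E * (w x)%:E).
  apply/esym/cvg_lim; first exact: ereal_hausdorff.
  by apply: cvgeZr => //; exact: hc.
rewrite [RHS](eq_integral _ _ (fun x _ => fwE x)).
rewrite [RHS]monotone_convergence//; last 3 first.
- by move=> n; apply: emeasurable_funM; [exact: mh|exact: mwE].
- by move=> n x _; rewrite -EFinM lee_fin mulr_ge0.
- by move=> x _ a b ab; rewrite -!EFinM lee_fin ler_wpM2r// hnd.
congr (limn _); apply/funext => n.
transitivity (\int[density_probability]_x
   (\sum_(y \in range (h n)) (y * \1_(h n @^-1` [set y]) x)%:E)).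
  by apply: eq_integral => t tE; rewrite /= fimfunE -fsumEFin.
have indich r : measurable_fun setT (fun x => (r * \1_(h n @^-1` [set r]) x)%:E).
  by apply: (measurable_comp measurableT) => //; exact: measurable_funM.
rewrite ge0_integral_fsum//; last by move=> y x _; exact: nnfun_muleindic_ge0.
transitivity (\int[mu]_x (\sum_(y \in range (h n))
    (y * \1_(h n @^-1` [set y]) x)%:E * (w x)%:E)); last first.
  apply: eq_integral => x _.
  rewrite -ge0_mule_fsuml => [|y]; last exact: nnfun_muleindic_ge0.
  by rewrite fsumEFin // -(fimfunE _ x).
rewrite ge0_integral_fsum//; last 2 first.
- by move=> y; apply: emeasurable_funM.
- by move=> y x _; apply: mule_ge0; [exact: nnfun_muleindic_ge0|rewrite lee_fin].
apply: eq_fsbigr => r rhn.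
under eq_integral do rewrite EFinM.
rewrite integralZl_indic_nnsfun => //.
under [RHS]eq_integral do rewrite EFinM -muleA.
have mA : measurable (h n @^-1` [set r]) by [].
have r0 : (0 <= r)%R.
  by move: rhn; rewrite inE => -[x _ <-].
rewrite ge0_integralZl//; last 2 first.
- by apply: emeasurable_funM => //; exact/measurable_EFinP.
- by move=> x _; rewrite -EFinM lee_fin mulr_ge0.
congr (_ * _); rewrite integral_indic// setIT.
rewrite /= /density_measure [LHS]integral_mkcond.
by apply: eq_integral => x _; rewrite epatch_indic muleC.
Qed.

End density.

(** * Laplace transforms of distributions on the half-line *)

Section probability_of_measure.
Context d (T : measurableType d) (R : realType).
Variables (m : {measure set T -> \bar R}) (m1 : m setT = 1%E).

(** A copy of [m] that carries the proof of total mass 1, to which a probability structure can be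
    attached. *)
Definition measure_with_mass1 & m setT = 1%E : set T -> \bar R := m.

HB.instance Definition _ := Measure.copy (measure_with_mass1 m1) m.

HB.instance Definition _ :=
  @Measure_isProbability.Build _ _ R (measure_with_mass1 m1) m1.

Lemma probability_of_measure :
  exists P : probability T R, (P : set T -> \bar R) = m.
Proof. by exists (measure_with_mass1 m1). Qed.

End probability_of_measure.

Section laplace_class.
Context (R : realType).
Implicit Types (f g : R -> R).
Local Open Scope ereal_scope.

(** The law is given as that of a variable [X] on an arbitrary probability space, so that
    independent sums live on product spaces; [is_laplace_real] brings it back to the line. *)
Definition is_laplace f : Prop :=
  exists (d : measure_display) (T : measurableType d) (P : probability T R)
    (X : T -> R), [/\ measurable_fun setT X, (forall t, 0 <= X t)%R &
    forall x : R, (0 < x)%R -> \int[P]_t (expR (- (x * X t)))%:E = (f x)%:E].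

Lemma eq_is_laplace f g : (forall x, (0 < x)%R -> f x = g x) ->
  is_laplace f -> is_laplace g.
Proof.
move=> fg [d [T [P [X [mX X0 XE]]]]]; exists d, T, P, X; split => // x x0.
by rewrite XE// fg.
Qed.

Lemma measurable_expRM (d : measure_display) (T : measurableType d) (X : T -> R)
  (x : R) : measurable_fun setT X ->
  measurable_fun setT (fun t => (expR (- (x * X t)))%:E).
Proof.
move=> mX; apply/measurable_EFinP; apply: measurableT_comp => //.
by apply: measurableT_comp => //; exact: measurable_funM.
Qed.

(** The absolute value keeps the integrand bounded by 1 on the whole line and changes nothing on the
    half-line, where [Q] is concentrated. *)
Lemma is_laplace_real f : is_laplace f ->
  exists Q : probability (measurableTypeR R) R, Q `[0%R, +oo[%classic = 1 /\
    forall x : R, (0 < x)%R -> \int[Q]_t (expR (- (x * `|t|%R)))%:E = (f x)%:E.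
Proof.
move=> [d [T [P [X [mX X0 XE]]]]].
pose Y : {mfun T >-> measurableTypeR R} := HB.pack X
  (isMeasurableFun.Build _ _ T (measurableTypeR R) X mX).
exists (distribution P Y); split.
  rewrite /distribution /pushforward -(@probability_setT _ _ _ P); congr (P _).
  by apply/seteqP; split => // t _ /=; rewrite in_itv/= andbT.
move=> x x0; rewrite ge0_integral_distribution//; last first.
  by apply: measurable_expRM; exact: normr_measurable.
by rewrite -XE//; apply: eq_integral => t _ /=; rewrite ger0_norm.
Qed.

Lemma is_laplace1 : is_laplace (fun=> 1%R).
Proof.
exists _, (measurableTypeR R), (dirac (0%R : measurableTypeR R)), (fun=> 0%R); split => //.
move=> x x0; rewrite integral_dirac//.
by rewrite diracT mul1e mulr0 oppr0 expR0.
Qed.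

Lemma product_probability d (T : measurableType d) d' (T' : measurableType d')
    (P : probability T R) (P' : probability T' R) :
  exists Q : probability (T * T')%type R, (Q : set (T * T') -> \bar R) = (P \x P').
Proof.
apply: probability_of_measure.
rewrite -setXTT; apply: (eq_trans (product_measure1E _ _ _ _)) => //.
by rewrite -[RHS]mule1; congr (_ * _); exact: probability_setT.
Qed.

Lemma laplaceD d (T : measurableType d) d' (T' : measurableType d')
    (P : probability T R) (P' : probability T' R) (X : T -> R) (X' : T' -> R)
    (x u v : R) : measurable_fun setT X -> measurable_fun setT X' ->
  \int[P]_t (expR (- (x * X t)))%:E = u%:E ->
  \int[P']_t (expR (- (x * X' t)))%:E = v%:E ->
  \int[P \x P']_z (expR (- (x * (X z.1 + X' z.2))))%:E = (u * v)%:E.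
Proof.
move=> mX mX' XE XE'.
have mX1 : measurable_fun setT (fun z : T * T' => X z.1).
  by apply: (measurableT_comp mX); exact: measurable_fst.
have mX2 : measurable_fun setT (fun z : T * T' => X' z.2).
  by apply: (measurableT_comp mX'); exact: measurable_snd.
rewrite fubini_tonelli1//; last first.
  by apply: measurable_expRM; exact: measurable_funD.
rewrite /fubini_F/= EFinM -XE' // -XE//.
rewrite muleC -ge0_integralZl//; last 2 first.
- exact: measurable_expRM.
- by apply: integral_ge0 => t _; rewrite lee_fin expR_ge0.
apply: eq_integral => t _; rewrite muleC -ge0_integralZl//; last first.
  exact: measurable_expRM.
by apply: eq_integral => t' _; rewrite -EFinM -expRD mulrDr opprD.
Qed.

Lemma is_laplaceM f g : is_laplace f -> is_laplace g ->
  is_laplace (fun x => f x * g x)%R.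
Proof.
move=> [d [T [P [X [mX X0 XE]]]]] [d' [T' [P' [X' [mX' X'0 XE']]]]].
have [Q QE] := product_probability P P'.
exists _, (T * T')%type, Q, (fun z => X z.1 + X' z.2)%R; split.
- apply: measurable_funD.
    by apply: (measurableT_comp mX); exact: measurable_fst.
  by apply: (measurableT_comp mX'); exact: measurable_snd.
- by move=> z; rewrite addr_ge0.
by move=> x x0; rewrite QE; apply: laplaceD => //; [exact: XE|exact: XE'].
Qed.

Lemma is_laplaceX f n : is_laplace f -> is_laplace (fun x => f x ^+ n)%R.
Proof.
move=> lf; elim: n => [|n IH]; first exact: is_laplace1.
by apply: eq_is_laplace (is_laplaceM lf IH) => x _; rewrite exprS.
Qed.

Lemma is_laplace_mixture (c : nat -> R) (h : nat -> R -> R) f :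
  (forall n, 0 <= c n)%R -> \sum_(n <oo) (c n)%:E = 1 ->
  (forall n, is_laplace (h n)) ->
  (forall x, (0 < x)%R -> (f x)%:E = \sum_(n <oo) (c n * h n x)%:E) ->
  is_laplace f.
Proof.
move=> c0 c1 lh fE.
have /choice[Q QE] := fun n => is_laplace_real (lh n).
pose m := mseries (fun n => mscale (NngNum (c0 n)) (Q n)) 0.
have [P PE] : exists P : probability (measurableTypeR R) R,
    (P : set (measurableTypeR R) -> \bar R) = m.
  apply: probability_of_measure.
  rewrite /m /= /mseries -c1; apply: eq_eseriesr => n _.
  by rewrite /mscale/= -[RHS]mule1; congr (_ * _); exact: probability_setT.
exists _, (measurableTypeR R), P, (fun t => `|t|)%R; split => //.
  exact: normr_measurable.
move=> x x0; rewrite PE ge0_integral_measure_series//; last first.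
  by apply: measurable_expRM; exact: normr_measurable.
rewrite fE//; apply: eq_eseriesr => n _.
rewrite ge0_integral_mscale//; last first.
  by apply: measurable_expRM; exact: normr_measurable.
by rewrite (QE n).2// EFinM.
Qed.

(** Expanding exp (l f) exhibits the function as the mixture of the powers f^n with Poisson weights:
    the law of a Poisson number of independent summands. *)
Lemma is_laplace_compound_poisson f (l : R) : (0 <= l)%R -> is_laplace f ->
  is_laplace (fun x => expR (- (l * (1 - f x))))%R.
Proof.
move=> l0 lf.
have expE (y : R) : (0 <= y)%R ->
    \sum_(n <oo) (y ^+ n / n`!%:R)%:E = (expR y)%:E.
  move=> y0; apply: eseries_EFin.
  by apply: is_cvg_series_exp_coeff.
have f0 x : (0 < x)%R -> (0 <= f x)%R.
  move: lf => [d [T [P [X [mX X0 XE]]]]] x0.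
  by rewrite -lee_fin -XE//; apply: integral_ge0 => t _; rewrite lee_fin expR_ge0.
have ce n : (0 <= expR (- l) * (l ^+ n / n`!%:R))%R.
  by rewrite mulr_ge0 ?expR_ge0// divr_ge0// exprn_ge0.
apply: (@is_laplace_mixture (fun n => expR (- l) * (l ^+ n / n`!%:R))%R
  (fun n x => f x ^+ n)%R) => //.
- under eq_eseriesr do rewrite EFinM.
  rewrite nneseriesZl//; last first.
    by move=> n _; rewrite lee_fin divr_ge0// exprn_ge0.
  by rewrite expE// -EFinM -expRD addNr expR0.
- by move=> n; exact: is_laplaceX.
move=> x x0.
rewrite (eq_eseriesr (g := fun n => (expR (- l))%:E * ((l * f x) ^+ n / n`!%:R)%:E)); last first.
  by move=> n _; rewrite -EFinM exprMn; congr EFin; ring.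
rewrite nneseriesZl//; last first.
  by move=> n _; rewrite lee_fin divr_ge0// exprn_ge0// mulr_ge0// f0.
rewrite expE ?mulr_ge0 ?f0// -EFinM -expRD; congr (expR _)%:E; ring.
Qed.

End laplace_class.

(** * Laplace transforms through distribution functions *)

Section laplace_cdf.
Context (R : realType).
Local Open Scope ereal_scope.
Local Notation mu := (@lebesgue_measure R).

(** Write exp (- x X) as the integral of x exp (- x s) over s > X and exchange the integrals by
    Tonelli. In this form pointwise limits of distribution functions pass to the transforms. *)
Lemma laplace_cdf d (T : measurableType d) (P : probability T R) (X : T -> R)
    (x : R) : measurable_fun setT X -> (forall t, 0 <= X t)%R -> (0 < x)%R ->
  \int[P]_t (expR (- (x * X t)))%:E =
  \int[mu]_s ((x * expR (- (x * s)))%:E * P [set t | X t <= s]%R).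
Proof.
move=> mX X0 x0.
pose A := [set z : T * measurableTypeR R | X z.1 <= z.2]%R.
have mA : measurable A.
  have -> : A = (fun z : T * measurableTypeR R => (z.2 - X z.1)%R) @^-1` `[0%R, +oo[.
    by apply/seteqP; split => z; rewrite /A/= in_itv/= andbT subr_ge0.
  rewrite -[X in measurable X]setTI.
  apply: (measurable_funB (f := fun z : T * measurableTypeR R => z.2 : R)) => //.
  - exact: measurable_snd.
  - by apply: (measurableT_comp mX); exact: measurable_fst.
pose e (s : measurableTypeR R) : R := (x * expR (- (x * s)))%R.
have me : measurable_fun setT e.
  apply: measurable_funM => //; apply: measurableT_comp => //.
  by apply: measurableT_comp => //; exact: measurable_funM.
have e0 s : (0 <= e s)%R by rewrite mulr_ge0 ?expR_ge0 ?ltW.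
pose F (z : T * measurableTypeR R) := (e z.2 * \1_A z)%:E.
have mF : measurable_fun setT F.
  apply/measurable_EFinP; apply: measurable_funM; last exact: measurable_indic.
  by apply: (measurableT_comp me); exact: measurable_snd.
have F0 z : 0 <= F z by rewrite lee_fin mulr_ge0.
transitivity (\int[P]_t \int[mu]_s F (t, s)).
  apply: eq_integral => t _; rewrite -(integral_exp_tail _ x0).
  rewrite integral_itv_obnd_cbnd; last first.
    by apply/measurable_EFinP; exact: measurable_funTS.
  rewrite integral_mkcond; apply: eq_integral => s _.
  rewrite /F/= patchE indicE; case: ifPn => sX.
    rewrite mem_set ?mulr1//; move: sX; rewrite inE/= in_itv/= andbT; exact.
  rewrite memNset ?mulr0//; move: sX; rewrite notin_setE/= in_itv/= andbT; exact.
rewrite (fubini_tonelli _ mF F0); apply: eq_integral => s _.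
rewrite /F/=.
under eq_integral do rewrite EFinM.
rewrite ge0_integralZl//.
- rewrite (_ : (fun t => (\1_A (t, s))%:E) = (fun t => (\1_[set t | X t <= s]%R t)%:E)).
    rewrite integral_indic ?setIT//.
    have -> : [set t | X t <= s]%R = X @^-1` `]-oo, s].
      by apply/seteqP; split => t /=; rewrite in_itv.
    rewrite -[X in measurable X]setTI; exact: mX.
  by apply/funext => t.
- apply/measurable_EFinP.
  have mI : measurable_fun setT (\1_A : T * measurableTypeR R -> R).
    exact: measurable_indic.
  by apply: (measurableT_comp mI); exact: measurable_pair2.
- by rewrite lee_fin.
Qed.

Lemma is_laplace_of_cdf (G f : R -> R) :
  {homo G : s t / (s <= t)%R} -> right_continuous G ->
  (forall s, (s < 0)%R -> G s = 0%R) -> G s @[s --> +oo%R] --> (1%R : R) ->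
  (forall x, (0 < x)%R ->
    \int[mu]_s ((x * expR (- (x * s))) * G s)%:E = (f x)%:E) ->
  is_laplace f.
Proof.
move=> ndG rcG G0 G1 fE.
have GNy : G s @[s --> -oo%R] --> (0%R : R).
  apply: cvg_near_cst.
  by exists 0%R; split; [exact: num_real|move=> s /= /G0].
pose Gc : cumulativeBounded (0 : R) (1 : R) := HB.pack G
  (isCumulative.Build R _ R G ndG rcG) (isCumulativeBounded.Build R 0%R 1%R G GNy G1).
pose P : probability (measurableTypeR R) R := lebesgue_stieltjes_measure Gc.
(* Truncation at 0 makes [X] nonnegative everywhere; as [G] vanishes on the negative reals, the
   distribution function is unchanged. *)
pose X (t : measurableTypeR R) : R := Num.max (t : R) 0%R.
have mX : measurable_fun setT X by apply: measurable_maxr.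
have X0 t : (0 <= X t)%R by rewrite le_max lexx orbT.
exists _, (measurableTypeR R), P, X; split => // x x0.
rewrite laplace_cdf// -fE//; apply: eq_integral => s _.
rewrite [RHS]EFinM; congr (_ * _).
have [s0|s0] := ltP s 0%R.
  rewrite (_ : [set t | _] = set0) ?measure0 ?G0//.
  apply/seteqP; split => // t /= Xts.
  by have := le_lt_trans (X0 t) (le_lt_trans Xts s0); rewrite ltxx.
rewrite (_ : [set t | _] = `]-oo, s]%classic); last first.
  by apply/seteqP; split => t /=; rewrite in_itv/= /X ge_max s0 andbT.
exact: (cdf_lebesgue_stieltjes_id Gc s).
Qed.

End laplace_cdf.

(** * Infinite products of Laplace transforms *)

Section infinite_product.
Context (R : realType).
Local Open Scope ereal_scope.
Local Notation mu := (@lebesgue_measure R).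
Local Notation RR := (measurableTypeR R).

Let m1 : measurable_fun setT (fun t : RR => `|t|%R : R).
Proof. exact: normr_measurable. Qed.

Let abs : {mfun RR >-> R} := HB.pack (fun t : RR => `|t|%R : R)
  (isMeasurableFun.Build _ _ RR R (fun t : RR => `|t|%R : R) (@normr_measurable R setT)).

Let F (Q : probability RR R) s := fine (cdf (abs : {RV Q >-> R}) s).

Let cdfE (Q : probability RR R) s : Q [set t | `|t| <= s]%R = (F Q s)%:E.
Proof.
rewrite /F fineK; last by rewrite fin_num_measure.
rewrite /cdf /distribution /pushforward; congr (Q _).
Qed.

Let F01 Q s : (0 <= F Q s <= 1)%R.
Proof. by rewrite -!lee_fin /F fineK ?fin_num_measure// cdf_ge0 cdf_le1. Qed.

Let F_lt0 Q s : (s < 0)%R -> F Q s = 0%R.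
Proof.
move=> s0; apply/EFin_inj; rewrite -cdfE (_ : [set t | _] = set0) ?measure0//.
apply/seteqP; split => // t /= ts.
by have := le_lt_trans (normr_ge0 t) (le_lt_trans ts s0); rewrite ltxx.
Qed.

Let F_nd Q s t : (s <= t)%R -> (F Q s <= F Q t)%R.
Proof. by move=> st; rewrite fine_le ?fin_num_measure// cdf_nondecreasing. Qed.

Let F_rc Q : right_continuous (F Q).
Proof.
move=> a; apply: fine_cvg.
by rewrite fineK ?fin_num_measure//; exact: cdf_right_continuous.
Qed.

(** Adding an independent nonnegative variable can only lower the distribution function. This
    monotonicity stands in for a compactness argument. *)
Let mulstep (Q : probability RR R) (u h : R -> R) :
  (forall x, (0 < x)%R -> \int[Q]_t (expR (- (x * `|t|%R)))%:E = (u x)%:E) ->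
  is_laplace h ->
  exists Q' : probability RR R,
    (forall x, (0 < x)%R -> \int[Q']_t (expR (- (x * `|t|%R)))%:E = (u x * h x)%:E)
    /\ forall s, (F Q' s <= F Q s)%R.
Proof.
move=> uE [d [T [P [X [mX X0 XE]]]]].
have [M ME] := product_probability Q P.
pose Yf (z : RR * T) : RR := (`|z.1| + X z.2)%R.
have mY : measurable_fun setT Yf.
  apply: measurable_funD.
    by apply: (measurableT_comp (@normr_measurable R setT)); exact: measurable_fst.
  by apply: (measurableT_comp mX); exact: measurable_snd.
pose Y : {mfun (RR * T)%type >-> RR} := HB.pack Yf
  (isMeasurableFun.Build _ _ (RR * T)%type RR Yf mY).
have Y0 z : (0 <= Y z)%R by rewrite addr_ge0.
exists (distribution M Y); split.
  move=> x x0; rewrite ge0_integral_distribution//; last first.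
    by apply: measurable_expRM; exact: normr_measurable.
  transitivity (\int[Q \x P]_z (expR (- (x * (`|z.1| + X z.2)%R)))%:E).
    rewrite -ME; apply: eq_integral => z _ /=.
    by rewrite ger0_norm ?Y0.
  have := laplaceD m1 mX (uE x x0) (XE x x0).
  exact.
move=> s; rewrite -lee_fin -!cdfE /distribution /pushforward.
pose A : set RR := [set t : RR | `|t| <= s]%R.
have mA : measurable A.
  have -> : A = abs @^-1` `]-oo, s].
    by apply/seteqP; split => t /=; rewrite /A/= in_itv.
  by rewrite -[X in measurable X]setTI; exact: measurable_funP.
have QM : Q A = M (A `*` setT).
  rewrite ME product_measure1E// -[LHS]mule1; congr (_ * _).
  by apply/esym; exact: probability_setT.
rewrite -/A QM.
suff : M (Y @^-1` A : set (RR * T)) <= M (A `*` setT : set (RR * T)) by [].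
apply: (@le_measure _ _ _ M); rewrite ?inE.
- by have := mY measurableT A mA; rewrite setTI.
- exact: measurableX.
- move=> z; rewrite /A/= ger0_norm ?Y0// => zs; split => //=.
  by apply: le_trans zs; rewrite lerDl.
Qed.

(** The distribution functions of the partial products decrease to a function [G], and dominated
    convergence identifies the transform of [G] with [f]. The values of [f] close to 1 prevent mass
    from escaping to infinity, so that [G] tends to 1. *)
Lemma is_laplace_infinite_product (h : nat -> R -> R) (f : R -> R) :
  (forall i, is_laplace (h i)) ->
  (forall x, (0 < x)%R -> (\prod_(i < n) h i x)%R @[n --> \oo] --> f x) ->
  (forall e, (0 < e)%R -> exists2 x, (0 < x)%R & (1 - e < f x)%R) ->
  is_laplace f.
Proof.
move=> lh hf f1.
pose A n (Q : probability RR R) := forall x, (0 < x)%R ->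
  \int[Q]_t (expR (- (x * `|t|%R)))%:E = (\prod_(i < n) h i x)%R%:E.
have A0 : exists Q, A 0%N Q.
  exists (dirac (0%R : RR)) => x x0; rewrite integral_dirac//; last first.
    by apply: measurable_expRM; exact: normr_measurable.
  by rewrite diracT mul1e normr0 mulr0 oppr0 expR0 big_ord0.
have AS n Q : A n Q -> exists Q', A n.+1 Q' /\ forall s, (F Q' s <= F Q s)%R.
  move=> AQ; have [Q' [Q'1 Q'2]] := mulstep AQ (lh n).
  by exists Q'; split => // x x0; rewrite Q'1// big_ord_recr.
(* The laws are chosen recursively, each one built from its predecessor, because the comparison of
   distribution functions links consecutive choices. *)
pose S := fix S n : {Q | A n Q} := match n with
  | O => cid A0
  | k.+1 => let Q := S k in
            let Q' := cid (AS k (projT1 Q) (projT2 Q)) in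
            exist _ (projT1 Q') (proj1 (projT2 Q'))
  end.
pose Q n := projT1 (S n).
have AQ n : A n (Q n) := projT2 (S n).
have QS n s : (F (Q n.+1) s <= F (Q n) s)%R.
  by rewrite /Q /=; case: cid => Q' /= [].
pose G s := limn (fun n => F (Q n) s).
have Fnd s : nonincreasing_seq (fun n => F (Q n) s).
  by apply/nonincreasing_seqP => n.
have Gcvg s : F (Q n) s @[n --> \oo] --> G s.
  apply: nonincreasing_is_cvgn => //.
  by exists 0%R => _ [n _ <-]; have /andP[] := F01 (Q n) s.
have GF n s : (G s <= F (Q n) s)%R.
  by apply: nonincreasing_cvgn_ge => //; apply/cvg_ex; exists (G s).
have G0 s : (0 <= G s)%R.
  apply: limr_ge; first by apply/cvg_ex; exists (G s).
  by apply: nearW => n; have /andP[] := F01 (Q n) s.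
have G1 s : (G s <= 1)%R.
  by apply: le_trans (GF 0%N s) _; have /andP[] := F01 (Q 0%N) s.
have Glt0 s : (s < 0)%R -> G s = 0%R.
  by move=> s0; apply/le_anti; rewrite G0 (le_trans (GF 0%N s))// F_lt0.
have ndG : {homo G : s t / (s <= t)%R}.
  move=> s t st; apply: ler_lim.
  - by apply/cvg_ex; exists (G s).
  - by apply/cvg_ex; exists (G t).
  - by apply: nearW => n; exact: F_nd.
have rcG : right_continuous G.
  move=> a; apply/cvgrPdist_lt => e e0.
  (* An infimum of nondecreasing right-continuous functions is right-continuous: one [F (Q n)] that
     is close to [G] at [a] controls [G] to the right of [a]. *)
  have [n Fn] : exists n, (F (Q n) a < G a + e)%R.
    have /cvgrPdist_lt/(_ e e0)[n _ /(_ n (leqnn n))/=] := Gcvg a.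
    rewrite distrC => /ltr_distlDr ?; exists n; lra.
  have : (\forall s \near a^'+, (F (Q n) s < G a + e)%R).
    move: (@F_rc (Q n) a) => H; exact: (cvgr_lt _ H _ Fn).
  apply: filter_app; near=> s => Fs.
  have as_ : (a <= s)%R by near: s; exact: nbhs_right_ge.
  rewrite ler0_norm ?subr_le0; last exact: ndG.
  by rewrite opprB ltrBlDl (le_lt_trans (GF n s)).
(* The kernel is cut at 0, since x exp (- x s) is not integrable on the negative side. Cut, it is a
   probability density and serves as the majorant. *)
pose g (x : R) : RR -> R := fun s => (x * expR (- (x * s)) * \1_(`[0%R, +oo[%classic : set RR) s)%R.
have mg x : measurable_fun setT (g x).
  apply: measurable_funM; last by apply: measurable_indic; exact: measurable_itv.
  apply: measurable_funM => //; apply: measurableT_comp => //.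
  by apply: measurableT_comp => //; exact: measurable_funM.
have g0 x s : (0 < x)%R -> (0 <= g x s)%R.
  by move=> x0; rewrite mulr_ge0// mulr_ge0 ?expR_ge0 ?ltW.
have intg x : (0 < x)%R -> \int[mu]_s (g x s)%:E = 1.
  move=> x0; rewrite -[RHS](_ : (expR (- (x * 0)))%:E = 1); last first.
    by rewrite mulr0 oppr0 expR0.
  rewrite -(integral_exp_tail _ x0) integral_itv_obnd_cbnd; last first.
    apply/measurable_EFinP; apply: measurable_funM => //; apply: measurableT_comp => //.
    by apply: measurableT_comp => //; exact: measurable_funM.
  rewrite [RHS]integral_mkcond; apply: eq_integral => s _.
  by rewrite patchE /g indicE; case: ifPn; rewrite ?mulr1 ?mulr0.
have gH (H : R -> R) x s : (forall t, (t < 0)%R -> H t = 0%R) ->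
    (x * expR (- (x * s)) * H s = g x s * H s)%R.
  move=> H0; rewrite /g indicE; have [s0|s0] := ltP s 0%R.
    by rewrite H0// !mulr0.
  by rewrite mem_set ?mulr1//= in_itv/= s0.
have GE x : (0 < x)%R -> \int[mu]_s ((x * expR (- (x * s))) * G s)%:E = (f x)%:E.
  move=> x0.
  rewrite (eq_integral (fun s => (g x s * G s)%:E)); last first.
    by move=> s _; rewrite gH.
  have FE n : \int[mu]_s (g x s * F (Q n) s)%:E = (\prod_(i < n) h i x)%R%:E.
    rewrite -AQ// (laplace_cdf (Q n) m1 _ x0)//.
    by apply: eq_integral => s _; rewrite cdfE -EFinM gH//; exact: F_lt0.
  have mgF n : measurable_fun setT (fun s => (g x s * F (Q n) s)%:E).
    apply/measurable_EFinP; apply: measurable_funM; first exact: mg.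
    by apply: nondecreasing_measurable => //; exact: F_nd.
  have mgG : measurable_fun setT (fun s => (g x s * G s)%:E).
    apply/measurable_EFinP; apply: measurable_funM; first exact: mg.
    by apply: nondecreasing_measurable.
  have := @dominated_convergence _ RR R mu setT measurableT
    (fun n s => (g x s * F (Q n) s)%:E) (fun s => (g x s * G s)%:E)
    (fun s => (g x s)%:E) mgF mgG.
  case => //.
  - apply: nearW => s _; apply: cvg_EFin; first exact: nearW.
    by apply: cvgM; [exact: cvg_cst|exact: Gcvg].
  - apply/integrableP; split; first by apply/measurable_EFinP; exact: mg.
    under eq_integral do rewrite gee0_abs ?lee_fin ?g0//.
    by rewrite intg// ltry.
  - apply: nearW => s n _; have /andP[Fn0 Fn1] := F01 (Q n) s.
    rewrite gee0_abs lee_fin; last by apply: mulr_ge0 => //; exact: g0.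
    by apply: ler_piMr => //; exact: g0.
  move=> _ _ cv.
  apply: (cvg_unique _ cv); first exact: ereal_hausdorff.
  rewrite (_ : (fun n => _) = (fun n => (\prod_(i < n) h i x)%R%:E)); last first.
    by apply/funext => n; rewrite /= FE.
  by apply: cvg_EFin; [exact: nearW|exact: hf].
apply: (is_laplace_of_cdf ndG rcG Glt0 _ GE).
apply/cvgrPdist_lt => e e0.
(* If [G] stayed below 1 - e, integrating it against the density [g x] would give f x <= 1 - e for
   every x > 0. *)
have [s0 Gs0] : exists s, (1 - e < G s)%R.
  apply: contrapT => /forallNP nG.
  have [x x0] := f1 e e0; apply/negP; rewrite -leNgt -lee_fin -GE//.
  rewrite -[leRHS]mule1 -(intg x x0) -ge0_integralZl//; last 3 first.
  - by apply/measurable_EFinP; exact: mg.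
  - by move=> s _; rewrite lee_fin g0.
  - rewrite lee_fin; apply: le_trans (G0 0%R) _.
    by rewrite leNgt; apply/negP; exact: nG.
  apply: ge0_le_integral => //.
  - by move=> s _; rewrite lee_fin mulr_ge0// mulr_ge0 ?expR_ge0 ?ltW.
  - apply/measurable_EFinP; apply: measurable_funM; last exact: nondecreasing_measurable.
    apply: measurable_funM => //; apply: measurableT_comp => //.
    by apply: measurableT_comp => //; exact: measurable_funM.
  - apply/measurable_EFinP; apply: measurable_funM => //; exact: mg.
  - move=> s _; rewrite gH// lee_fin mulrC; apply: ler_wpM2r; first exact: g0.
    by rewrite leNgt; apply/negP; exact: nG.
near=> s.
rewrite ger0_norm ?subr_ge0// ltrBlDr -ltrBlDl (lt_le_trans Gs0)// ndG//.
Unshelve. all: by end_near. Qed.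

End infinite_product.

(** * Mixtures of exponential distributions and exponentials of potentials *)

Section exponential_mixture.
Context (R : realType).
Local Open Scope ereal_scope.
Local Notation mu := (@lebesgue_measure R).
Local Notation RR := (measurableTypeR R).

Let m1 : measurable_fun setT (fun t : RR => `|t|%R : R).
Proof. exact: normr_measurable. Qed.

Let pdf : RR -> R := @exponential_pdf R 1.

Let pdf0 t : (0 <= pdf t)%R. Proof. exact: exponential_pdf_ge0. Qed.

Let mpdf : measurable_fun setT pdf. Proof. exact: measurable_exponential_pdf. Qed.

Let pdf1 : \int[mu]_x (pdf x)%:E = 1. Proof. exact: integral_exponential_pdf. Qed.

Let expo : probability RR R := density_probability pdf0 mpdf pdf1.

Let laplace_expo (y : R) : (0 <= y)%R ->
  \int[expo]_t (expR (- (y * `|t|%R)))%:E = ((1 + y)^-1)%:E.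
Proof.
move=> y0; have y1 : (0 < 1 + y)%R by rewrite ltr_wpDr.
have me (z : R) : measurable_fun setT (fun t : RR => expR (- (z * t))).
  apply/measurable_EFinP.
  exact: (measurable_expRM (X := fun t : RR => t : R) z (@measurable_id _ _ _)).
have me' : measurable_fun setT (fun t : RR => (1 + y) * expR (- ((1 + y) * t)))%R.
  by apply: measurable_funM => //; exact: me.
rewrite integral_density//; last exact: measurable_expRM.
transitivity (\int[mu]_(t in `[0%R, +oo[)
    ((1 + y)^-1%:E * ((1 + y) * expR (- ((1 + y) * t)))%:E)).
  rewrite [RHS]integral_mkcond; apply: eq_integral => t _.
  rewrite patchE /pdf /exponential_pdf patchE; case: ifPn; last by rewrite mule0.
  rewrite inE/= in_itv/= andbT => t0.
  rewrite -[LHS]EFinM -[RHS]EFinM mulKf ?gt_eqF// ger0_norm// mul1r -expRD.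
  by congr (expR _)%:E; ring.
rewrite ge0_integralZl//; last 3 first.
- by apply/measurable_EFinP; apply: measurable_funTS; exact: me'.
- by move=> t _; rewrite lee_fin mulr_ge0 ?expR_ge0// ltW.
- by rewrite lee_fin invr_ge0 ltW.
rewrite -integral_itv_obnd_cbnd; last first.
  by apply/measurable_EFinP; apply: measurable_funTS; exact: me'.
by rewrite integral_exp_tail// mulr0 oppr0 expR0 mule1.
Qed.

(** 1 / (1 + x v) is the transform of v times a standard exponential variable; here [V] is
    multiplied by an independent one. *)
Lemma is_laplace_exp_mixture d (T : measurableType d) (P : probability T R)
    (V : T -> R) (f : R -> R) :
  measurable_fun setT V -> (forall t, 0 <= V t)%R ->
  (forall x, (0 < x)%R -> \int[P]_t ((1 + x * V t)^-1)%:E = (f x)%:E) ->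
  is_laplace f.
Proof.
move=> mV V0 fE.
have [Q QE] := product_probability P expo.
have mX : measurable_fun setT (fun z : T * RR => V z.1 * `|z.2|)%R.
  apply: measurable_funM.
    by apply: (measurableT_comp mV); exact: measurable_fst.
  by apply: (measurableT_comp m1); exact: measurable_snd.
exists _, (T * RR)%type, Q, (fun z => V z.1 * `|z.2|)%R; split => //.
  by move=> z; rewrite mulr_ge0.
move=> x x0; rewrite QE fubini_tonelli1//; last exact: measurable_expRM.
rewrite -fE//; apply: eq_integral => t _; rewrite /fubini_F/=.
rewrite -laplace_expo; last by apply: mulr_ge0 => //; exact: ltW.
by apply: eq_integral => s _; rewrite mulrA.
Qed.

Section potential.
Variables (w : RR -> R) (mw : measurable_fun setT w) (w0 : forall u, (0 <= w u)%R).

Let mres (x : R) (A : set RR) : measurable_fun A (fun u : RR => (x / (x + u) * w u)%:E).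
Proof.
apply/measurable_EFinP; apply: measurable_funM; last exact: measurable_funTS.
apply: measurable_funM => //; apply: measurable_funTS.
apply: (measurableT_comp (@measurable_invr R)).
exact: measurable_funD.
Qed.

(** On a bounded piece [w] has a finite mass l. As x / (x + u) = 1 - 1 / (1 + x / u), one gets psi x
    = l (1 - E (1 / (1 + x / U))) with U of density w / l, so that exp (- psi) is compound Poisson
    with mixed exponential jumps. *)
Let is_laplace_piece (A : set RR) (c : R) (psi : R -> R) : measurable A ->
  (forall u, A u -> 0 < u <= c)%R ->
  (forall x, (0 < x)%R -> \int[mu]_(u in A) (x / (x + u) * w u)%:E = (psi x)%:E) ->
  is_laplace (fun x => expR (- psi x)).
Proof.
move=> mA Ac psiE.
have mwA : measurable_fun A (EFin \o w).
  by apply/measurable_EFinP; exact: measurable_funTS.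
have wE0 u : 0 <= (w u)%:E by rewrite lee_fin.
have lfin : \int[mu]_(u in A) (w u)%:E < +oo.
  (* On [A] one has 1 <= (1 + c) / (1 + u), so the finite integral at x = 1 bounds the mass of
     [w]. *)
  apply: (@le_lt_trans _ _ ((1 + c)%:E * \int[mu]_(u in A) (1 / (1 + u) * w u)%:E)).
    have c0 u : A u -> (0 <= 1 + c)%R.
      by move=> /Ac/andP[u0 uc]; lra.
    have [->|/set0P[u0 Au0]] := eqVneq A set0.
      by rewrite !integral_set0 mule0.
    rewrite -ge0_integralZl//; last 2 first.
    - move=> u /Ac /andP[u1 uc]; rewrite lee_fin mulr_ge0// divr_ge0//; lra.
    - by rewrite lee_fin (c0 u0).
    apply: ge0_le_integral => //.
    - by apply: measurable_funeM; exact: mres.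
    - move=> u /Ac /andP[u1 uc]; rewrite -EFinM lee_fin mulrA ler_peMl//.
      by rewrite div1r ler_pdivlMr ?mul1r ?lerD2l//; lra.
  by rewrite psiE// -EFinM ltry.
have lge0 : 0 <= \int[mu]_(u in A) (w u)%:E by apply: integral_ge0.
have [l lE] : exists l, \int[mu]_(u in A) (w u)%:E = l%:E.
  exists (fine (\int[mu]_(u in A) (w u)%:E)); rewrite fineK//.
  by rewrite ge0_fin_numE.
have [l0|ln0] := eqVneq l 0%R.
  apply: eq_is_laplace (@is_laplace1 R) => x x0.
  suff -> : psi x = 0%R by rewrite oppr0 expR0.
  have res0 u : A u -> (0 <= x / (x + u) * w u)%R.
    by move=> /Ac /andP[u1 uc]; rewrite mulr_ge0// divr_ge0// ?ltW// addr_gt0.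
  apply/le_anti/andP; split; rewrite -lee_fin -psiE//.
    rewrite -l0 -lE; apply: ge0_le_integral => //.
    - move=> u /Ac /andP[u1 uc]; rewrite lee_fin ler_piMl//.
      by rewrite ler_pdivrMr ?mul1r; lra.
  by apply: integral_ge0 => u Au; rewrite lee_fin res0.
have lp : (0 < l)%R by rewrite lt_neqAle eq_sym ln0 -lee_fin -lE.
pose w' (u : RR) : R := (l^-1 * (w u * \1_A u))%R.
have w'0 u : (0 <= w' u)%R by rewrite mulr_ge0 ?invr_ge0 ?mulr_ge0// ltW.
have mw' : measurable_fun setT w'.
  by apply: measurable_funM => //; apply: measurable_funM => //; exact: measurable_indic.
have restr (g : RR -> R) : (forall u, A u -> (0 <= g u)%R) ->
    measurable_fun A (EFin \o g) ->
    \int[mu]_u (g u * \1_A u / l)%:E = l^-1%:E * \int[mu]_(u in A) (g u)%:E.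
  move=> g0 mg; rewrite -ge0_integralZl//; last by rewrite lee_fin invr_ge0 ltW.
  rewrite [RHS]integral_mkcond; apply: eq_integral => u _.
  rewrite patchE indicE; case: ifPn => _; last by rewrite mulr0 mul0r.
  by rewrite mulr1 mulrC EFinM.
have w'1 : \int[mu]_u (w' u)%:E = 1.
  under eq_integral do rewrite /w' mulrC.
  by rewrite restr// lE -EFinM mulVf.
pose Q := density_probability w'0 mw' w'1.
(* The absolute value only makes [V] nonnegative off [A], where the density [w'] vanishes. *)
pose V (u : RR) : R := (`|u|^-1)%R.
have mV : measurable_fun setT V by apply: (measurableT_comp (@measurable_invr R)).
have V0 u : (0 <= V u)%R by rewrite /V invr_ge0.
apply: eq_is_laplace (is_laplace_compound_poisson (ltW lp)
  (@is_laplace_exp_mixture _ RR Q V (fun x => 1 - psi x / l)%R mV _ _)).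
- by move=> x x0; congr expR; field.
- exact: V0.
move=> x x0.
have xV u : (0 < 1 + x * V u)%R by apply: ltr_wpDr => //; apply: mulr_ge0 => //; exact: ltW.
have mxV : measurable_fun setT (fun u => (1 + x * V u)^-1)%R.
  apply: (measurableT_comp (@measurable_invr R)).
  by apply: measurable_funD => //; exact: measurable_funM.
rewrite integral_density//; last 2 first.
- by move=> u; rewrite lee_fin invr_ge0 ltW.
- exact/measurable_EFinP.
have eqb : \int[mu]_u (x / (x + u) * w u * \1_A u / l)%:E = (psi x / l)%:E.
  rewrite restr//.
  - by rewrite psiE// -EFinM mulrC.
  - by move=> u /Ac /andP[u1 uc]; rewrite mulr_ge0// divr_ge0// ?ltW// addr_gt0.
  - exact: mres.
(* Stated as a sum equal to 1, so that only integrals of nonnegative functions are combined. *)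
suff : \int[mu]_u (((1 + x * V u)^-1)%:E * (w' u)%:E) + (psi x / l)%:E = 1.
  move=> H; rewrite EFinB -H addeK//.
rewrite -eqb -ge0_integralD//; last 4 first.
- by move=> u _; rewrite -EFinM lee_fin mulr_ge0// invr_ge0 ltW.
- by apply: emeasurable_funM; apply/measurable_EFinP.
- move=> u _; rewrite lee_fin indicE; have [/set_mem Au|_] := boolP (u \in A).
    have /andP[u1 _] := Ac u Au.
    by rewrite mulr1 !mulr_ge0 ?invr_ge0// ltW// addr_gt0.
  by rewrite mulr0 mul0r.
- apply/measurable_EFinP; apply: measurable_funM => //.
  apply: measurable_funM; last exact: measurable_indic.
  by have /measurable_EFinP := @mres x setT.
rewrite -w'1; apply: eq_integral => u _.
rewrite -EFinM -EFinD; congr EFin.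
rewrite /w' indicE; have [/set_mem Au|_] := boolP (u \in A); last by rewrite !(mulr0,mul0r) addr0.
have /andP[u1 _] := Ac u Au.
rewrite /V ger0_norm ?ltW//; field.
by rewrite ln0 !gt_eqF// addr_gt0.
Qed.

(** The total mass of [w] may be infinite. The half-line is cut into pieces of length at most 1,
    each giving a compound Poisson factor, and the factors are multiplied. *)
Lemma is_laplace_exp_potential (psi : R -> R) :
  (forall x, (0 < x)%R ->
    \int[mu]_(u in `]0%R, +oo[) (x / (x + u) * w u)%:E = (psi x)%:E) ->
  is_laplace (fun x => expR (- psi x)).
Proof.
move=> psiE.
pose A (k : nat) : set RR := `]0%R, +oo[%classic `&` `[k%:R, k.+1%:R[%classic.
have mA k : measurable (A k) by apply: measurableI; exact: measurable_itv.
have Au k u : A k u -> (0 < u <= k.+1%:R)%R.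
  by rewrite /A/= !in_itv/= andbT => -[-> /andP[_ /ltW]].
have res0 x u : (0 < x)%R -> (0 < u)%R -> 0 <= (x / (x + u) * w u)%:E.
  by move=> x0 u0; rewrite lee_fin mulr_ge0// divr_ge0// ltW// addr_gt0.
have UA : `]0%R, +oo[%classic = \bigcup_k A k :> set RR.
  apply/seteqP; split => u; last by move=> [k _ []].
  move=> u0; exists (Num.truncn u) => //; split => //=.
  rewrite in_itv/= truncnS_gt andbT truncn_le//.
  by move: u0; rewrite /= in_itv/= andbT => /ltW.
have tA : trivIset setT A.
  move=> i j _ _ [u [[_ ui] [_ uj]]].
  move: ui uj; rewrite /= !in_itv/= => /andP[iu ui] /andP[ju uj].
  have := le_lt_trans iu uj; have := le_lt_trans ju ui.
  by rewrite !ltr_nat !ltnS => ji ij; apply/eqP; rewrite eqn_leq ij ji.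
have resA k x u : (0 < x)%R -> A k u -> 0 <= (x / (x + u) * w u)%:E.
  by move=> x0 /Au/andP[u0 _]; exact: res0.
have /choice[p pE] : forall k, exists p : R -> R, forall x, (0 < x)%R ->
    \int[mu]_(u in A k) (x / (x + u) * w u)%:E = (p x)%:E.
  move=> k; exists (fun x => fine (\int[mu]_(u in A k) (x / (x + u) * w u)%:E)) => x x0.
  rewrite fineK// ge0_fin_numE; last by apply: integral_ge0 => u; exact: resA.
  apply: (@le_lt_trans _ _ (psi x)%:E); last exact: ltry.
  rewrite -psiE//; apply: ge0_subset_integral => //.
  - by move=> u /=; rewrite in_itv/= andbT; exact: res0.
  - by move=> u [].
have psiS x : (0 < x)%R -> \sum_(k <oo) (p k x)%:E = (psi x)%:E.
  move=> x0; rewrite -psiE// UA ge0_integral_bigcup//.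
  - by apply: eq_eseriesr => k _; rewrite pE.
  - by move=> u [k _]; exact: resA.
have p0 k x : (0 < x)%R -> (0 <= p k x)%R.
  by move=> x0; rewrite -lee_fin -pE//; apply: integral_ge0 => u; exact: resA.
apply: (@is_laplace_infinite_product _ (fun k x => expR (- p k x))%R).
- by move=> k; apply: (@is_laplace_piece (A k) k.+1%:R) => //; [exact: Au|exact: pE].
- move=> x x0.
  rewrite (_ : (fun n => _) = (fun n => expR (- \sum_(0 <= k < n) p k x))%R); last first.
    by apply/funext => n; rewrite big_mkord -sumrN expR_sum.
  apply: (@cvg_comp _ _ _ (fun n => - \sum_(0 <= k < n) p k x)%R expR); last exact: continuous_expR.
  apply: cvgN.
  exact: (cvg_series_eseries (fun k => p0 k x x0) (psiS x x0)).
move=> e e0.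
(* It remains to see that psi tends to 0 at 0, which excludes a loss of mass. Along this sequence x
   <= 1, and the integrand is dominated by its value at x = 1. *)
pose xs (n : nat) : R := (n.+1%:R^-1)%R.
have xs0 n : (0 < xs n)%R by rewrite /xs invr_gt0.
have xs1 n : (xs n <= 1)%R by rewrite /xs invf_le1 ?ler1n.
have resD x u : (0 < x)%R -> `]0%R, +oo[%classic u -> 0 <= (x / (x + u) * w u)%:E.
  by move=> x0; rewrite /= in_itv/= andbT => u0; exact: res0.
have := @dominated_convergence _ RR R mu `]0%R, +oo[%classic (measurable_itv _)
  (fun n u => (xs n / (xs n + u) * w u)%:E) (cst 0) (fun u => (1 / (1 + u) * w u)%:E).
case => //.
- apply: nearW => u; rewrite /= in_itv/= andbT => u0.
  apply: cvg_EFin; first exact: nearW.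
  rewrite -[X in _ --> X](mul0r (w u : R)); apply: cvgM; last exact: cvg_cst.
  rewrite -[X in _ --> X](mul0r (0 + u : R)^-1%R); apply: cvgM; first exact: cvg_harmonic.
  apply: cvgV; first by rewrite add0r gt_eqF.
  by apply: cvgD; [exact: cvg_harmonic|exact: cvg_cst].
- apply/integrableP; split; first exact: mres.
  rewrite (eq_integral (fun u : RR => (1 / (1 + u) * w u)%:E)).
    by rewrite psiE// ltry.
  by move=> u /set_mem uD; rewrite gee0_abs// resD.
- apply: nearW => u n; rewrite /= in_itv/= andbT => u0.
  rewrite lee_fin ger0_norm; last by rewrite -lee_fin res0.
  apply: ler_wpM2r => //.
  rewrite div1r ler_pdivrMr ?addr_gt0// mulrC ler_pdivlMr ?addr_gt0//.
  by rewrite mulrDr mulr1 lerD2l ler_piMl// ltW.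
rewrite integral0 => _ _ cv.
have psi0 : psi (xs n) @[n --> \oo] --> (0 : R)%R.
  move: cv; rewrite (_ : (fun n => _) = EFin \o (psi \o xs)); last first.
    by apply/funext => n; rewrite /= psiE.
  by move/fine_cvg.
have /cvgrPdist_lt/(_ e e0)[n _ /(_ n (leqnn n))] := psi0.
rewrite /= sub0r normrN => pe.
exists (xs n) => //; apply: lt_le_trans (expR_ge1Dx _).
by rewrite ltrD2l ltrN2 (le_lt_trans (ler_norm _)).
Qed.

End potential.
End exponential_mixture.

(** * Real-rooted polynomials *)

Section real_rooted.
Context (R : realType).
Implicit Types (s : seq R).

(** Indexing by the negated inverses of the roots normalises the value at 0 to 1, and t = 0 gives a
    trivial factor, so no degree has to be tracked. *)
Definition root_poly s : {poly R} := \prod_(t <- s) (1 + t *: 'X).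

Lemma root_poly0 s : (root_poly s)`_0 = 1.
Proof.
rewrite -horner_coef0 /root_poly horner_prod big1// => t _.
by rewrite !hornerE ?mulr0 ?addr0.
Qed.

Lemma root_poly_eval s (C : comNzRingType) (f : {rmorphism R -> C}) z :
  (map_poly f (root_poly s)).[z] = \prod_(t <- s) (1 + f t * z).
Proof.
rewrite /root_poly rmorph_prod horner_prod; apply: eq_bigr => t _.
by rewrite rmorphD rmorph1 /= map_polyZ map_polyX !hornerE.
Qed.

Lemma root_poly_deriv s (C : fieldType) (f : {rmorphism R -> C}) z :
  (forall t, t \in s -> 1 + f t * z != 0) ->
  (map_poly f (root_poly s)^`()).[z] =
  (map_poly f (root_poly s)).[z] * \sum_(t <- s) f t / (1 + f t * z).
Proof.
elim: s => [|t s IH] nz.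
  by rewrite /root_poly !big_nil derivC rmorph0 rmorph1 !hornerE.
have t0 : 1 + f t * z != 0 by apply: nz; rewrite mem_head.
have {}IH := IH (fun u us => nz u (mem_behead (us : u \in behead (t :: s)))).
rewrite /root_poly !big_cons -/(root_poly s) derivM rmorphD !rmorphM !hornerE.
have e1 : (map_poly f (1 + t *: 'X)^`()).[z] = f t.
  rewrite derivD derivC derivZ derivX add0r -mul_polyC mulr1.
  by rewrite map_polyC hornerC.
have e2 : (map_poly f (1 + t *: 'X)).[z] = 1 + f t * z.
  by rewrite rmorphD rmorph1 /= map_polyZ map_polyX !hornerE.
by rewrite /= e1 e2 IH; field.
Qed.

Local Notation C := (R[i]).
Local Notation iota := (real_complex R).

(** If z is not a root of the original polynomial, its logarithmic derivative gives 1 + (1/c) sum t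
    z / (1 + t z) = 0. Subtracting the conjugate leaves (z - conj z) times the sum of t / |1 + t
    z|^2, so a nonreal z forces every t to be 0, which is absurd. A nonnegative real z would make
    the left side positive. *)
Let real_rooted_step s (c : R) (z : C) : 0 < c -> all (fun t => 0 <= t) s ->
  (map_poly iota (root_poly s + c^-1 *: ('X * (root_poly s)^`()))).[z] = 0 ->
  exists2 r : R, 0 < r & z = iota (- r).
Proof.
move=> c0 /allP s0.
rewrite rmorphD /= map_polyZ rmorphM /= map_polyX !hornerE.
have it0 t : t \in s -> 0 <= iota t.
  by move=> ts; rewrite -(rmorph0 iota) lecR s0.
have [nz|] := boolP (all (fun t => 1 + iota t * z != 0) s); last first.
  move=> /allPn[t ts]; rewrite negbK => /eqP tz _.
  have t1 : 0 < t.
    rewrite lt_neqAle s0// andbT eq_sym; apply/eqP => t00.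
    by move: tz; rewrite t00 rmorph0 mul0r addr0 => /eqP; rewrite oner_eq0.
  exists t^-1; first by rewrite invr_gt0.
  have tn : iota t != 0 by rewrite fmorph_eq0 gt_eqF.
  apply: (mulfI tn); rewrite -rmorphM/= mulrN mulfV ?gt_eqF// rmorphN rmorph1.
  by apply/eqP; rewrite -addr_eq0 addrC tz.
move/allP: nz => nz.
rewrite root_poly_deriv// => /eqP.
rewrite (_ : _ + _ = (map_poly iota (root_poly s)).[z] *
  (1 + iota c^-1 * \sum_(t <- s) (iota t * z / (1 + iota t * z)))); last first.
  have -> : \sum_(t <- s) (iota t * z / (1 + iota t * z)) =
      z * \sum_(t <- s) iota t / (1 + iota t * z).
    by rewrite mulr_sumr; apply: eq_bigr => t _; rewrite [iota t * z]mulrC mulrA.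
  by rewrite /=; ring.
rewrite mulf_eq0 root_poly_eval prodf_seq_eq0.
have /negPf -> /= : ~~ has (fun t => true && (1 + iota t * z == 0)) s.
  by apply/hasPn => t ts /=; exact: nz.
move=> /eqP S0.
have ic0 : 0 < iota c^-1 by rewrite -(rmorph0 iota) ltcR invr_gt0.
pose D := \sum_(t <- s) iota t / `|1 + iota t * z| ^+ 2.
have tD t : t \in s -> 0 <= iota t / `|1 + iota t * z| ^+ 2.
  by move=> ts; rewrite divr_ge0 ?it0// exprn_ge0.
have zD : (z - z^*) * D = 0.
  have : iota c^-1 * ((z - z^*) * D) = 0.
    have <- : (1 + iota c^-1 * \sum_(t <- s) (iota t * z / (1 + iota t * z))) -
      (1 + iota c^-1 * \sum_(t <- s) (iota t * z / (1 + iota t * z)))^* = 0.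
      by rewrite S0 rmorph0 subrr.
    rewrite rmorphD rmorph1 rmorphM /= (CrealP (gtr0_real ic0)).
    rewrite opprD addrACA subrr add0r -mulrBr rmorph_sum -sumrB mulr_sumr.
    congr (_ * _); rewrite big_seq [RHS]big_seq; apply: eq_bigr => t ts.
    have tr : (iota t)^* = iota t by apply/CrealP/ger0_real/it0.
    have t1 := nz t ts; have t2 : (1 + iota t * z)^* != 0 by rewrite fmorph_eq0.
    rewrite rmorphM fmorphV /= normCK.
    move: t2; rewrite !rmorphD !rmorph1 !rmorphM /= tr => t2.
    by field; rewrite t1 t2.
  by move=> /eqP; rewrite mulf_eq0 gt_eqF//= => /eqP.
have zr : z \is Num.real.
  apply/CrealP/eqP; rewrite eq_sym -subr_eq0; apply/negPn/negP => zz.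
  move/eqP: zD; rewrite mulf_eq0 (negPf zz)/= => /eqP D0.
  have tz t : t \in s -> iota t = 0.
    move=> ts; move/eqP: D0; rewrite /D big_seq psumr_eq0// => /allP/(_ t ts).
    rewrite ts /= mulf_eq0 invr_eq0 expf_eq0/= normr_eq0 (negPf (nz t ts)) orbF.
    by move/eqP.
  move/eqP: S0; rewrite big_seq big1 ?mulr0 ?addr0 ?oner_eq0// => t ts.
  by rewrite tz// !mul0r.
move/complex_realP: zr => [r zE].
exists (- r); last by rewrite opprK.
rewrite oppr_gt0 ltNge; apply/negP => r0.
have z0 : 0 <= z by rewrite zE -(rmorph0 iota) lecR.
have : 0 < 1 + iota c^-1 * \sum_(t <- s) (iota t * z / (1 + iota t * z)).
  rewrite ltr_pwDl// mulr_ge0 ?(ltW ic0)// big_seq sumr_ge0// => t ts.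
  have tz : 0 <= iota t * z by rewrite mulr_ge0 ?it0.
  by rewrite divr_ge0// addr_ge0.
by rewrite S0 ltxx.
Qed.

(** The polynomial splits over R[i], all its roots there are negative reals, and the value 1 at 0
    fixes the constant of the factorization. *)
Lemma real_rooted_op s (c : R) : 0 < c -> all (fun t => 0 <= t) s ->
  exists2 s', all (fun t => 0 <= t) s' &
    root_poly s' = root_poly s + c^-1 *: ('X * (root_poly s)^`()).
Proof.
move=> c0 s0; set q := _ + _.
have q0 : q`_0 = 1.
  by rewrite /q coefD coefZ coefXM eqxx mulr0 addr0 root_poly0.
have [zs zsE] := closed_field_poly_normal (map_poly iota q).
have qn0 : map_poly iota q != 0.
  rewrite map_poly_eq0; apply/eqP => q00.
  by move: q0; rewrite q00 coef0 => /esym/eqP; rewrite oner_eq0.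
have ln0 : lead_coef (map_poly iota q) != 0 by rewrite lead_coef_eq0.
have zsP z : z \in zs -> exists2 r : R, 0 < r & z = iota (- r).
  move=> zz; apply: (real_rooted_step c0 s0).
  rewrite -/q zsE hornerZ horner_prod; apply/eqP; rewrite mulf_eq0 (negPf ln0)/=.
  rewrite prodf_seq_eq0; apply/hasP; exists z => //=.
  by rewrite !hornerE subrr.
pose rt (z : C) : R := - (complex.Re z)^-1.
have rtE z : z \in zs -> 0 < rt z /\ iota (rt z) * z = -1.
  move=> /zsP[r r0 ->]; rewrite /rt /= invrN opprK; split; first by rewrite invr_gt0.
  by rewrite -rmorphM /= mulrN mulVf ?gt_eqF// rmorphN rmorph1.
exists (map rt zs).
  by apply/allP => t /mapP[z /rtE[rz _] ->]; exact: ltW.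
apply: (@map_poly_inj _ _ iota); rewrite -/q.
have q1 : (map_poly iota q).[0] = 1.
  by rewrite horner_coef0 coef_map q0; exact: (rmorph1 iota).
move: q1; rewrite zsE; set l := lead_coef _.
have -> : \prod_(z <- zs) ('X - z%:P) =
  (\prod_(z <- zs) - z) *: map_poly iota (root_poly (map rt zs)).
  rewrite /root_poly rmorph_prod big_map -scaler_prod big_seq [RHS]big_seq.
  apply: eq_bigr => z zz.
  rewrite rmorphD rmorph1 /= map_polyZ map_polyX scalerDr scalerA mulNr mulrC.
  by rewrite (rtE z zz).2 opprK scale1r addrC -mul_polyC mulr1 polyCN.
have r1 : (map_poly iota (root_poly (map rt zs))).[0] = 1.
  by rewrite horner_coef0 coef_map root_poly0; exact: (rmorph1 iota).
rewrite scalerA hornerZ r1 mulr1 => ->.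
by rewrite scale1r.
Qed.

End real_rooted.

(** * Polynomial approximants of F *)

Section approximants.
Context (R : realType) (mu : R).
Hypothesis mu0 : 0 < mu.

Definition bcoef k : R := \prod_(i < k) (4 * i.+1%:R * (mu + 1 + i%:R))^-1.

(** The correction to [bcoef] is m! / ((m - k)! m^k) times (mu + m + 1)_k / (mu + m + 1)^k for k <=
    m. It tends to 1 as m grows, and it vanishes for k > m > 0. *)
Definition acoef m k : R :=
  bcoef k * \prod_(i < k) ((1 - i%:R / m%:R) * (1 + i%:R / (mu + m%:R + 1))).

Lemma bcoefS k : bcoef k.+1 = bcoef k * (4 * k.+1%:R * (mu + 1 + k%:R))^-1.
Proof. by rewrite /bcoef big_ord_recr. Qed.

Lemma acoefS m k : acoef m k.+1 = acoef m k *
  ((4 * k.+1%:R * (mu + 1 + k%:R))^-1 *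
   ((1 - k%:R / m%:R) * (1 + k%:R / (mu + m%:R + 1)))).
Proof. by rewrite /acoef bcoefS big_ord_recr /=; ring. Qed.

(** The coefficients of (1 + x / m)^m after n applications of the operator, with c = mu + 1, ..., mu
    + n. *)
Let pcoef m n k : R := 'C(m, k)%:R / m%:R ^+ k *
  \prod_(i < k) ((mu + n%:R + 1 + i%:R) / (mu + 1 + i%:R)).

Let mup (n : nat) : 0 < mu + 1 + n%:R.
Proof. by rewrite ltr_wpDr// addr_gt0. Qed.

Let mup' (n : nat) : 0 < mu + n%:R + 1.
Proof. by rewrite addrAC mup. Qed.

Let shift_prod n k :
  \prod_(i < k) ((mu + n.+1%:R + 1 + i%:R) / (mu + 1 + i%:R)) =
  (1 + k%:R / (mu + n%:R + 1)) *
  \prod_(i < k) ((mu + n%:R + 1 + i%:R) / (mu + 1 + i%:R)).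
Proof.
elim: k => [|k IH]; first by rewrite !big_ord0 mul0r addr0 mulr1.
rewrite !big_ord_recr /= {}IH.
set Q := \prod_(i < k) _.
have h1 := mup k; have h2 := mup' n.
rewrite -!natr1; field.
by rewrite !gt_eqF.
Qed.

Let real_rooted_pcoef m n : exists2 s, all (fun t => 0 <= t) s &
  forall k, (root_poly s)`_k = pcoef m.+1 n k.
Proof.
elim: n => [|n [s s0 sE]].
  exists (nseq m.+1 (m.+1%:R^-1)).
    by apply/allP => t /nseqP[-> _]; rewrite invr_ge0.
  move=> k; rewrite /root_poly big_nseq -Monoid.iteropE.
  rewrite -[iterop _ _ _ _]/((1 + m.+1%:R^-1 *: 'X) ^+ m.+1) exprDn coef_sum.
  rewrite (_ : pcoef _ _ _ = 'C(m.+1, k)%:R / m.+1%:R ^+ k); last first.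
    rewrite /pcoef big1 ?mulr1// => i _; rewrite addr0 divff// gt_eqF//.
  under eq_bigr do rewrite expr1n mul1r exprZn coefMn coefZ coefXn.
  have [km|km] := leqP k m.+1.
    rewrite (bigD1 (Ordinal (km : (k < m.+2)%N)))//= eqxx mulr1 big1 => [|i ik].
      by rewrite addr0 -[LHS]mulr_natr mulrC exprVn.
    rewrite (_ : (k == i) = false) ?mulr0 ?mul0rn//.
    by apply/negbTE; apply: contra_neq ik => ik; apply/val_inj.
  rewrite bin_small// mul0r big1// => i _.
  by rewrite gtn_eqF ?mulr0 ?mul0rn// (leq_trans (ltn_ord i)).
have [s' s'0 s'E] := real_rooted_op (mup' n) s0.
exists s' => // k; rewrite s'E coefD coefZ coefXM sE.
have -> : (if k == 0 then 0 else (root_poly s)^`()`_k.-1) = k%:R * pcoef m.+1 n k.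
  by case: k => [|k] /=; rewrite ?mul0r// coef_deriv sE mulr_natl.
rewrite /pcoef shift_prod; ring.
Qed.

Lemma real_rooted_approximant m : exists2 s, all (fun t => 0 <= t) s &
  forall x, \prod_(t <- s) (1 + t * x) = \sum_(k < m.+2) acoef m.+1 k * x ^+ k.
Proof.
have [s s0 sE] := real_rooted_pcoef m m.+1.
(* With as many operator steps as the degree M = m + 1, dividing x by 4 (mu + M + 1) supplies the
   powers of 4 and turns (mu + M + 1)_k into a product of factors close to 1. *)
have c0 : 0 < (4 * (mu + m.+1%:R + 1))^-1 by rewrite invr_gt0 mulr_gt0 ?mup'.
exists (map (fun t => t * (4 * (mu + m.+1%:R + 1))^-1) s).
  apply/allP => _ /mapP[t ts ->]; apply: mulr_ge0; last exact: ltW.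
  by move/allP: s0 => /(_ t ts).
move=> x; rewrite big_map.
transitivity (root_poly s).[(4 * (mu + m.+1%:R + 1))^-1 * x].
  rewrite /root_poly horner_prod; apply: eq_bigr => t _.
  by rewrite hornerD hornerC hornerZ hornerX mulrA.
rewrite (@horner_coef_wide _ m.+2); last first.
  by apply/leq_sizeP => k mk; rewrite sE /pcoef bin_small// !mul0r.
apply: eq_bigr => -[k km] _ /=; rewrite exprMn mulrA sE; congr (_ * _).
elim: k {km} => [|k IH].
  by rewrite /pcoef /acoef /bcoef bin0 !big_ord0 !expr0 divr1 !mulr1.
rewrite acoefS -{}IH /pcoef big_ord_recr/= !exprS.
have binE : k.+1%:R * 'C(m.+1, k.+1)%:R = (m.+1%:R - k%:R) * 'C(m.+1, k)%:R :> R.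
  have [km|km] := leqP k m.+1; last by rewrite !bin_small ?mulr0// (ltn_trans km).
  by rewrite -natrB// -!natrM mul_bin_left.
have -> : 'C(m.+1, k.+1)%:R = (m.+1%:R - k%:R) * 'C(m.+1, k)%:R / k.+1%:R :> R.
  by rewrite -binE mulrC mulKf// pnatr_eq0.
set Q := \prod_(i < k) _; set B := 'C(m.+1, k)%:R.
have h1 := mup k; have h2 := mup' m.+1.
have h3 : (m.+1%:R : R) != 0 by rewrite pnatr_eq0.
have h4 : (k.+1%:R : R) != 0 by rewrite pnatr_eq0.
move: h3 h4 h2; set M := m.+1%:R; set K := k.+1%:R; move=> h3 h4 h2.
have h5 : M ^+ k != 0 by rewrite expf_neq0.
have h6 : mu + M + 1 != 0 by rewrite gt_eqF.
have h7 : mu + 1 + k%:R != 0 by rewrite gt_eqF.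
move: h5; set Mk := M ^+ k; set Z := _^-1 ^+ k; move=> h5.
clearbody M K Mk Z Q B.
by field; rewrite ?h3 ?h4 ?h5 ?h6 ?h7.
Qed.

End approximants.

(** * The entire function F *)

Section entire.
Context (R : realType).
Implicit Types (c : R^nat) (x : R).

(** Domination by the exponential series: it gives convergence everywhere and is preserved by
    termwise differentiation. *)
Definition exp_bounded c := forall k, `|c k| <= (k`!%:R)^-1.

Definition psum c x := limn (pseries c x).

Lemma cvg_norm_series_le (u v : R^nat) : (forall k, `|u k| <= v k) ->
  cvgn (series v) -> cvgn (series u).
Proof.
move=> uv cv; apply: normed_cvg; apply: series_le_cvg cv => // k; first exact: normr_ge0.
by apply: le_trans (uv k).
Qed.

Lemma exp_bounded_cvg c x : exp_bounded c -> cvgn (pseries c x).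
Proof.
move=> cb; apply: (@cvg_norm_series_le _ (exp_coeff `|x|)) => [k|].
  by rewrite normrM normrX /exp_coeff/= mulrC ler_wpM2l// exprn_ge0.
exact: is_cvg_series_exp_coeff.
Qed.

Lemma exp_bounded_diffs c : exp_bounded c -> exp_bounded (pseries_diffs c).
Proof.
move=> cb k; rewrite /pseries_diffs normrM ger0_norm//.
rewrite (le_trans (ler_wpM2l _ (cb k.+1)))// factS natrM invfM mulrA.
by rewrite divff ?mul1r// pnatr_eq0.
Qed.

Lemma is_derive_psum c x : exp_bounded c ->
  is_derive x 1 (psum c) (psum (pseries_diffs c) x).
Proof.
move=> cb; apply: (@pseries_snd_diffs _ _ (`|x| + 1)).
- exact: exp_bounded_cvg.
- exact/exp_bounded_cvg/exp_bounded_diffs.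
- exact/exp_bounded_cvg/exp_bounded_diffs/exp_bounded_diffs.
- by rewrite [ltRHS]ger0_norm ?ltrDl// addr_ge0.
Qed.

Lemma psum_cvg c x : exp_bounded c -> pseries c x @ \oo --> psum c x.
Proof. exact: exp_bounded_cvg. Qed.

Lemma psum_diffs_cvg c x : exp_bounded c ->
  series (fun i => i%:R * c i * x ^+ i) @ \oo --> x * psum (pseries_diffs c) x.
Proof.
move=> cb.
have H := pseries_diffs_equiv (exp_bounded_cvg (x := x) (exp_bounded_diffs cb)).
rewrite (_ : series _ = fun n => x * series (fun i => i%:R * c i * x ^+ i.-1) n).
  by apply: cvgM; [exact: cvg_cst|exact: H].
apply/funext => n; rewrite /series/= mulr_sumr; apply: eq_bigr => -[|i] _.
  by rewrite !mul0r mulr0.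
by rewrite /= exprS mulrCA.
Qed.

End entire.

Section bessel_series.
Context (R : realType) (mu : R).
Hypothesis mu2 : 1 / 2 < mu.

Let mu0 : 0 < mu. Proof. by apply: lt_trans mu2; rewrite divr_gt0. Qed.

Local Notation b := (bcoef mu).

Lemma bcoef_gt0 k : 0 < b k.
Proof.
apply: prodr_gt0 => i _; rewrite invr_gt0 !mulr_gt0// ltr_wpDr// addr_gt0//.
Qed.

(** Passing from k to k + 1, the step factor satisfies 4 (k + 1) (mu + 1 + k) >= (2k + 2) (2k + 3),
    as mu > 1/2. The right-hand sides are the coefficients of sinh z / z in powers of z^2. *)
Lemma bcoef_le k : b k <= ((k.*2.+1)`!%:R)^-1.
Proof.
elim: k => [|k IH]; first by rewrite /bcoef big_ord0 invr1.
have k0 : 0 <= (k%:R : R) by [].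
have -> : ((k.+1.*2.+1)`!%:R : R)^-1 =
    ((k.*2.+1)`!%:R)^-1 * ((k.*2.+2)%:R * (k.*2.+3)%:R)^-1.
  by rewrite doubleS !factS !natrM !invfM; ring.
rewrite bcoefS; apply: ler_pM => //.
- exact/ltW/bcoef_gt0.
- by rewrite invr_ge0 !mulr_ge0// !addr_ge0// ltW.
rewrite lef_pV2 ?posrE; last 2 first.
- by rewrite !mulr_gt0// ltr_wpDr// addr_gt0.
- by rewrite mulr_gt0.
rewrite -!natr1 -muln2 natrM; move: mu2 k0; set K := k%:R; nra.
Qed.

Lemma exp_bounded_bcoef : exp_bounded b.
Proof.
move=> k; rewrite ger0_norm; last exact/ltW/bcoef_gt0.
apply: le_trans (bcoef_le k) _; rewrite lef_pV2 ?posrE ?ltr0n ?fact_gt0//.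
rewrite ler_nat; apply: leq_fact; rewrite -addnn; lia.
Qed.

Definition besselF x := psum b x.
Definition besselF' x := psum (pseries_diffs b) x.
Definition besselF'' x := psum (pseries_diffs (pseries_diffs b)) x.

Lemma is_derive_besselF (x : R) : is_derive x 1 besselF (besselF' x).
Proof. exact/is_derive_psum/exp_bounded_bcoef. Qed.

Lemma is_derive_besselF' (x : R) : is_derive x 1 besselF' (besselF'' x).
Proof. exact/is_derive_psum/exp_bounded_diffs/exp_bounded_bcoef. Qed.

(** Termwise, this is the recursion 4 (k + 1) (mu + 1 + k) b_(k+1) = b_k. *)
Lemma besselF_ode x :
  4 * x * besselF'' x + 4 * (mu + 1) * besselF' x = besselF x.
Proof.
have cb := exp_bounded_bcoef.
have h1 := psum_diffs_cvg (x := x) (exp_bounded_diffs cb).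
have h2 := psum_cvg (x := x) (exp_bounded_diffs cb).
have h0 := psum_cvg (x := x) cb.
apply/esym; apply: (cvg_unique _ h0) => //.
rewrite (_ : pseries b x = fun n => 4 *
   series (fun i => i%:R * pseries_diffs b i * x ^+ i) n +
   4 * (mu + 1) * pseries (pseries_diffs b) x n).
  rewrite -[4 * x * _]mulrA; apply: cvgD.
    by apply: cvgM; [exact: cvg_cst|exact: h1].
  by apply: cvgM; [exact: cvg_cst|exact: h2].
apply/funext => n; rewrite /pseries /series/= !mulr_sumr -big_split/=.
apply: eq_bigr => i _; rewrite /pseries_diffs bcoefS.
have h3 : mu + 1 + i%:R != 0 by rewrite gt_eqF// ltr_wpDr// addr_gt0.
have h4 : (i.+1%:R : R) != 0 by rewrite pnatr_eq0.
move: h4; rewrite -natr1; set I := i%:R in h3 *; move=> h4.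
by field; rewrite h3 h4.
Qed.

Lemma besselF0 : besselF 0 = 1.
Proof.
apply/cvg_lim => //; rewrite -(cvg_shiftn 1).
rewrite (_ : (fun n => _) = cst 1); first exact: cvg_cst.
apply/funext => n; rewrite addn1 /pseries /series/= big_nat_recl// expr0 mulr1 /bcoef big_ord0.
by rewrite big1 ?addr0// => i _; rewrite exprS mul0r mulr0.
Qed.

Lemma le_besselF x n : 0 <= x -> \sum_(0 <= k < n) b k * x ^+ k <= besselF x.
Proof.
move=> x0; apply: (@nondecreasing_cvgn_le _ (pseries b x)).
  apply/nondecreasing_seqP => k; rewrite /pseries /series/= big_nat_recr//= lerDl.
  by rewrite mulr_ge0 ?exprn_ge0// ltW ?bcoef_gt0.
exact/exp_bounded_cvg/exp_bounded_bcoef.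
Qed.

Lemma besselF_ge1 x : 0 <= x -> 1 + b 1 * x <= besselF x.
Proof.
move=> x0; apply: le_trans (le_besselF 2 x0).
by rewrite !big_nat_recl// big_nil expr0 mulr1 /bcoef big_ord0 expr1 addr0.
Qed.

(** The terms z^(2k) and z^(2k+1) of the left side are each dominated by the corresponding term of
    the exponential series. The factor 1 + z makes e^(-z) F(z^2) tend to 0, which later excludes an
    atom at 0. *)
Lemma besselF_le_exp z : 0 <= z -> (1 + z) * besselF (z ^+ 2) <= expR z.
Proof.
move=> z0.
have : (fun n => (1 + z) * pseries b (z ^+ 2) n) @ \oo --> (1 + z) * besselF (z ^+ 2).
  by apply: cvgM; [exact: cvg_cst|exact/psum_cvg/exp_bounded_bcoef].
move=> cv; rewrite -(cvg_lim _ cv)//; apply: limr_le.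
  by apply/cvg_ex; exists ((1 + z) * besselF (z ^+ 2)).
apply: nearW => n.
apply: (@le_trans _ _ (series (exp_coeff z) n.*2)); last first.
  apply: nondecreasing_cvgn_le.
    apply/nondecreasing_seqP => k; rewrite /series/= big_nat_recr//= lerDl.
    exact: exp_coeff_ge0.
  exact: is_cvg_series_exp_coeff.
elim: n => [|n IH].
  by rewrite /pseries /series/= !big_geq// mulr0.
rewrite doubleS /pseries /series/= !big_nat_recr//= mulrDr -addrA lerD//.
have z2n : 0 <= z ^+ n.*2 by rewrite exprn_ge0.
have e : z ^+ 2 ^+ n = z ^+ n.*2 by rewrite -exprM mul2n.
have b1 := bcoef_le n.
have b2 : b n <= ((n.*2)`!%:R)^-1.
  apply: le_trans b1 _; rewrite lef_pV2 ?posrE ?ltr0n ?fact_gt0//.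
  by rewrite ler_nat leq_fact.
rewrite e mulrDl mul1r; apply: lerD; first by rewrite mulrC ler_wpM2l.
rewrite /exp_coeff/= exprS -mulrA; apply: ler_wpM2l => //.
by rewrite mulrC; apply: ler_wpM2l.
Qed.

End bessel_series.

(** * The product formula *)

Lemma ultra_bounded_cvg (R : realType) (I : Type) (U : set_system I) (f : I -> R) (a b : R) :
  UltraFilter U -> (forall i, a <= f i <= b) -> exists l : R, f @ U --> l.
Proof.
move=> UU fab.
have Ffab : (f @ U) `[a, b]%classic.
  by apply: (@filterE _ U) => i; rewrite /= in_itv/=.
have [l [_ cl]] := @segment_compact R a b (f @ U) _ Ffab.
exists l => V Vl.
have [//|nV] := in_ultra_setVsetC (f @^-1` V) UU.
by have [y [/= nVy Vy]] := cl (~` V) V nV Vl.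
Qed.

Lemma tannery (R : realType) (N : nat -> nat) (a : nat -> nat -> R) (b M : R^nat) :
  (forall m, m <= N m)%N -> (forall m k, `|a m k| <= M k) ->
  (forall k, `|b k| <= M k) -> (forall k, a m k @[m --> \oo] --> b k) ->
  cvgn (series M) ->
  (\sum_(0 <= k < N m) a m k) @[m --> \oo] --> limn (series b).
Proof.
move=> mN aM bM ab cM.
have M0 k : 0 <= M k by apply: le_trans (bM k).
set lM := limn (series M).
have tail (u : R^nat) K n : (forall k, `|u k| <= M k) -> (K <= n)%N ->
    `|series u n - series u K| <= lM - series M K.
  move=> uM Kn; rewrite sub_series_geq// (le_trans (ler_norm_sum _ _ _))//.
  apply: (@le_trans _ _ (series M n - series M K)).
    by rewrite sub_series_geq//; apply: ler_sum => k _.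
  rewrite lerD2r; apply: nondecreasing_cvgn_le => //.
  by apply/nondecreasing_seqP => k; rewrite /series/= big_nat_recr//= lerDl.
have cb : cvgn (series b).
  by apply: normed_cvg; apply: series_le_cvg cM => // k; rewrite /= ?normr_ge0.
apply/cvgrPdist_lt => e e0.
have e3 : 0 < e / 3 by rewrite divr_gt0.
have /cvgrPdist_lt/(_ _ e3)[K _ /(_ K (leqnn K))/=] : series M @ \oo --> lM by [].
move=> /(le_lt_trans (ler_norm _)) lMK.
have bK : `|limn (series b) - series b K| <= lM - series M K.
  rewrite ler_distl; apply/andP; split.
    apply: limr_ge => //; exists K => // n /= Kn.
    by have := tail b K n bM Kn; rewrite ler_distl => /andP[].
  apply: limr_le => //; exists K => // n /= Kn.
  by have := tail b K n bM Kn; rewrite ler_distl => /andP[].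
have cK : (\sum_(0 <= k < K) a m k) @[m --> \oo] --> \sum_(0 <= k < K) b k.
  elim: K {lMK bK} => [|K IH].
    by rewrite big_nil; under eq_fun do rewrite big_nil; exact: cvg_cst.
  under eq_fun do rewrite big_nat_recr//=.
  by rewrite big_nat_recr//=; apply: cvgD => //; exact: ab.
move/cvgrPdist_lt : cK => /(_ _ e3) cK.
near=> m.
have Km : (K <= m)%N by near: m; exact: nbhs_infty_ge.
have h1 : `|\sum_(0 <= k < K) b k - \sum_(0 <= k < K) a m k| < e / 3 by near: m.
have h2 := tail (a m) K (N m) (aM m) (leq_trans Km (mN m)).
rewrite (_ : _ - _ = (limn (series b) - series b K) +
  ((\sum_(0 <= k < K) b k - \sum_(0 <= k < K) a m k) -
   (series (a m) (N m) - series (a m) K))); last by rewrite /series/=; ring.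
rewrite (le_lt_trans (ler_normD _ _))//.
have h3 := ler_normB (\sum_(0 <= k < K) b k - \sum_(0 <= k < K) a m k)
   (series (a m) (N m) - series (a m) K).
move: h1 h2 h3 bK lMK; lra.
Unshelve. all: by end_near. Qed.

Section product_formula.
Context (R : realType) (mu : R).
Hypothesis mu2 : 1 / 2 < mu.

Let mu0 : 0 < mu. Proof. by apply: lt_trans mu2; rewrite divr_gt0. Qed.

Local Notation b := (bcoef mu).
Local Notation F := (besselF mu).

Let approx m x := \sum_(0 <= k < m.+2) acoef mu m.+1 k * x ^+ k.

(** For k > m + 1 the product contains a vanishing factor; otherwise, with M = m + 1, its factors
    are at most 1 - (i / M)^2. *)
Let acoef_bound m k : `|acoef mu m.+1 k| <= b k.
Proof.
have [km|km] := ltnP m.+1 k.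
  rewrite /acoef (bigD1 (Ordinal km))//= divff ?pnatr_eq0// subrr !mul0r mulr0.
  by rewrite normr0 ltW ?bcoef_gt0.
rewrite /acoef normrM ger0_norm ?(ltW (bcoef_gt0 _ _))// ler_piMr//.
  exact/ltW/bcoef_gt0.
rewrite normr_prod prodr_ile1// => -[i ik] _ /=; rewrite normr_ge0/=.
have im : (i%:R : R) <= m.+1%:R by rewrite ler_nat ltnW// (leq_trans ik).
have i0 : 0 <= (i%:R : R) by [].
have m0 : 0 < (m.+1%:R : R) by [].
move: (i%:R : R) (m.+1%:R : R) im i0 m0 => I M im i0 m0.
have h : 0 < mu + M + 1 by rewrite !addr_gt0.
have d0 : 0 <= 1 - I / M by rewrite subr_ge0 ler_pdivrMr// mul1r.
have d1 : 0 <= I / (mu + M + 1) by rewrite divr_ge0// ltW.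
rewrite ger0_norm; last by rewrite mulr_ge0// addr_ge0.
apply: (@le_trans _ _ ((1 - I / M) * (1 + I / M))).
  rewrite ler_wpM2l// lerD2l ler_wpM2l// lef_pV2 ?posrE//.
  by have := mu0; lra.
have := sqr_ge0 (I / M); lra.
Qed.

Let acoef_cvg k : acoef mu m.+1 k @[m --> \oo] --> b k.
Proof.
elim: k => [|k IH].
  rewrite /acoef; under eq_fun do rewrite big_ord0 mulr1; exact: cvg_cst.
under eq_fun do rewrite acoefS.
rewrite bcoefS; apply: cvgM => //.
rewrite -[X in _ --> X]mulr1; apply: cvgM; first exact: cvg_cst.
rewrite -[X in _ --> X]mulr1; apply: cvgM.
  rewrite -[X in _ --> X]subr0; apply: cvgB; first exact: cvg_cst.
  rewrite -(mulr0 (k%:R : R)); apply: cvgM; first exact: cvg_cst.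
  exact: cvg_harmonic.
rewrite -[X in _ --> X]addr0; apply: cvgD; first exact: cvg_cst.
rewrite -(mulr0 (k%:R : R)); apply: cvgM; first exact: cvg_cst.
apply: (@squeeze_cvgr _ _ _ _ (cst 0) (@harmonic R)); [|exact: cvg_cst|exact: cvg_harmonic].
apply: nearW => m; rewrite /= invr_ge0 !addr_ge0 ?(ltW mu0)//= lef_pV2 ?posrE//.
  by have := mu0; lra.
by rewrite !addr_gt0.
Qed.

Let approx_cvg x : approx m x @[m --> \oo] --> F x.
Proof.
apply: (@tannery _ (fun m => m.+2) (fun m k => acoef mu m.+1 k * x ^+ k)
  (fun k => b k * x ^+ k) (fun k => b k * `|x| ^+ k)).
- by move=> m; rewrite ltnW.
- by move=> m k; rewrite normrM normrX ler_wpM2r ?exprn_ge0.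
- by move=> k; rewrite normrM normrX ger0_norm// ltW ?bcoef_gt0.
- by move=> k; apply: cvgM; [exact: acoef_cvg|exact: cvg_cst].
- exact/exp_bounded_cvg/exp_bounded_bcoef.
Qed.

Let approx_le m x : 0 <= x -> approx m x <= F x.
Proof.
move=> x0; apply: le_trans (le_besselF mu2 m.+2 x0).
apply: ler_sum => k _; rewrite ler_wpM2r ?exprn_ge0//.
exact: le_trans (ler_norm _) (acoef_bound m k).
Qed.

Let besselF_le_expsqrt x : 0 <= x -> F x <= expR (Num.sqrt x).
Proof.
move=> x0; have := besselF_le_exp mu2 (sqrtr_ge0 x); rewrite sqr_sqrtr//.
apply: le_trans; rewrite ler_peMl ?lerDl ?sqrtr_ge0//.
by apply: le_trans (besselF_ge1 mu2 x0); rewrite addr_ge0// mulr_ge0// ltW ?bcoef_gt0.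
Qed.

Let expR_nat_le4 n : expR n%:R <= 4 ^+ n :> R.
Proof.
have e2 : expR (1 / 2) <= 2 :> R.
  have := @expR_ge1Dx R (- (1 / 2)); rewrite expRN => h.
  rewrite -[expR _]invrK -[leRHS]invrK lef_pV2 ?posrE ?invr_gt0 ?expR_gt0//; lra.
have e1 : expR 1 <= 4 :> R.
  rewrite (_ : 1 = 1 / 2 + 1 / 2 :> R); last by lra.
  by rewrite expRD (le_trans (ler_pM _ _ e2 e2)) ?expR_ge0//; lra.
by rewrite -[n%:R]mulr1 expRM_natl lerXn2r ?nnegrE ?expR_ge0.
Qed.

(** Sorting and padding by zeros gives all approximants the same index set, so that each [T m i] can
    be followed as m grows. The padding is also why the product may run over an arbitrarily long
    range. *)
Let exists_roots : exists T : nat -> nat -> R,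
  [/\ forall m i, 0 <= T m i,
      forall m i j, (i <= j)%N -> T m j <= T m i &
      forall m N, exists2 n, (N <= n)%N &
        forall x, \prod_(i < n) (1 + T m i * x) = approx m x].
Proof.
have /choice[s sP] m : exists s : seq R, all (fun t => 0 <= t) s /\
    forall x, \prod_(t <- s) (1 + t * x) = approx m x.
  have [s s0 sE] := real_rooted_approximant mu0 m.
  by exists s; split => // x; rewrite sE /approx big_mkord.
pose S m := sort (fun x y => y <= x) (s m).
have S0 m i : 0 <= nth 0 (S m) i.
  have [im|im] := ltnP i (size (S m)); last by rewrite nth_default.
  have : nth 0 (S m) i \in s m by rewrite -(mem_sort (fun x y => y <= x)) mem_nth.
  by move/(allP (sP m).1).
exists (fun m i => nth 0 (S m) i); split => //.
  move=> m i j ij; have [jm|jm] := ltnP j (size (S m)); last by rewrite [leLHS]nth_default.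
  have sS : sorted (fun x y : R => y <= x) (S m).
    by apply: sort_sorted => x y; exact: ge_total.
  apply: (sorted_leq_nth _ _ _ sS) => //.
  - by move=> x y z xy yz; exact: le_trans yz xy.
  - by rewrite inE (leq_ltn_trans ij).
move=> m N; exists (maxn N (size (S m))); first exact: leq_maxl.
move=> x; rewrite -(sP m).2 -(perm_big _ (permEl (perm_sort (fun x y => y <= x) (s m))))/=.
rewrite (big_nth 0) -/(S m) big_mkord.
rewrite -(big_mkord xpredT (fun i => 1 + nth 0 (S m) i * x)).
rewrite (@big_cat_nat _ _ _ (size (S m)))//=; last exact: leq_maxr.
rewrite big_mkord [X in _ * X]big_nat_cond [X in _ * X]big1 ?mulr1//.
by move=> i /andP[/andP[si _] _]; rewrite nth_default// mul0r addr0.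
Qed.

(** The last two clauses say that 1 / tau i is a zero of F(- x), at least a double one when tau i =
    tau j. As inequalities they hold for the approximants and survive the limit, with no product
    formula at negative arguments. *)
Lemma besselF_product : exists tau : nat -> R,
  [/\ forall i, 0 <= tau i <= 3 / i.+1%:R ^+ 2,
      forall x, 0 <= x -> \prod_(i < n) (1 + tau i * x) @[n --> \oo] --> F x,
      forall i x, 0 <= x -> `|F (- x)| <= `|1 - tau i * x| * F x &
      forall i j x, i != j -> 0 <= x ->
        `|F (- x)| <= `|1 - tau i * x| * `|1 - tau j * x| * F x].
Proof.
have [T [T0 Tnd TE]] := exists_roots.
have T1 m i x : 0 <= x -> 1 <= 1 + T m i * x.
  by move=> x0; rewrite lerDl mulr_ge0.
have prod_ge1 m (A : seq nat) (Q : pred nat) x : 0 <= x ->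
    1 <= \prod_(i <- A | Q i) (1 + T m i * x).
  move=> x0; elim/big_ind: _ => // [u v u1 v1|i _]; last exact: T1.
  by rewrite mulr_ege1.
have low m N x : 0 <= x -> \prod_(i < N) (1 + T m i * x) <= approx m x.
  move=> x0; have [n Nn <-] := TE m N.
  rewrite -!(big_mkord xpredT (fun i => 1 + T m i * x)).
  rewrite (@big_cat_nat _ _ _ N 0%N n)//=.
  by rewrite ler_peMr ?prod_ge1// (le_trans ler01)// prod_ge1.
have Tle m i : T m i <= 3 / i.+1%:R ^+ 2.
  have [->|Tn0] := eqVneq (T m i) 0; first by rewrite divr_ge0// exprn_ge0.
  have Tp : 0 < T m i by rewrite lt_neqAle eq_sym Tn0 T0.
  (* At x = 3 / T m i the first i + 1 factors are at least 1 + 3 = 4. As F x <= e^(sqrt x) and e <=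
     4, this gives i + 1 <= sqrt x. *)
  have x0 : 0 <= 3 / T m i by rewrite divr_ge0.
  have h : 4 ^+ i.+1 <= expR (Num.sqrt (3 / T m i)).
    apply: le_trans (besselF_le_expsqrt x0).
    apply: le_trans (approx_le m x0); apply: le_trans (low m i.+1 _ x0).
    rewrite -[X in _ ^+ X]card_ord -prodr_const; apply: ler_prod => -[j ji] _ /=.
    rewrite ler0n/= (_ : 4 = 1 + T m i * (3 / T m i)); last by field.
    by rewrite lerD2l ler_wpM2r// Tnd.
  have : i.+1%:R <= Num.sqrt (3 / T m i) by rewrite -ler_expR (le_trans (expR_nat_le4 _)).
  rewrite -(@ler_pXn2r _ 2)// ?nnegrE ?sqrtr_ge0// sqr_sqrtr// => h2.
  by rewrite ler_pdivlMr ?exprn_gt0// mulrC -ler_pdivlMr.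
have sum_tail N n : (0 < N)%N -> (N <= n)%N ->
    \sum_(N <= i < n) (3 / i.+1%:R ^+ 2 : R) <= 3 / N%:R - 3 / n%:R.
  move=> N0; elim: n => [|n IH]; first by rewrite leqn0 => /eqP N00; rewrite N00 in N0.
  rewrite leq_eqVlt => /predU1P[->|]; first by rewrite big_geq// subrr.
  rewrite ltnS => Nn; rewrite big_nat_recr//=.
  have n0 : 0 < (n%:R : R) by rewrite ltr0n (leq_trans N0).
  apply: (le_trans (lerD (IH Nn) (lexx _))).
  have -> : n.+1%:R = n%:R + 1 :> R by rewrite natr1.
  have N1 : N%:R != 0 :> R by rewrite pnatr_eq0 -lt0n.
  move: (n%:R : R) n0 (N%:R : R) N1 => y y0 z z0.
  rewrite -subr_ge0 (_ : _ - _ = 3 / (y * (y + 1) ^+ 2)).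
    by rewrite divr_ge0// mulr_ge0 ?exprn_ge0 ?addr_ge0// ltW.
  by field; rewrite ?z0 ?gt_eqF// addr_gt0.
(* Uniformly in m, the factors beyond N contribute at most exp (3 x / N); hence nothing of the
   product is lost in the limit. *)
have high m N x : (0 < N)%N -> 0 <= x ->
    approx m x <= \prod_(i < N) (1 + T m i * x) * expR (x * (3 / N%:R)).
  move=> N0 x0; have [n Nn <-] := TE m N.
  rewrite -!(big_mkord xpredT (fun i => 1 + T m i * x)).
  rewrite (@big_cat_nat _ _ _ N 0%N n)//=.
  rewrite ler_wpM2l//; first by rewrite (le_trans ler01)// prod_ge1.
  apply: (@le_trans _ _ (\prod_(N <= i < n) expR (T m i * x))).
    apply: ler_prod => i _; rewrite expR_ge1Dx andbT.
    by rewrite (le_trans ler01) ?T1.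
  rewrite -expR_sum ler_expR -mulr_suml mulrC ler_wpM2l//.
  apply: (@le_trans _ _ (3 / N%:R - 3 / n%:R)); last by rewrite gerBl divr_ge0.
  by apply: le_trans (sum_tail N n N0 Nn); apply: ler_sum => i _.
have norm1 m i x : 0 <= x -> `|1 + T m i * - x| <= 1 + T m i * x.
  move=> x0; rewrite (le_trans (ler_normD _ _))// normr1 lerD2l mulrN normrN.
  by rewrite ger0_norm// mulr_ge0.
have dev2 m i j x : i != j -> 0 <= x ->
    `|approx m (- x)| <= `|1 - T m i * x| * `|1 - T m j * x| * F x.
  move=> ij x0; have [n nij nE] := TE m (maxn i j).+1.
  move: nij; rewrite gtn_max => /andP[ni nj].
  rewrite -nE normr_prod (bigD1 (Ordinal ni))//= (bigD1 (Ordinal nj))/=; last first.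
    by rewrite -val_eqE/= eq_sym.
  rewrite mulrA !mulrN; apply: ler_wpM2l; first by rewrite mulr_ge0.
  apply: le_trans (approx_le m x0); rewrite -nE.
  rewrite [leRHS](bigD1 (Ordinal ni))//= [X in _ <= _ * X](bigD1 (Ordinal nj))/=; last first.
    by rewrite -val_eqE/= eq_sym.
  rewrite mulrA -[leLHS]mul1r; apply: ler_pM => //.
  - by apply: prodr_ge0 => k _.
  - by rewrite mulr_ege1// T1.
  - by apply: ler_prod => k _; rewrite normr_ge0 norm1.
have dev1 m i x : 0 <= x -> `|approx m (- x)| <= `|1 - T m i * x| * F x.
  move=> x0; have [n ni nE] := TE m i.+1.
  rewrite -nE normr_prod (bigD1 (Ordinal ni))//= !mulrN; apply: ler_wpM2l => //.
  apply: le_trans (approx_le m x0); rewrite -nE.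
  rewrite [leRHS](bigD1 (Ordinal ni))//= -[leLHS]mul1r; apply: ler_pM => //.
  - by apply: prodr_ge0 => k _.
  - by rewrite T1.
  - by apply: ler_prod => k _; rewrite normr_ge0 norm1.
(* One ultrafilter finer than the filter at infinity makes all the bounded sequences [T ^~ i]
   converge at once, in place of a diagonal extraction. *)
have [U [UU oU]] := @ultraFilterLemma nat \oo _.
have toU (f : nat -> R) (l : R) : f @ \oo --> l -> f @ U --> l.
  by move=> fl V /fl; exact: oU.
have /choice[tau tauP] i : exists l : R, T m i @[m --> U] --> l.
  by apply: (@ultra_bounded_cvg _ _ _ _ 0 (3 / i.+1%:R ^+ 2)) => m; rewrite T0 Tle.
have tauprod N x : \prod_(i < N) (1 + T m i * x) @[m --> U] --> \prod_(i < N) (1 + tau i * x).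
  elim: N => [|N IH].
    by rewrite big_ord0; under eq_fun do rewrite big_ord0; exact: cvg_cst.
  under eq_fun do rewrite big_ord_recr/=.
  rewrite big_ord_recr/=; apply: cvgM => //.
  by apply: cvgD; [exact: cvg_cst|apply: cvgM; [exact: tauP|exact: cvg_cst]].
have leU (f g : nat -> R) (u v : R) : f @ U --> u -> g @ U --> v ->
    (forall m, f m <= g m) -> u <= v.
  move=> fu gv fg; rewrite -(cvg_lim _ fu)// -(cvg_lim _ gv)//.
  apply: ler_lim; [by apply/cvg_ex; exists u|by apply/cvg_ex; exists v|].
  exact: nearW.
have F0 x : 0 <= x -> 0 <= F x.
  move=> x0; apply: le_trans (besselF_ge1 mu2 x0).
  by rewrite addr_ge0// mulr_ge0// ltW ?bcoef_gt0.
have cU i x : `|1 - T m i * x| @[m --> U] --> `|1 - tau i * x|.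
  apply: cvg_norm; apply: cvgB; first exact: cvg_cst.
  by apply: cvgM; [exact: tauP|exact: cvg_cst].
have cA x : `|approx m (- x)| @[m --> U] --> `|F (- x)|.
  by apply: cvg_norm; apply: toU; exact: approx_cvg.
exists tau; split.
- move=> i; apply/andP; split.
    by apply: (leU (cst 0) (fun m => T m i)) => //; exact: cvg_cst.
  apply: (leU (fun m => T m i) (cst (3 / i.+1%:R ^+ 2))) => //; exact: cvg_cst.
- move=> x x0.
  have up N : \prod_(i < N) (1 + tau i * x) <= F x.
    apply: (leU _ _ _ _ (tauprod N x) (toU _ _ (approx_cvg (x := x)))) => m.
    exact: low.
  have dn N : F x * expR (- (x * (3 / N.+1%:R))) <= \prod_(i < N.+1) (1 + tau i * x).
    rewrite expRN ler_pdivrMr ?expR_gt0//.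
    apply: (leU _ _ _ _ (toU _ _ (approx_cvg (x := x)))
      (cvgM (tauprod N.+1 x) (cvg_cst (expR (x * (3 / N.+1%:R)))))) => m.
    exact: high.
  rewrite -(cvg_shiftn 1).
  apply: (@squeeze_cvgr _ _ _ _ (fun N => F x * expR (- (x * (3 / N.+1%:R)))) (cst (F x))).
  + by apply: nearW => N; rewrite /= addn1 dn up.
  + rewrite -[X in _ --> X]mulr1; apply: cvgM; first exact: cvg_cst.
    rewrite -[X in _ --> X](@expR0 R).
    apply: (@cvg_comp _ _ _ (fun N => - (x * (3 / N.+1%:R))) expR); last exact: continuous_expR.
    rewrite -oppr0; apply: cvgN; rewrite -(mulr0 x); apply: cvgM; first exact: cvg_cst.
    rewrite -(mulr0 (3 : R)); apply: cvgM; first exact: cvg_cst.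
    exact: cvg_harmonic.
  + exact: cvg_cst.
- move=> i x x0; apply: (leU _ _ _ _ (cA x)
    (cvgM (cU i x) (cvg_cst (F x)))) => m; exact: dev1.
- move=> i j x ij x0; apply: (leU _ _ _ _ (cA x)
    (cvgM (cvgM (cU i x) (cU j x)) (cvg_cst (F x)))) => m; exact: dev2.
Qed.

End product_formula.

(** * Zeros of F *)

Section derive_pointwise.
Context (R : realType).
Implicit Types (f g : R -> R) (x a b c : R).

Lemma der_eq f x a b : is_derive x 1 f a -> a = b -> is_derive x 1 f b.
Proof. by move=> ? <-. Qed.

Lemma derM f g x a b : is_derive x 1 f a -> is_derive x 1 g b ->
  is_derive x 1 (fun y => f y * g y) (a * g x + f x * b).
Proof.
move=> fa gb; apply: (der_eq (is_deriveM fa gb)).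
by rewrite /GRing.scale/= addrC [a * _]mulrC.
Qed.

Lemma derD f g x a b : is_derive x 1 f a -> is_derive x 1 g b ->
  is_derive x 1 (fun y => f y + g y) (a + b).
Proof. by move=> fa gb; exact: (is_deriveD fa gb). Qed.

Lemma derB f g x a b : is_derive x 1 f a -> is_derive x 1 g b ->
  is_derive x 1 (fun y => f y - g y) (a - b).
Proof. by move=> fa gb; exact: (is_deriveB fa gb). Qed.

Lemma derN f x a : is_derive x 1 f a -> is_derive x 1 (fun y => - f y) (- a).
Proof. by move=> fa; exact: (is_deriveN fa). Qed.

Lemma derC x c : is_derive x 1 (fun=> c : R) 0.
Proof. exact: is_derive_cst. Qed.

Lemma derId x : is_derive x 1 (fun y : R => y) 1.
Proof. exact: is_derive_id. Qed.

Lemma derZ f x c a : is_derive x 1 f a -> is_derive x 1 (fun y => c * f y) (c * a).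
Proof. by move=> fa; apply: (der_eq (derM (derC x c) fa)); rewrite mul0r add0r. Qed.

Lemma derX n x : is_derive x 1 (fun y : R => y ^+ n.+1) (n.+1%:R * x ^+ n).
Proof.
elim: n => [|n IH]; first by apply: (der_eq (derId x)); rewrite mulr1.
under eq_fun do rewrite exprS.
apply: (der_eq (derM (derId x) IH)).
by rewrite -[in RHS]natr1 !exprS; ring.
Qed.

Lemma der_comp f g x a b : is_derive (g x) 1 f a -> is_derive x 1 g b ->
  is_derive x 1 (fun y => f (g y)) (a * b).
Proof. by move=> fa gb; exact: (is_derive1_comp fa gb). Qed.

End derive_pointwise.

Lemma ge0_derive_le (R : realType) (g dg : R -> R) (a b : R) : a <= b ->
  (forall x, a <= x <= b -> is_derive x 1 g (dg x)) ->
  (forall x, a <= x <= b -> 0 <= dg x) -> g a <= g b.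
Proof.
move=> ab gd dg0.
have [| |c] := @MVT_segment R g dg a b ab.
- by move=> x; rewrite in_itv/= => /andP[ax xb]; apply: gd; rewrite !ltW.
- apply: derivable_within_continuous => x; rewrite in_itv/= => xab.
  by apply: ex_derive; exact: gd.
rewrite in_itv/= => cab e; rewrite -subr_ge0 e mulr_ge0 ?subr_ge0//.
exact: dg0.
Qed.

Lemma continuous_gt0_right (R : realType) (g : R -> R) (x e : R) :
  {for x, continuous g} -> 0 < g x -> 0 < e -> exists2 t, 0 < t <= e & 0 < g (x + t).
Proof.
move=> gc gx e0.
have : \forall y \near x, 0 < g y by apply: (cvgr_gt _ gc).
move=> /nbhs_ballP[d /= d0 hd].
pose t := Num.min (d / 2) e.
have t0 : 0 < t by rewrite lt_min divr_gt0.
exists t; first by rewrite t0/= ge_min lexx orbT.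
apply: hd; rewrite /ball/= opprD addrA subrr sub0r.
by rewrite normrN gtr0_norm// gt_min ltr_pdivrMr// ltr_pMr// ltr1n.
Qed.

Lemma derive_gt0_right (R : realType) (g : R -> R) (x l e : R) :
  is_derive x 1 g l -> 0 < l -> 0 < e -> exists2 t, 0 < t < e & g x < g (x + t).
Proof.
move=> /is_derive1_caratheodory[h [hE hc hx]] l0 e0.
have : \forall y \near x, 0 < h y.
  by apply: (cvgr_gt _ hc); rewrite hx.
move=> /nbhs_ballP[d /= d0 hd].
pose t := Num.min (d / 2) (e / 2).
have t0 : 0 < t by rewrite lt_min !divr_gt0.
exists t.
  rewrite t0/= gt_min; apply/orP; right.
  by rewrite ltr_pdivrMr// ltr_pMr// ltr1n.
rewrite -subr_gt0 hE addrAC subrr add0r mulr_gt0// hd// /ball/= opprD addrA subrr sub0r.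
rewrite normrN gtr0_norm// gt_min ltr_pdivrMr// ltr_pMr// ltr1n//.
Qed.

(** * Sturm comparison and the spacing of the zeros *)

Section sturm.
Context (R : realType) (mu : R).
Hypothesis mu2 : 1 / 2 < mu.

Let mu0 : 0 < mu. Proof. by apply: lt_trans mu2; rewrite divr_gt0. Qed.

Local Notation F := (besselF mu).
Local Notation F' := (besselF' mu).
Local Notation F'' := (besselF'' mu).

(** For z > 0 this is Gamma(mu + 1) (2 / z)^mu J_mu(z). *)
Let f (z : R) : R := F (- z ^+ 2).
Let f' (z : R) : R := - (2 * z) * F' (- z ^+ 2).
Let f'' (z : R) : R := - 2 * F' (- z ^+ 2) + 4 * z ^+ 2 * F'' (- z ^+ 2).

Let dsq (z : R) : is_derive z 1 (fun z : R => - z ^+ 2) (- (2 * z)).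
Proof.
exact: (derN (derX 1 z)).
Qed.

Let df (z : R) : is_derive z 1 f (f' z).
Proof.
apply: (der_eq (der_comp (g := fun y => - y ^+ 2) (is_derive_besselF mu2 (- z ^+ 2)) (dsq z))).
by rewrite /f' mulrC.
Qed.

Let df' (z : R) : is_derive z 1 f' (f'' z).
Proof.
have d1 := der_comp (g := fun y => - y ^+ 2) (is_derive_besselF' mu2 (- z ^+ 2)) (dsq z).
apply: (der_eq (derM (derN (derZ 2 (derId z))) d1)).
rewrite /f''; ring.
Qed.

Let ode z : z * f'' z = - ((2 * mu + 1) * f' z) - z * f z.
Proof.
rewrite /f'' /f' /f -(besselF_ode mu2); ring.
Qed.

(** For a large exponent the energy z^(k+1) (f^2 + f'^2) is nondecreasing. If it vanished at z0 it
    would vanish on the whole of ]0, z0], against f 0 = 1. *)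
Lemma simple_zero z0 : 0 < z0 -> f z0 = 0 -> f' z0 != 0.
Proof.
move=> z00 fz0; apply/eqP => f'z0.
(* The exponent k + 1 must absorb the damping term - 2 (2 mu + 1) f'^2 that the differential
   equation produces. *)
pose k := Num.truncn (2 * (2 * mu + 1)).
have mE : 2 * (2 * mu + 1) <= k.+1%:R by exact/ltW/truncnS_gt.
pose E (z : R) : R := z ^+ k.+1 * (f z ^+ 2 + f' z ^+ 2).
pose dE (z : R) : R := z ^+ k * (k.+1%:R * f z ^+ 2 + (k.+1%:R - 2 * (2 * mu + 1)) * f' z ^+ 2).
have EdE (z : R) : is_derive z 1 E (dE z).
  have dff := derM (df z) (df z); have dff' := derM (df' z) (df' z).
  apply: (der_eq (derM (derX k z) (derD dff dff'))).
  have := ode z; rewrite /dE exprSr => o.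
  move: (z ^+ k) (k.+1%:R : R) => Z M.
  transitivity (Z * (M * (f z ^+ 2 + f' z ^+ 2) + 2 * z * (f z * f' z) +
     2 * f' z * (z * f'' z))); first by ring.
  by rewrite o; ring.
have f0 z : 0 < z <= z0 -> f z = 0.
  move=> /andP[zp zz0].
  have Ez : E z <= E z0.
    apply: (ge0_derive_le zz0 (dg := dE)) => // x /andP[zx _].
    apply: mulr_ge0; first by rewrite exprn_ge0// (le_trans (ltW zp)).
    by rewrite addr_ge0// mulr_ge0 ?sqr_ge0// subr_ge0.
  move: Ez; rewrite /E fz0 f'z0 expr0n/= addr0 mulr0.
  rewrite pmulr_rle0 ?exprn_gt0// => h.
  have := sqr_ge0 (f z); have := sqr_ge0 (f' z) => h1 h2.
  apply/eqP; rewrite -sqrf_eq0; apply/eqP/le_anti.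
  by rewrite h2 andbT (le_trans _ h)// lerDl.
have f01 : f 0 = 1 by rewrite /f expr0n/= oppr0 besselF0.
have fc : {for 0, continuous f} by exact/is_derive_continuous/df.
have f00 : 0 < f 0 by rewrite f01.
have [t] := continuous_gt0_right fc f00 z00.
by rewrite add0r => tz; rewrite f0// ltxx.
Qed.

Let cot c (z : R) := cos (z - c) / sin (z - c).

Let dcot c (z : R) : sin (z - c) != 0 ->
  is_derive z 1 (cot c) (- (1 + cot c z ^+ 2)).
Proof.
move=> s0.
have d1 : is_derive z 1 (fun y : R => y - c) 1.
  by apply: (der_eq (derB (derId z) (derC z c))); rewrite subr0.
have dc := der_comp (g := fun y : R => y - c) (is_derive_cos (z - c)) d1.
have ds := der_comp (g := fun y : R => y - c) (is_derive_sin (z - c)) d1.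
have dv := is_deriveV s0 ds.
apply: (der_eq (derM dc dv)).
by rewrite /GRing.scale/= /cot; field.
Qed.

(* With y = z^(mu + 1/2) f, the quantity z^(2 mu) h is y y' - y^2 s'/s, whose
   derivative is (y' - y s'/s)^2 + (mu^2 - 1/4) y^2 / z^2. *)
Let h c (z : R) := z * f z * f' z + (mu + 1 / 2) * f z ^+ 2 - z * f z ^+ 2 * cot c z.

Let h' c (z : R) := f z * f' z + z * f' z ^+ 2 + f z * (z * f'' z) +
  (2 * mu + 1) * (f z * f' z) - f z ^+ 2 * cot c z -
  2 * z * f z * f' z * cot c z + z * f z ^+ 2 * (1 + cot c z ^+ 2).

Let dh c (z : R) : sin (z - c) != 0 -> is_derive z 1 (h c) (h' c z).
Proof.
move=> s0.
have df2 : is_derive z 1 (fun y => f y ^+ 2) (2 * f z * f' z).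
  by apply: (der_eq (derM (df z) (df z))); ring.
have d1 := derM (derM (derId z) (df z)) (df' z).
have d2 := derZ (mu + 1 / 2) df2.
have d3 := derM (derM (derId z) df2) (dcot s0).
apply: (der_eq (derB (derD d1 d2) d3)).
by rewrite /h'; field.
Qed.

(** A zero of [f] at z2 would make [h] vanish there, although z^(2 mu) h is nondecreasing on
    [z1, z2], where the sine stays positive, and is positive at z1. *)
Let sturm_contra c z1 z2 : 0 < z1 <= z2 ->
  (forall z, z1 <= z <= z2 -> 0 < sin (z - c)) -> 0 < h c z1 -> f z2 != 0.
Proof.
move=> /andP[z10 z12] s0 h0; apply/eqP => fz2.
pose H (z : R) : R := z `^ (2 * mu) * h c z.
pose dH (z : R) : R := z `^ (2 * mu - 1) * (2 * mu * h c z + z * h' c z).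
have : H z1 <= H z2.
  apply: (ge0_derive_le z12 (dg := dH)) => z /andP[zz1 zz2].
    have z0 : 0 < z by exact: lt_le_trans zz1.
    have sn : sin (z - c) != 0 by rewrite gt_eqF// s0// zz1.
    apply: (der_eq (derM (is_derive1_powR (2 * mu) z0) (dh sn))).
    rewrite /dH -(@mulr_powRB1 _ z (2 * mu)) ?ltW ?mulr_gt0//; ring.
  rewrite mulr_ge0 ?powR_ge0//.
  rewrite (_ : _ + _ = (z * f' z + (mu + 1 / 2) * f z - z * f z * cot c z) ^+ 2 +
     (mu ^+ 2 - 1 / 4) * f z ^+ 2).
    rewrite addr_ge0 ?sqr_ge0// mulr_ge0 ?sqr_ge0//.
    by have := mu2; nra.
  transitivity (2 * mu * h c z + z * (f z * f' z + z * f' z ^+ 2 +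
    f z * (- ((2 * mu + 1) * f' z) - z * f z) +
    (2 * mu + 1) * (f z * f' z) - f z ^+ 2 * cot c z -
    2 * z * f z * f' z * cot c z + z * f z ^+ 2 * (1 + cot c z ^+ 2))).
    by rewrite /h' ode.
  by rewrite /h; field.
rewrite /H {2}/h fz2 !(mulr0, mul0r, expr0n)/= addr0 subr0 mulr0.
by rewrite leNgt mulr_gt0 ?powR_gt0.
Qed.

Lemma first_zero z1 : 0 < z1 -> f z1 = 0 -> pi <= z1.
Proof.
move=> z10 fz1; rewrite leNgt; apply/negP => z1pi.
(* The shift centres [0, z1] inside an arch of the sine, leaving a margin at both ends; in
   particular the cotangent is finite at 0, where h = mu + 1/2. *)
pose c := - ((pi - z1) / 2).
have s0 z : 0 <= z <= z1 -> 0 < sin (z - c).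
  by move=> /andP[z0 zz1]; apply: sin_gt0_pi; rewrite /c; lra.
have h00 : 0 < h c 0.
  rewrite /h !mul0r add0r subr0 /f expr0n/= oppr0 besselF0 expr1n mulr1.
  by rewrite addr_gt0.
have ch : {for 0, continuous (h c)}.
  apply/is_derive_continuous/dh; rewrite gt_eqF// s0// lexx ltW//.
have [z /andP[z0 zz1]] := continuous_gt0_right ch h00 z10; rewrite add0r => hz.
have := @sturm_contra c z z1; rewrite z0 zz1 fz1 eqxx => /(_ isT) H.
have : ~~ true by apply: H => // y /andP[zy yz1]; apply: s0; rewrite yz1 andbT (le_trans (ltW z0)).
by [].
Qed.

Lemma zero_spacing z0 z1 : 0 < z0 -> z0 < z1 -> f z0 = 0 -> f z1 = 0 -> pi <= z1 - z0.
Proof.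
move=> z00 z01 fz0 fz1; rewrite leNgt; apply/negP => zpi.
(* Again [z0, z1] is centred inside an arch of the sine. Here h vanishes at z0, but its derivative
   z0 f'(z0)^2 is positive because the zero is simple. *)
pose c := z0 - (pi - (z1 - z0)) / 2.
have s0 z : z0 <= z <= z1 -> 0 < sin (z - c).
  by move=> /andP[z0z zz1]; apply: sin_gt0_pi; rewrite /c; lra.
have d : is_derive z0 1 (h c) (z0 * f' z0 ^+ 2).
  apply: (der_eq (dh _)); first by rewrite gt_eqF// s0// lexx ltW.
  by rewrite /h' fz0; ring.
have l0 : 0 < z0 * f' z0 ^+ 2.
  by rewrite mulr_gt0// exprn_even_gt0//= simple_zero.
have z10 : 0 < z1 - z0 by rewrite subr_gt0.
have [t /andP[t0 tz] ht] := derive_gt0_right d l0 z10.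
have hz0 : h c z0 = 0 by rewrite /h fz0; ring.
rewrite hz0 in ht.
have zt : z0 + t <= z1 by rewrite -lerBrDl ltW.
have := @sturm_contra c (z0 + t) z1; rewrite zt fz1 eqxx addr_gt0//.
move=> /(_ isT) H; have : ~~ true; last by [].
apply: H => // y /andP[zy yz1]; apply: s0; rewrite yz1 andbT (le_trans _ zy)//.
by rewrite lerDl ltW.
Qed.

Section zeros.
Variable tau : nat -> R.
Hypothesis tau0 : forall i, 0 <= tau i.
Hypothesis tau_zero : forall i (x : R), 0 <= x -> `|F (- x)| <= `|1 - tau i * x| * F x.
Hypothesis tau_double : forall i j (x : R), i != j -> 0 <= x ->
  `|F (- x)| <= `|1 - tau i * x| * `|1 - tau j * x| * F x.

Let z i : R := (Num.sqrt (tau i))^-1.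

Let sqz i : 0 < tau i -> z i ^+ 2 = (tau i)^-1.
Proof. by move=> ti; rewrite /z exprVn sqr_sqrtr// ltW. Qed.

Let zp i : 0 < tau i -> 0 < z i.
Proof. by move=> ti; rewrite invr_gt0 sqrtr_gt0. Qed.

Let fz i : 0 < tau i -> f (z i) = 0.
Proof.
move=> ti; rewrite /f sqz//; apply/normr0_eq0/le_anti; rewrite normr_ge0 andbT.
have ti0 : 0 <= (tau i)^-1 by rewrite invr_ge0 ltW.
have := @tau_zero i _ ti0.
by rewrite mulfV ?gt_eqF// subrr normr0 mul0r.
Qed.

(** Equal values would bound |F(- x)| by a multiple of (x - x0)^2 near x0 = 1 / tau i, against the
    simplicity of the zero. *)
Let tau_inj i j : i != j -> 0 < tau i -> tau i != tau j.
Proof.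
move=> ij ti; apply/eqP => tij.
have ti0 : 0 <= (tau i)^-1 by rewrite invr_ge0 ltW.
have := simple_zero (zp ti) (fz ti).
rewrite /f' sqz// mulf_eq0 negb_or => /andP[_].
set x0 := (tau i)^-1 in ti0 * => l0.
set l := F' (- x0) in l0 *.
(* The sign makes s F(- x) increase at x0 with slope |l|, since the derivative of F(- x) there is -
   l. *)
pose s := - Num.sg l.
pose G (x : R) : R := s * F (- x) - tau i ^+ 2 * ((x - x0) * (x - x0) * F x).
have dm : is_derive x0 1 (fun x : R => x - x0) 1.
  by apply: (der_eq (derB (derId x0) (derC x0 x0))); rewrite subr0.
have dG : is_derive x0 1 G `|l|.
  have d1 := derZ s (der_comp (g := fun x : R => - x) (is_derive_besselF mu2 (- x0)) (derN (derId x0))).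
  have d2 := derZ (tau i ^+ 2) (derM (derM dm dm) (is_derive_besselF mu2 x0)).
  apply: (der_eq (derB d1 d2)).
  by rewrite subrr normrEsg /s -/l; ring.
have lp : 0 < `|l| by rewrite normr_gt0.
have [t /andP[t0 _]] := derive_gt0_right dG lp ltr01.
have -> : G x0 = s * F (- x0) by rewrite /G subrr; ring.
have -> : F (- x0) = 0 by rewrite /x0 -(sqz ti); exact: fz.
rewrite mulr0 /G subr_gt0 addrAC subrr add0r ltNge => /negP; apply.
have x0t : 0 <= x0 + t by rewrite addr_ge0// ltW.
have := tau_double ij x0t; rewrite -tij -normrM.
have -> : 1 - tau i * (x0 + t) = - (tau i * t).
  by rewrite mulrDr mulfV ?gt_eqF//; ring.
rewrite ger0_norm; last by rewrite -expr2 sqr_ge0.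
move=> FF; apply: le_trans (ler_norm _) _.
rewrite normrM (_ : `|s| = 1); last by rewrite normrN normr_sg l0.
rewrite mul1r; apply: le_trans FF _.
by rewrite le_eqVlt; apply/orP; left; apply/eqP; ring.
Qed.

(** Zeros at distance at least pi lie in different intervals [k pi, (k + 1) pi[. *)
Let z_inj i j : i != j -> 0 < tau i -> 0 < tau j ->
  Num.truncn (z i / pi) != Num.truncn (z j / pi).
Proof.
wlog zij : i j / z i < z j.
  move=> H ij ti tj; have := tau_inj ij ti.
  have [zij _|zij _|zij] := ltgtP (z i) (z j); first exact: H.
    by rewrite eq_sym; apply: H => //; rewrite eq_sym.
  move/eqP => []; apply: invr_inj; rewrite -!sqz//; by rewrite zij.
move=> ij ti tj.
have sp := zero_spacing (zp ti) zij (fz ti) (fz tj).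
have p0 : 0 < pi :> R by exact: pi_gt0.
rewrite neq_ltn; apply/orP; left.
have n1 : z i / pi + 1 <= z j / pi.
  by rewrite ler_pdivlMr// mulrDl divfK ?gt_eqF// mul1r addrC -lerBrDr.
have := truncnS_gt (z j / pi); have zi0 : 0 <= z i / pi by rewrite divr_ge0 ?ltW// zp.
have := truncn_le (z i / pi); rewrite zi0 => h1 h2.
have : (Num.truncn (z i / pi)).+1%:R < (Num.truncn (z j / pi)).+1%:R :> R.
  by apply: le_lt_trans h2; apply: le_trans n1; rewrite -natr1 lerD2r.
by rewrite !ltr_nat ltnS.
Qed.

(** The integer part of z i / pi embeds the counted indices into 1, ..., N with N the integer part
    of sqrt u / pi. It is at least 1 because the first zero is at least pi. *)
Lemma zeros_count (u : R) n : 0 < u ->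
  \sum_(0 <= i < n) (1 <= tau i * u)%R%:R <= Num.sqrt u / pi :> R.
Proof.
move=> u0.
have p0 : 0 < pi :> R by exact: pi_gt0.
pose N := Num.truncn (Num.sqrt u / pi).
have su0 : 0 <= Num.sqrt u / pi by rewrite divr_ge0 ?sqrtr_ge0// ltW.
apply: (@le_trans _ _ N%:R); last by have := truncn_le (Num.sqrt u / pi); rewrite su0.
rewrite -natr_sum ler_nat.
pose s := [seq i <- index_iota 0 n | 1 <= tau i * u].
have sP i : i \in s -> 0 < tau i /\ z i <= Num.sqrt u.
  rewrite mem_filter => /andP[tu _].
  have ti : 0 < tau i.
    rewrite lt_neqAle tau0 andbT; apply: contraTneq tu => <-.
    by rewrite mul0r -ltNge.
  split=> //; rewrite -(@ler_pXn2r _ 2) ?nnegrE ?sqrtr_ge0//; last exact/ltW/zp.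
  rewrite sqz// sqr_sqrtr; last exact: ltW.
  by rewrite -[_^-1]mul1r ler_pdivrMr// mulrC.
have -> : (\sum_(0 <= i < n) (1 <= tau i * u)%R = size [seq Num.truncn (z i / pi) | i <- s])%N.
  rewrite size_map size_filter -sum1_count [RHS]big_mkcond/=.
  by apply: eq_bigr => i _; case: ifP.
rewrite -(size_iota 1 N); apply: uniq_leq_size.
  rewrite map_inj_in_uniq ?filter_uniq ?iota_uniq// => i j /sP[ti _] /sP[tj _] e.
  by apply/eqP/negPn/negP => ij; have := z_inj ij ti tj; rewrite e eqxx.
move=> _ /mapP[i /sP[ti ziu] ->].
rewrite mem_iota add1n ltnS; apply/andP; split.
  rewrite truncn_gt0 ler_pdivlMr// mul1r.
  exact: first_zero (zp ti) (fz ti).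
by apply: le_truncn; rewrite ler_pM2r ?invr_gt0.
Qed.

End zeros.

Lemma besselF_zeros : exists tau : nat -> R,
  [/\ forall i, 0 <= tau i <= 3 / (i.+1%:R) ^+ 2,
      forall x, 0 <= x -> \prod_(i < n) (1 + tau i * x) @[n --> \oo] --> F x &
      forall u n, 0 < u ->
        \sum_(0 <= i < n) (1 <= tau i * u)%R%:R <= Num.sqrt u / pi :> R].
Proof.
have [tau [t0 tp t1 t2]] := besselF_product mu2.
exists tau; split=> // u n u0; apply: zeros_count => //.
by move=> i; have /andP[] := t0 i.
Qed.

End sturm.

(** * Potential of ln F *)

Section potentials.
Context (R : realType).
Local Notation leb := (@lebesgue_measure R).

Lemma derLn (x : R) : 0 < x -> is_derive x 1 (@ln R) x^-1.
Proof. exact: is_derive1_ln. Qed.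

Lemma cvgy_ge (f : R -> R) (g : R -> R) :
  (forall A : R, 0 < A -> forall u, g A <= u -> A <= f u) -> f u @[u --> +oo] --> +oo.
Proof.
move=> H; apply/cvgryPge => A; exists (g (`|A| + 1)); split; first exact: num_real.
move=> u /ltW gu; apply: le_trans (H _ _ _ gu); last by rewrite ltr_wpDl.
by rewrite (le_trans (ler_norm _))// lerDl.
Qed.

Variable x : R.
Hypothesis x0 : 0 < x.

Lemma sqrt_scaled_cvgy : Num.sqrt (u / x) @[u --> +oo] --> +oo.
Proof.
apply: (@cvgy_ge _ (fun A => A ^+ 2 * x)) => A A0 u Au.
rewrite -[leLHS]gtr0_norm// -sqrtr_sqr ler_wsqrtr//.
by rewrite ler_pdivlMr.
Qed.

Lemma atan_sqrt_cvgy : atan (Num.sqrt (u / x)) @[u --> +oo] --> pi / 2.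
Proof. exact: (cvg_comp _ _ sqrt_scaled_cvgy (@cvgy_atan R)). Qed.

Lemma atan_sqrt_cvg0 : atan (Num.sqrt (u / x)) @[u --> 0^'+] --> (0 : R).
Proof.
apply: cvg_at_right_filter.
have e : atan (Num.sqrt (0 / x)) = 0 :> R by rewrite mul0r sqrtr0 atan0.
rewrite -[X in _ --> X]e.
apply: (@continuous_comp _ _ _ (fun u : R => Num.sqrt (u / x)) atan); last exact: continuous_atan.
apply: (@continuous_comp _ _ _ (fun u : R => u / x) Num.sqrt); last exact: sqrt_continuous.
by apply: continuousM; [exact: cvg_id|exact: cvg_cst].
Qed.

Lemma derAtanSqrt (u : R) : 0 < u ->
  is_derive u 1 (fun u => atan (Num.sqrt (u / x))) (x / (x + u) * (2 * Num.sqrt (u / x) * x)^-1).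
Proof.
move=> u0.
have d1 : is_derive u 1 (fun u => u / x) x^-1.
  by apply: (der_eq (derM (derId u) (derC u x^-1))); rewrite mulr0 addr0 mul1r.
have ux : 0 < u / x by rewrite divr_gt0.
have d2 := der_comp (g := fun u => u / x) (is_derive1_sqrt ux) d1.
have d3 := der_comp (g := fun u => Num.sqrt (u / x)) (is_derive1_atan _) d2.
apply: (der_eq d3); rewrite sqr_sqrtr ?ltW//.
have : Num.sqrt (u / x) != 0 by rewrite gt_eqF// sqrtr_gt0.
move: (Num.sqrt (u / x)) => s s0; field.
by rewrite s0 !gt_eqF// addr_gt0.
Qed.

Lemma integral_sqrt_resolvent :
  (\int[leb]_(u in `]0%R, +oo[) (x / (x + u) * (Num.sqrt u / pi / u))%:E
   = (Num.sqrt x)%:E)%E.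
Proof.
have p0 : 0 < pi :> R by exact: pi_gt0.
have := (@ge0_FTC_oy R (fun u : R => x / (x + u) * (Num.sqrt u / pi / u)) (fun u : R => 2 * Num.sqrt x / pi * atan (Num.sqrt (u / x))) 0 0 (Num.sqrt x)).
rewrite subr0; apply.
- move=> u u0; by apply/ltW; rewrite mulr_gt0 ?divr_gt0 ?sqrtr_gt0// addr_gt0.
- move=> u u0; apply: continuousM.
    apply: continuousM; first exact: cvg_cst.
    apply: continuousV; first by rewrite gt_eqF// addr_gt0.
    by apply: continuousD; [exact: cvg_cst|exact: cvg_id].
  apply: continuousM; last by apply: continuousV; [rewrite gt_eqF|exact: cvg_id].
  apply: continuousM; last exact: cvg_cst.
  exact: sqrt_continuous.
- move=> u u0; apply: (der_eq (derZ _ (derAtanSqrt u0))).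
  have -> : u = Num.sqrt u ^+ 2 by rewrite sqr_sqrtr ?ltW.
  have -> : Num.sqrt (Num.sqrt u ^+ 2 / x) = Num.sqrt u / Num.sqrt x.
    by rewrite sqrtrM ?sqr_ge0// sqrtr_sqr ger0_norm ?sqrtr_ge0// sqrtrV// ltW.
  rewrite [Num.sqrt (Num.sqrt u ^+ 2)]sqrtr_sqr ger0_norm ?sqrtr_ge0//.
  have : Num.sqrt x ^+ 2 = x by rewrite sqr_sqrtr ?ltW.
  have : 0 < Num.sqrt u by rewrite sqrtr_gt0.
  have : 0 < Num.sqrt x by rewrite sqrtr_gt0.
  move: (Num.sqrt u) (Num.sqrt x) (pi : R) p0 => v y p p0 y0 v0 <-; field.
  by rewrite !gt_eqF//= addr_gt0// exprn_gt0.
- rewrite -[X in _ --> X](mulr0 (2 * Num.sqrt x / pi)); apply: cvgM; first exact: cvg_cst.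
  exact: atan_sqrt_cvg0.
- rewrite [X in _ --> X](_ : _ = (2 * Num.sqrt x / pi) * (pi / 2)); last first.
    by move: (pi : R) p0 => p p0; field; rewrite gt_eqF.
  by apply: cvgM; [exact: cvg_cst|exact: atan_sqrt_cvgy].
Qed.

(** A factor 1 + t x of F contributes a unit jump at u = 1 / t to the counting function. Its
    logarithm is the integral of x / (x + u) du / u beyond that jump, with primitive - ln (1 + x /
    u). *)
Lemma integral_step_resolvent (t : R) : 0 <= t ->
  (\int[leb]_(u in `]0%R, +oo[) (x / (x + u) * ((1 <= t * u)%R%:R / u))%:E
   = (ln (1 + t * x))%:E)%E.
Proof.
rewrite le_eqVlt => /predU1P[<-|t0].
  rewrite mul0r addr0 ln1; apply: integral0_eq => u _.
  by rewrite mul0r ler10/= mul0r mulr0.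
have ti : 0 < t^-1 by rewrite invr_gt0.
transitivity (\int[leb]_(u in `[t^-1%R, +oo[) (x / (x + u) * u^-1)%:E)%E.
  rewrite [LHS]integral_mkcond [RHS]integral_mkcond; apply: eq_integral => u _.
  rewrite !patchE.
  have -> : (u \in `[t^-1, +oo[%classic) = (0 < u) && (1 <= t * u).
    rewrite mem_setE/= in_itv/= andbT -[in RHS]ler_pdivrMl// mulr1.
    apply/idP/andP => [tu|[]//]; split => //; exact: lt_le_trans tu.
  rewrite mem_setE/= in_itv/= andbT; case: ifPn => //= u0.
  by case: ifPn => _; rewrite ?mul1r// mul0r mulr0.
have c (u : R) : 0 < u -> {for u, continuous (fun u : R => x / (x + u) * u^-1)}.
  move=> u0; apply: continuousM.
    apply: continuousM; first exact: cvg_cst.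
    apply: continuousV; first by rewrite gt_eqF// addr_gt0.
    by apply: continuousD; [exact: cvg_cst|exact: cvg_id].
  by apply: continuousV; [rewrite gt_eqF|exact: cvg_id].
rewrite -integral_itv_obnd_cbnd; last first.
  apply/measurable_EFinP; apply: open_continuous_measurable_fun => //.
  by move=> u /set_mem/=; rewrite in_itv/= andbT => tu; apply/c/(lt_trans ti).
have := (@ge0_FTC_oy R (fun u : R => x / (x + u) * u^-1) (fun u : R => - ln (1 + x / u)) t^-1 (- ln (1 + t * x)) 0).
rewrite sub0r opprK; apply.
- by move=> u /(lt_trans ti) u0; rewrite mulr_ge0 ?invr_ge0 ?divr_ge0 ?ltW// addr_gt0.
- by move=> u /(lt_trans ti); exact: c.
- move=> u /(lt_trans ti) u0.
  have p : 0 < 1 + x / u by rewrite addr_gt0 ?divr_gt0.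
  have d1 := derD (derC u 1) (derZ x (is_deriveV (lt0r_neq0 u0) (derId u))).
  apply: (der_eq (derN (der_comp (g := fun u => 1 + x / u) (derLn p) d1))).
  by rewrite /GRing.scale/=; field; rewrite !gt_eqF//= addr_gt0.
- apply: cvg_at_right_filter; apply: cvgN.
  have p : 0 < 1 + t * x by rewrite addr_gt0 ?mulr_gt0.
  apply: (cvg_comp (fun u => 1 + x / u) (@ln R)); last exact: continuous_ln p.
  apply: cvgD; first exact: cvg_cst.
  have e : x * (t^-1)^-1 = t * x by rewrite invrK mulrC.
  rewrite -[X in _ --> X]e; apply: cvgM; first exact: cvg_cst.
  by apply: cvgV; [rewrite gt_eqF|exact: cvg_id].
- have c1 : 1 + x / u @[u --> +oo] --> 1 + x * 0.
    apply: cvgD; first exact: cvg_cst.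
    apply: cvgM; first exact: cvg_cst.
    by apply/gtr0_cvgV0; [near=> u; near: u; exact: nbhs_pinfty_gt|exact: cvg_id].
  rewrite mulr0 addr0 in c1.
  rewrite -oppr0 -[X in _ --> - X](@ln1 R); apply: cvgN.
  exact: (cvg_comp _ _ c1 (continuous_ln ltr01)).
Unshelve. all: by end_near. Qed.

End potentials.

Section bessel_potential.
Context (R : realType) (mu : R).
Hypothesis mu2 : 1 / 2 < mu.
Local Notation leb := (@lebesgue_measure R).
Local Notation RR := (measurableTypeR R).

Lemma measurable_resolvent (x : R) : measurable_fun [set: RR] (fun u : RR => x / (x + u)).
Proof.
apply: measurable_funM => //.
apply: (measurableT_comp (@measurable_invr R)).
by apply: measurable_funD => //; exact: measurable_id.
Qed.

Lemma series_ln_prod (tau : nat -> R) (f x : R) : (forall i, 0 <= tau i) -> 0 <= x -> 0 < f ->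
  \prod_(i < n) (1 + tau i * x) @[n --> \oo] --> f ->
  series (fun i => ln (1 + tau i * x)) @ \oo --> ln f.
Proof.
move=> t0 x0 f0 cf.
have p i : 0 < 1 + tau i * x by rewrite ltr_wpDr// mulr_ge0.
rewrite (_ : series _ = fun n => ln (\prod_(i < n) (1 + tau i * x))); last first.
  apply/funext => n; rewrite /series/= big_mkord; elim: n => [|n IH].
    by rewrite !big_ord0 ln1.
  have P : 0 < \prod_(i < n) (1 + tau i * x) by apply: prodr_gt0 => i _; exact: p.
  by rewrite !big_ord_recr/= IH lnM ?posrE.
exact: (cvg_comp _ _ cf (continuous_ln f0)).
Qed.

Lemma besselF_gt0 x : 0 <= x -> 0 < besselF mu x.
Proof.
move=> x0; apply: lt_le_trans (besselF_ge1 mu2 x0).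
by rewrite ltr_wpDr// mulr_ge0// ltW// bcoef_gt0.
Qed.

Lemma besselF_potential : exists w : RR -> R,
  [/\ measurable_fun setT w, forall u, 0 <= w u &
      forall x, 0 < x -> (\int[leb]_(u in `]0%R, +oo[) (x / (x + u) * w u)%:E =
        (Num.sqrt x - ln (besselF mu x))%:E)%E].
Proof.
have [tau [tau0 cF cnt]] := besselF_zeros mu2.
have t0 i : 0 <= tau i by have /andP[] := tau0 i.
pose s (u : R) : R^nat := fun i => (1 <= tau i * u)%R%:R.
pose N (u : R) : R := limn (series (s u)).
have sN u n : series (s u) n <= Num.sqrt u / pi.
  rewrite /series/=; have [u0|u0] := ltP 0 u; first exact: cnt.
  rewrite big1 ?divr_ge0 ?sqrtr_ge0 ?pi_ge0// => i _.
  rewrite /s leNgt (le_lt_trans _ ltr01)//.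
  by rewrite -[leRHS](mulr0 (tau i)) ler_wpM2l.
have cN u : series (s u) @ \oo --> N u.
  apply: nondecreasing_is_cvgn.
    by apply: nondecreasing_series => i _ _.
  by exists (Num.sqrt u / pi) => _ [n _ <-].
have Nle u : N u <= Num.sqrt u / pi.
  by apply: limr_le; [apply/cvg_ex; exists (N u)|exact: nearW].
have ms i : measurable_fun [set: RR] (fun u : RR => s u i).
  rewrite (_ : (fun u => s u i) = fun u => if 1 <= tau i * u then 1 else 0); last first.
    by apply/funext => u; rewrite /s; case: ifP.
  apply: measurable_fun_ifT => //.
  exact: measurable_fun_ler.
have mN : measurable_fun [set: RR] N.
  apply: (@measurable_fun_cvg _ RR R setT (fun n u => series (s u) n)) => //.
  by move=> n; rewrite /series/=; apply: measurable_sum.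
have N0 u : 0 <= N u.
  apply: limr_ge; first by apply/cvg_ex; exists (N u).
  by apply: nearW => n; rewrite sumr_ge0.
have mi : measurable_fun [set: RR] (fun u : RR => u^-1 : R) by exact: measurable_invr.
have m1 : measurable_fun [set: RR] (fun u : RR => Num.sqrt u / pi / u).
  apply: measurable_funM => //; apply: measurable_funM => //.
  by apply: continuous_measurable_fun; exact: sqrt_continuous.
have m2 : measurable_fun [set: RR] (fun u : RR => N u / u).
  exact: measurable_funM.
have m3 (x : R) := measurable_resolvent x.
pose w (u : RR) : R := Num.sqrt u / pi / u - N u / u.
have w0 u : 0 <= w u.
  rewrite /w -mulrBl; have [u0|u0] := ltP 0 u.
    by rewrite divr_ge0 ?subr_ge0// ltW.
  (* The density must be nonnegative on the whole line; for u <= 0 the square root is 0 by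
     convention, and so is its minorant N. *)
  have Nu : N u = 0.
    apply/le_anti; rewrite N0 andbT (le_trans (Nle u))// ler0_sqrtr//.
    by rewrite mul0r.
  by rewrite Nu ler0_sqrtr// mul0r subr0 mul0r.
have mw : measurable_fun setT w by exact: measurable_funB.
exists w; split => //.
move=> x x0.
have r0 u : 0 < u -> 0 <= x / (x + u) by move=> u0; apply/ltW; rewrite divr_gt0// addr_gt0.
have IN : (\int[leb]_(u in `]0%R, +oo[) (x / (x + u) * (N u / u))%:E =
    (ln (besselF mu x))%:E)%E.
  transitivity (\int[leb]_(u in `]0%R, +oo[)
     \sum_(i <oo) (x / (x + u) * (s u i / u))%:E)%E.
    apply: eq_integral => u _; apply/esym/eseries_EFin.
    rewrite (_ : series _ = fun n => x / (x + u) * (series (s u) n / u)).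
      by apply: cvgM; [exact: cvg_cst|apply: cvgM => //; exact: cvg_cst].
    by apply/funext => n; rewrite /series/= mulr_suml mulr_sumr.
  rewrite integral_nneseries//.
  - under eq_eseriesr do rewrite integral_step_resolvent//.
    apply: eseries_EFin; apply: series_ln_prod => //; [exact: ltW|exact/besselF_gt0/ltW|].
    exact/cF/ltW.
  - move=> i; apply/measurable_EFinP; apply: measurable_funTS.
    by apply: measurable_funM => //; exact: measurable_funM.
  - move=> i u; rewrite /= in_itv/= andbT => u0; rewrite lee_fin mulr_ge0 ?r0//.
    by rewrite divr_ge0// ltW.
have := integral_sqrt_resolvent x0.
(* Adding the counting part back keeps every integrand nonnegative; its integral is finite and can
   then be cancelled. *)
rewrite (eq_integral (fun u : RR => (x / (x + u) * w u)%:E + (x / (x + u) * (N u / u))%:E)%E); last first.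
  by move=> u _; rewrite -EFinD -mulrDr /w subrK.
rewrite ge0_integralD//=.
- by rewrite IN EFinB => <-; rewrite addeK.
- by move=> u; rewrite /= in_itv/= andbT => u0; rewrite lee_fin mulr_ge0 ?r0.
- by apply/measurable_EFinP; apply: measurable_funTS; exact: measurable_funM.
- move=> u; rewrite /= in_itv/= andbT => u0; rewrite lee_fin mulr_ge0 ?r0//.
  by rewrite divr_ge0// ltW.
- by apply/measurable_EFinP; apply: measurable_funTS; exact: measurable_funM.
Qed.

End bessel_potential.

Lemma is_laplace_dilation (R : realType) (f : R -> R) (c : R) : 0 < c -> is_laplace f ->
  is_laplace (fun x => f (c * x)).
Proof.
move=> c0 [d [T [P [X [mX X0 XE]]]]].
exists d, T, P, (fun t => c * X t); split.
- by apply: measurable_funM.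
- by move=> t; rewrite mulr_ge0// ltW.
- move=> x x0; rewrite -XE ?mulr_gt0//; apply: eq_integral => t _.
  by rewrite mulrA [x * c]mulrC.
Qed.

(** Taking an n-th root divides the nonnegative density of the potential by n, so the root is again
    the exponential of minus such a potential. *)
Lemma besselF_root (R : realType) (mu a : R) n : 1 / 2 < mu -> 0 < a -> (0 < n)%N ->
  exists2 h : R -> R, is_laplace h &
    forall x, 0 < x -> h x ^+ n = expR (- (a * Num.sqrt x)) * besselF mu (a ^+ 2 * x).
Proof.
move=> mu2 a0 n0.
have [w [mw w0 wE]] := besselF_potential mu2.
have nR0 : 0 < n%:R :> R by rewrite ltr0n.
pose psi x := (Num.sqrt x - ln (besselF mu x)) / n%:R.
have Lpsi : is_laplace (fun x => expR (- psi x)).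
  apply: (@is_laplace_exp_potential R (fun u => w u / n%:R)).
  - by apply: measurable_funM.
  - by move=> u; rewrite divr_ge0// ltW.
  move=> x x0; rewrite /psi EFinM -wE// muleC.
  rewrite -ge0_integralZl//=.
  - by apply: eq_integral => u _; rewrite -EFinM; congr EFin; ring.
  - apply/measurable_EFinP; apply: measurable_funTS; apply: measurable_funM => //.
    exact: measurable_resolvent.
  - move=> u; rewrite in_itv/= andbT => u0.
    by rewrite lee_fin mulr_ge0// ltW// divr_gt0// addr_gt0.
have a20 : 0 < a ^+ 2 by rewrite exprn_gt0.
exists (fun x => expR (- psi (a ^+ 2 * x))); first exact: is_laplace_dilation a20 Lpsi.
move=> x x0; rewrite -expRM_natl /psi mulrN mulrC divfK ?gt_eqF//.
rewrite opprB expRD lnK ?posrE; last by apply: besselF_gt0 => //; rewrite ltW// mulr_gt0.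
by rewrite mulrC sqrtrM ?sqr_ge0// sqrtr_sqr gtr0_norm.
Qed.

(** * Stieltjes transforms and atoms *)

Section stieltjes_moments.
Context (R : realType) d (Y : measurableType d) (mu : {measure set Y -> \bar R}).
Variables (B : set Y) (T : Y -> R).
Hypotheses (mB : measurable B) (mT : measurable_fun B T).
Hypothesis T0 : forall y, B y -> 0 < T y.

(** The majorant is asked for only when z > x / 2, since the resolvents it is applied to need not be
    uniformly integrable near z = 0. *)
Lemma is_derive_integral (f f' : R -> Y -> R) (G : Y -> R) (x : R) : 0 < x ->
  (forall z, 0 < z -> mu.-integrable B (EFin \o f z)) ->
  (forall (z : R) y, 0 < z -> B y -> is_derive z 1 (f ^~ y) (f' z y)) ->
  (forall y, 0 <= G y) -> mu.-integrable B (EFin \o G) ->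
  (forall z y, x / 2 < z -> B y -> `|f' z y| <= G y) ->
  is_derive x 1 (fun z => \int[mu]_(y in B) f z y) (\int[mu]_(y in B) f' x y).
Proof.
move=> x0 intf derf G0 intG ub.
have x2 : 0 < x / 2 by rewrite divr_gt0.
pose I : set R := `]x / 2, x + 1[%classic.
have Ix : I x by rewrite /I/= in_itv/= ltr_pdivrMr// ltr_pMr// ltr1n ltrDl ltr01.
have Ip z : I z -> 0 < z /\ x / 2 < z.
  by rewrite /I/= in_itv/= => /andP[z1 _]; split => //; exact: lt_trans z1.
have i1 z : I z -> mu.-integrable B (EFin \o f z) by move=> /Ip[z0 _]; exact: intf.
have i2 z y : I z -> B y -> derivable (f ^~ y) z 1.
  by move=> /Ip[z0 _] By; apply: ex_derive; exact: derf.
have pf z y : 0 < z -> B y -> partial1of2 f z y = f' z y.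
  by move=> z0 By; rewrite partial1of2E; apply: derive_val; exact: derf.
have i3 z y : I z -> B y -> `|partial1of2 f z y| <= G y.
  by move=> /Ip[z0 zx] By; rewrite pf//; exact: ub.
apply: DeriveDef.
  exact: (derivable_under_integral mB Ix i1 i2 G0 intG i3).
rewrite -derive1E (differentiation_under_integral mB Ix i1 i2 G0 intG i3).
by apply: eq_Rintegral => y /set_mem By; rewrite pf.
Qed.

Hypothesis fin : forall x : R, 0 < x ->
  (\int[mu]_(y in B) (ln (1 + x / T y))%:E < +oo)%E.

Let ln0 (x : R) y : 0 < x -> B y -> 0 <= ln (1 + x / T y).
Proof. by move=> x0 By; rewrite ln_ge0// lerDl divr_ge0// ltW// T0. Qed.

Let mln (x : R) : measurable_fun B (fun y => ln (1 + x / T y)).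
Proof.
apply: (@measurableT_comp _ _ _ _ _ _ (@ln R)); first exact: measurable_ln.
apply: measurable_funD => //; apply: measurable_funM => //.
by apply: (measurableT_comp (@measurable_invr R)).
Qed.

Lemma integrable_ln x : 0 < x -> mu.-integrable B (EFin \o fun y => ln (1 + x / T y)).
Proof.
move=> x0; apply/integrableP; split; first exact/measurable_EFinP.
rewrite (eq_integral (fun y => (ln (1 + x / T y))%:E)); first exact: fin.
by move=> y /set_mem By; rewrite gee0_abs// lee_fin ln0.
Qed.

Let mres n (x : R) : measurable_fun B (fun y => (x + T y) ^- n).
Proof.
apply: (measurableT_comp (@measurable_invr R)).
by apply: measurable_funX; exact: measurable_funD.
Qed.

(** This is ln v <= v - 1 at v = t / (x + t). It derives the integrability of all resolvent powers
    from the finiteness of the logarithmic potential alone. *)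
Lemma inv_le_ln (x t : R) : 0 < x -> 0 < t -> (x + t)^-1 <= x^-1 * ln (1 + x / t).
Proof.
move=> x0 t0; rewrite -[leRHS]mulrC ler_pdivlMr//.
have xt : 0 < x + t by rewrite addr_gt0.
have -> : 1 + x / t = ((x + t)^-1 * t)^-1 by field; rewrite !gt_eqF.
rewrite lnV ?posrE ?mulr_gt0 ?invr_gt0// lerNr.
have := @le_ln1Dx R ((x + t)^-1 * t - 1).
rewrite addrCA subrr addr0 => h; apply: le_trans (h _) _.
  by rewrite ltrBrDr addrC subrr mulr_gt0// invr_gt0.
rewrite le_eqVlt; apply/orP; left; apply/eqP; field; exact: lt0r_neq0.
Qed.

Lemma integrable_resolvent n x : 0 < x ->
  mu.-integrable B (EFin \o fun y => (x + T y) ^- n.+1).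
Proof.
move=> x0; apply: (@le_integrable _ _ _ mu B mB _ (EFin \o fun y => (x ^- n.+1) * ln (1 + x / T y))).
- exact/measurable_EFinP.
- move=> y By; have Ty := T0 By; have xT : 0 < x + T y by rewrite addr_gt0.
  have h1 : 0 <= (x + T y) ^- n.+1 by rewrite invr_ge0 exprn_ge0// ltW.
  have h2 : 0 <= x ^- n.+1 by rewrite invr_ge0 exprn_ge0// ltW.
  have h3 : 0 <= (x + T y) ^- n by rewrite invr_ge0 exprn_ge0// ltW.
  rewrite /= lee_fin ger0_norm// ger0_norm; last by rewrite mulr_ge0 ?ln0.
  rewrite exprS invfM mulrC.
  apply: le_trans (ler_wpM2l h3 (inv_le_ln x0 Ty)) _.
  rewrite mulrA; apply: ler_wpM2r; first exact: ln0.
  rewrite exprSr invfM ler_wpM2r ?invr_ge0 ?(ltW x0)//.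
  rewrite lef_pV2 ?posrE ?exprn_gt0// lerXn2r ?nnegrE ?(ltW x0) ?(ltW xT)//.
  by rewrite lerDl ltW.
- exact: (integrableZl mB (x ^- n.+1) (integrable_ln x0)).
Qed.

Lemma is_derive_integral_ln (x : R) : 0 < x ->
  is_derive x 1 (fun z => \int[mu]_(y in B) ln (1 + z / T y)) (\int[mu]_(y in B) (x + T y) ^- 1).
Proof.
move=> x0; have x2 : 0 < x / 2 by rewrite divr_gt0.
apply: (@is_derive_integral (fun z y => ln (1 + z / T y)) (fun z y => (z + T y) ^- 1)
  (fun y => `|(x / 2 + T y) ^- 1|)) => //.
- exact: integrable_ln.
- move=> z y z0 By; have Ty := T0 By.
  have p : 0 < 1 + z / T y by rewrite addr_gt0// divr_gt0.
  have d1 := derD (derC z 1) (derM (derId z) (derC z (T y)^-1)).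
  apply: (der_eq (der_comp (g := fun z => 1 + z / T y) (derLn p) d1)).
  by rewrite expr1; field; rewrite !gt_eqF// addr_gt0.
- exact: (integrable_abse (integrable_resolvent 0 x2)).
- move=> z y xz By; have Ty := T0 By; have z0 := lt_trans x2 xz.
  rewrite !expr1 !gtr0_norm ?invr_gt0 ?addr_gt0//.
  by rewrite lef_pV2 ?posrE ?addr_gt0// lerD2r ltW.
Qed.

Lemma is_derive_integral_resolvent n (x : R) : 0 < x ->
  is_derive x 1 (fun z => \int[mu]_(y in B) (z + T y) ^- n.+1)
    (- n.+1%:R * \int[mu]_(y in B) (x + T y) ^- n.+2).
Proof.
move=> x0; have x2 : 0 < x / 2 by rewrite divr_gt0.
rewrite -RintegralZl//; last exact: integrable_resolvent.
apply: (@is_derive_integral (fun z y => (z + T y) ^- n.+1) (fun z y => - n.+1%:R * (z + T y) ^- n.+2)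
  (fun y => `|n.+1%:R * (x / 2 + T y) ^- n.+2|)) => //.
- by move=> z z0; exact: integrable_resolvent.
- move=> z y z0 By; have Ty := T0 By.
  have p : 0 < z + T y by rewrite addr_gt0.
  have d1 := derD (derId z) (derC z (T y)).
  have d2 := der_comp (g := fun z => z + T y) (derX n (z + T y)) d1.
  have p0 : (z + T y) ^+ n.+1 != 0 by rewrite expf_neq0// gt_eqF.
  have d3 := @is_deriveV R (fun z => (z + T y) ^+ n.+1) z _ _ p0 d2.
  apply: (der_eq d3).
  rewrite /GRing.scale/= addr0 mulr1 !exprS.
  move: p0; rewrite exprS mulf_eq0 negb_or => /andP[p1 p2]; field.
  by rewrite p1 p2.
- exact: (integrable_abse (integrableZl mB n.+1%:R (integrable_resolvent n.+1 x2))).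
- move=> z y xz By; have Ty := T0 By; have z0 := lt_trans x2 xz.
  rewrite mulNr normrN !normrM ler_wpM2l//.
  rewrite !gtr0_norm ?invr_gt0 ?exprn_gt0 ?addr_gt0//.
  rewrite lef_pV2 ?posrE ?exprn_gt0 ?addr_gt0// lerXn2r ?nnegrE ?ltW ?addr_gt0//.
  by rewrite ltrD2r.
Qed.

Variable c : R.
Hypothesis c0 : 0 < c.
Let u y : R := c / (c + T y).

Let u01 y : B y -> 0 < u y < 1.
Proof.
move=> By; have Ty := T0 By.
by rewrite divr_gt0 ?addr_gt0//= ltr_pdivrMr ?addr_gt0// mul1r ltrDl.
Qed.

Let mu1 : measurable_fun B u.
Proof.
apply: measurable_funM => //; apply: (measurableT_comp (@measurable_invr R)).
exact: measurable_funD.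
Qed.

Let integrable_u2 : mu.-integrable B (EFin \o fun y => u y ^+ 2).
Proof.
have := integrableZl mB (c ^+ 2) (integrable_resolvent 1 c0).
by under eq_fun do rewrite /= -EFinM -expr_div_n.
Qed.

(** The exponent of [u] starts at 2 because the first resolvents still differ by the constant
    [alpha]; only the later ones coincide. *)
Let moment n j := \int[mu]_(y in B) (u y ^+ n.+2 * (1 - u y) ^+ j).

Let integrable_moment n j :
  mu.-integrable B (EFin \o fun y => u y ^+ n.+2 * (1 - u y) ^+ j).
Proof.
apply: (le_integrable mB _ _ integrable_u2).
  apply/measurable_EFinP; apply: measurable_funM; apply: measurable_funX => //.
  exact: measurable_funB.
move=> y By; have /andP[uy0 uy1] := u01 By; rewrite lee_fin.
have v0 : 0 <= 1 - u y by rewrite subr_ge0 ltW.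
have v1 : (1 - u y) <= 1 by rewrite lerBlDr lerDl ltW.
have h2 k : 0 <= u y ^+ k by rewrite exprn_ge0// ltW.
rewrite ger0_norm; last by rewrite mulr_ge0// exprn_ge0.
rewrite ger0_norm// -addn2 exprD mulrAC ler_piMl//.
by rewrite mulr_ile1// ?exprn_ge0// exprn_ile1// ltW.
Qed.

Lemma resolvent_moment0 n : moment n 0 = c ^+ n.+2 * \int[mu]_(y in B) (c + T y) ^- n.+2.
Proof.
rewrite -RintegralZl//; last exact: integrable_resolvent.
by apply: eq_Rintegral => y _; rewrite /u expr0 mulr1 expr_div_n.
Qed.

Lemma resolvent_momentS n j : moment n j.+1 = moment n j - moment n.+1 j.
Proof.
rewrite -RintegralB//.
by apply: eq_Rintegral => y _; move: (u y) => v; rewrite [_ ^+ j.+1]exprS [v ^+ n.+3]exprS; ring.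
Qed.

(* 4 u (1 - u) is at most 1, with equality exactly where T = c. *)
Lemma cvg_bump : ((4 ^+ k * moment k k)%:E @[k --> \oo] -->
  (4^-1)%:E * mu (B `&` T @^-1` [set c]))%E.
Proof.
pose f k y : R := u y ^+ 2 * (4 * (u y * (1 - u y))) ^+ k.
pose A := B `&` T @^-1` [set c].
pose g y : R := 4^-1 * \1_A y.
have mA : measurable A by exact: mT.
have fE k y : 4 ^+ k * (u y ^+ k.+2 * (1 - u y) ^+ k) = f k y.
  rewrite /f; move: (u y) => v; rewrite !exprMn -(addn2 k) exprD.
  by move: (4 ^+ k) (v ^+ k) ((1 - v) ^+ k) (v ^+ 2) => p q r s; ring.
have fint k : (\int[mu]_(y in B) (f k y)%:E = (4 ^+ k * moment k k)%:E)%E.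
  rewrite /moment -RintegralZl// /Rintegral fineK//.
    by apply: eq_integral => y _; rewrite fE.
  exact: integrable_fin_num (integrableZl mB (4 ^+ k) (integrable_moment k k)).
have q01 y : B y -> 0 <= 4 * (u y * (1 - u y)) <= 1.
  move=> /u01/andP[]; move: (u y) => v v0 v1; apply/andP; split.
    by rewrite mulr_ge0// mulr_ge0// ?subr_ge0 ltW.
  by have := sqr_ge0 (2 * v - 1); nra.
have cfg y : B y -> f k y @[k --> \oo] --> g y.
  move=> By; rewrite /g indicE; have [/set_mem[_ /= Tc]|nA] := boolP (y \in A).
    apply: cvg_near_cst; apply: nearW => k.
    have uE : u y = 2^-1.
      by rewrite /u Tc; field; rewrite lt0r_neq0 ?addr_gt0.
    have qE : 4 * (2^-1 * (1 - 2^-1)) = 1 :> R by field.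
    by rewrite /f uE qE expr1n; field.
  have Tc : T y != c.
    by apply: contraNneq nA => Tc; apply/mem_set; split.
  rewrite mulr0 -[X in _ --> X](mulr0 (u y ^+ 2)); apply: cvgM; first exact: cvg_cst.
  apply: cvg_expr; have /andP[q0 q1] := q01 y By.
  rewrite ger0_norm// lt_neqAle q1 andbT; apply: contraNneq Tc => q.
  have Ty := T0 By; have cT : c + T y != 0 by rewrite gt_eqF// addr_gt0.
  have : (T y - c) ^+ 2 = (c + T y) ^+ 2 * (1 - 4 * (u y * (1 - u y))).
    by rewrite /u; field.
  by rewrite q subrr mulr0 => /eqP; rewrite sqrf_eq0 subr_eq0.
have mf k : measurable_fun B (f k).
  apply: measurable_funM; apply: measurable_funX => //.
  by apply: measurable_funM => //; apply: measurable_funM => //; exact: measurable_funB.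
have mg : measurable_fun B g.
  by apply: measurable_funM => //; exact: measurable_indic.
have [] // := @dominated_convergence _ Y R mu B mB (fun k y => (f k y)%:E)
   (fun y => (g y)%:E) (fun y => (u y ^+ 2)%:E).
- by move=> k; apply/measurable_EFinP.
- exact/measurable_EFinP.
- by apply: nearW => y By; apply: cvg_EFin; [exact: nearW|exact: cfg].
- apply: nearW => y k By; rewrite lee_fin /f normrM normrX normrX.
  have /andP[uy0 _] := u01 By; have /andP[q0 q1] := q01 y By.
  rewrite (gtr0_norm uy0) (ger0_norm q0) ler_piMr ?exprn_ile1//.
  by rewrite exprn_ge0// ltW.
move=> _ _; rewrite (eq_cvg _ _ fint).
rewrite (_ : (\int[mu]_(y in B) (g y)%:E)%E = ((4^-1)%:E * mu A)%E)//.
under eq_integral do rewrite /g EFinM.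
rewrite ge0_integralZl//; last first.
  by apply/measurable_EFinP; exact: measurable_indic.
by rewrite integral_indic// setIC setIA setIid.
Qed.

End stieltjes_moments.

Lemma is_derive_pos_unique (R : realType) (f g : R -> R) (x a b : R) : 0 < x ->
  (forall z, 0 < z -> f z = g z) -> is_derive x 1 f a -> is_derive x 1 g b -> a = b.
Proof.
move=> x0 fg fa gb.
have nfg : \near x, f x = g x.
  near=> z; apply: fg; near: z; exact: lt_nbhsr.
have [_ <-] := near_eq_is_derive nfg fa.
by have [_ <-] := gb.
Unshelve. all: by end_near. Qed.

Section stieltjes_uniqueness.
Context (R : realType) d1 d2 (Y1 : measurableType d1) (Y2 : measurableType d2)
  (mu1 : {measure set Y1 -> \bar R}) (mu2 : {measure set Y2 -> \bar R}).
Variables (B1 : set Y1) (B2 : set Y2) (T1 : Y1 -> R) (T2 : Y2 -> R).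
Hypotheses (mB1 : measurable B1) (mB2 : measurable B2).
Hypotheses (mT1 : measurable_fun B1 T1) (mT2 : measurable_fun B2 T2).
Hypotheses (T10 : forall y, B1 y -> 0 < T1 y) (T20 : forall y, B2 y -> 0 < T2 y).
Hypothesis fin1 : forall x : R, 0 < x ->
  (\int[mu1]_(y in B1) (ln (1 + x / T1 y))%:E < +oo)%E.
Hypothesis fin2 : forall x : R, 0 < x ->
  (\int[mu2]_(y in B2) (ln (1 + x / T2 y))%:E < +oo)%E.
Variable alpha : R.
Hypothesis eq12 : forall x : R, 0 < x ->
  \int[mu2]_(y in B2) ln (1 + x / T2 y) = alpha * x + \int[mu1]_(y in B1) ln (1 + x / T1 y).

Let resolvent1 x : 0 < x ->
  \int[mu2]_(y in B2) (x + T2 y) ^- 1 = alpha + \int[mu1]_(y in B1) (x + T1 y) ^- 1.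
Proof.
move=> x0; apply: (is_derive_pos_unique x0 eq12).
  exact: is_derive_integral_ln.
apply: derD; last exact: is_derive_integral_ln.
by apply: (der_eq (derZ alpha (derId x))); rewrite mulr1.
Qed.

(** One derivative of [resolvent1] removes [alpha], and each further derivative raises the power by
    one. *)
Let resolvent_eq n x : 0 < x ->
  \int[mu2]_(y in B2) (x + T2 y) ^- n.+2 = \int[mu1]_(y in B1) (x + T1 y) ^- n.+2.
Proof.
elim: n x => [|n IH] x x0.
  have der2 := is_derive_integral_resolvent mB2 mT2 T20 fin2 0 x0.
  have der1 := is_derive_integral_resolvent mB1 mT1 T10 fin1 0 x0.
  have := is_derive_pos_unique x0 resolvent1 der2 (derD (derC x alpha) der1).
  by rewrite add0r !mulN1r => /oppr_inj.
have der2 := is_derive_integral_resolvent mB2 mT2 T20 fin2 n.+1 x0.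
have der1 := is_derive_integral_resolvent mB1 mT1 T10 fin1 n.+1 x0.
have := is_derive_pos_unique x0 IH der2 der1.
by apply: mulfI; rewrite oppr_eq0.
Qed.

(** Equality of all moments makes the bump integrals equal, and so their limits. Measures enter
    through location maps [T1], [T2] on arbitrary spaces, so that a density can be represented by
    Lebesgue measure and a change of variable. *)
Lemma stieltjes_atom (c : R) : 0 < c ->
  mu1 (B1 `&` T1 @^-1` [set c]) = mu2 (B2 `&` T2 @^-1` [set c]).
Proof.
move=> c0.
have moment_eq n j : \int[mu2]_(y in B2) ((c / (c + T2 y)) ^+ n.+2 * (1 - c / (c + T2 y)) ^+ j) =
    \int[mu1]_(y in B1) ((c / (c + T1 y)) ^+ n.+2 * (1 - c / (c + T1 y)) ^+ j).
  elim: j n => [|j IH] n.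
    by rewrite !resolvent_moment0// resolvent_eq.
  by rewrite !resolvent_momentS// !IH.
have c1 := cvg_bump mB1 mT1 T10 fin1 c0.
have c2 := cvg_bump mB2 mT2 T20 fin2 c0.
move: c2; under eq_fun do rewrite moment_eq.
move=> c2; have e := cvg_unique (@ereal_hausdorff R) c1 c2.
have := congr1 (fun z => 4%:E * z)%E (e _).
by rewrite !muleA -EFinM mulfV// !mul1e; apply; typeclasses eauto.
Qed.

End stieltjes_uniqueness.

(** * The square root as a logarithmic potential *)

(** The fourth root is low enough for the limit at 0: s times the fourth root of 1 + x / s^2 is sqrt
    (s sqrt (s^2 + x)), which tends to 0 with s. *)
Lemma ln_le_root4 (R : realType) (z : R) : 0 < z -> ln z <= 4 * Num.sqrt (Num.sqrt z).
Proof.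
move=> z0; set w := Num.sqrt (Num.sqrt z).
have w0 : 0 < w by rewrite !sqrtr_gt0.
have -> : z = w ^+ 4.
  by rewrite (exprM w 2 2) !sqr_sqrtr// ?sqrtr_ge0// ltW.
by rewrite lnXn// mulr_natl lerMn2r/= ltW// ln_sublinear.
Qed.

Section integral_ln.
Context (R : realType) (x : R).
Hypothesis x0 : 0 < x.
Local Notation leb := (@lebesgue_measure R).

(** The boundary term of an integration by parts: g s + 2 sqrt x atan (s / sqrt x) is a primitive of
    ln (1 + x / s^2), and [g] vanishes at both ends. *)
Let g (s : R) : R := s * ln (1 + x / s ^+ 2).

Let g_ge0 s : 0 < s -> 0 <= g s.
Proof.
by move=> s0; rewrite mulr_ge0 ?(ltW s0)// ln_ge0// lerDl ltW// divr_gt0 ?exprn_gt0.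
Qed.

Let g_cvg0 : g s @[s --> 0^'+] --> (0 : R).
Proof.
pose h (s : R) : R := 4 * Num.sqrt (s * Num.sqrt (s ^+ 2 + x)).
have h0 : h s @[s --> 0^'+] --> (0 : R).
  have e : h 0 = 0 by rewrite /h mul0r sqrtr0 mulr0.
  apply: cvg_at_right_filter; rewrite -[X in _ --> X]e.
  apply: (@continuousM _ _ (fun=> 4) (fun s : R => Num.sqrt (s * Num.sqrt (s ^+ 2 + x)))).
    exact: cvg_cst.
  apply: (@continuous_comp _ _ _ (fun s : R => s * Num.sqrt (s ^+ 2 + x)) Num.sqrt);
    last exact: sqrt_continuous.
  apply: continuousM; first exact: cvg_id.
  apply: (@continuous_comp _ _ _ (fun s : R => s ^+ 2 + x) Num.sqrt);
    last exact: sqrt_continuous.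
  apply: continuousD; last exact: cvg_cst.
  exact: exprn_continuous.
apply: (squeeze_cvgr _ _ h0); last exact: (@cvg_cst _ (0 : R)).
near=> s; have s0 : 0 < s by near: s; exact: nbhs_right_gt.
rewrite g_ge0//=; have z0 : 0 < 1 + x / s ^+ 2 by rewrite addr_gt0// divr_gt0 ?exprn_gt0.
apply: le_trans (ler_wpM2l (ltW s0) (ln_le_root4 z0)) _.
have zE : s ^+ 2 * (1 + x / s ^+ 2) = s ^+ 2 + x by field; exact: lt0r_neq0.
have sM (v : R) : 0 <= v -> s * Num.sqrt v = Num.sqrt (s ^+ 2 * v).
  by move=> v0; rewrite sqrtrM ?sqr_ge0// sqrtr_sqr gtr0_norm.
rewrite /h -zE; move: (1 + _) z0 => z z0.
by rewrite mulrCA ler_wpM2l// -(sM z (ltW z0)) (sM (Num.sqrt z)) ?sqrtr_ge0// mulrA -expr2.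
Unshelve. all: by end_near. Qed.

Let g_cvgy : g s @[s --> +oo] --> (0 : R).
Proof.
have h0 : x * s^-1 @[s --> +oo] --> (0 : R).
  rewrite -[X in _ --> X](mulr0 x); apply: cvgM; first exact: cvg_cst.
  by apply/gtr0_cvgV0; [near=> u; near: u; exact: nbhs_pinfty_gt|exact: cvg_id].
apply: (squeeze_cvgr _ _ h0); last exact: (@cvg_cst _ (0 : R)).
near=> s; have s0 : 0 < s by near: s; exact: nbhs_pinfty_gt.
rewrite g_ge0//=.
have p : 0 < x / s ^+ 2 by rewrite divr_gt0 ?exprn_gt0.
have := @le_ln1Dx R (x / s ^+ 2) (lt_trans (ltrN10 R) p).
move=> /(ler_wpM2l (ltW s0)) le; apply: le_trans le _.
rewrite le_eqVlt; apply/orP; left; apply/eqP; field.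
exact: lt0r_neq0.
Unshelve. all: by end_near. Qed.

Lemma integral_ln1_inv_sqr :
  (\int[leb]_(s in `]0%R, +oo[) (ln (1 + x / s ^+ 2))%:E = (pi * Num.sqrt x)%:E)%E.
Proof.
have p0 : 0 < pi :> R by exact: pi_gt0.
have y0 : 0 < Num.sqrt x by rewrite sqrtr_gt0.
have z0 s : 0 < s -> 0 < 1 + x / s ^+ 2 :> R.
  by move=> s0; rewrite addr_gt0// divr_gt0 ?exprn_gt0.
have ds (s : R) : 0 < s ->
    is_derive s 1 (fun s => ln (1 + x / s ^+ 2)) (- (2 * x) / (s * (s ^+ 2 + x))).
  move=> s0; have sn : s ^+ 2 != 0 by rewrite expf_neq0// gt_eqF.
  have d1 := @is_deriveV R (fun s => s ^+ 2) s _ _ sn (derX 1 s).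
  have d2 := derD (derC s 1) (derZ x d1).
  apply: (der_eq (der_comp (g := fun s => 1 + x / s ^+ 2) (derLn (z0 s s0)) d2)).
  rewrite /GRing.scale/=; field.
  by rewrite !gt_eqF//= addr_gt0// exprn_gt0.
have := (@ge0_FTC_oy R (fun s : R => ln (1 + x / s ^+ 2))
  (fun s : R => g s + 2 * Num.sqrt x * atan (s / Num.sqrt x)) 0 (0 + 2 * Num.sqrt x * 0)
  (0 + 2 * Num.sqrt x * (pi / 2))).
have -> : 0 + 2 * Num.sqrt x * (pi / 2) - (0 + 2 * Num.sqrt x * 0) = pi * Num.sqrt x.
  by move: (pi : R) p0 => p p0; field.
apply.
- by move=> s s0; rewrite ln_ge0// lerDl ltW// divr_gt0 ?exprn_gt0.
- by move=> s s0; exact: is_derive_continuous (ds s s0).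
- move=> s s0; have dg := derM (derId s) (ds s s0).
  have d1 : is_derive s 1 (fun s => s / Num.sqrt x) (Num.sqrt x)^-1.
    by apply: (der_eq (derM (derId s) (derC s _))); rewrite mulr0 addr0 mul1r.
  have d2 := derZ (2 * Num.sqrt x) (der_comp (g := fun s => s / Num.sqrt x) (is_derive1_atan _) d1).
  apply: (der_eq (derD dg d2)).
  rewrite mul1r -addrA -[RHS]addr0; congr (_ + _).
  have : Num.sqrt x ^+ 2 = x by rewrite sqr_sqrtr ?ltW.
  move: (Num.sqrt x) y0 => y y0 <-; field.
  by rewrite !gt_eqF//= addr_gt0// exprn_gt0.
- apply: cvgD; first exact: g_cvg0.
  apply: cvgM; first exact: cvg_cst.
  apply: cvg_at_right_filter.
  have e : atan (0 / Num.sqrt x) = 0 :> R by rewrite mul0r atan0.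
  rewrite -[X in _ --> X]e.
  apply: (@continuous_comp _ _ _ (fun u : R => u / Num.sqrt x) atan); last exact: continuous_atan.
  by apply: continuousM; [exact: cvg_id|exact: cvg_cst].
- apply: cvgD; first exact: g_cvgy.
  apply: cvgM; first exact: cvg_cst.
  apply: (cvg_comp (fun u => u / Num.sqrt x) atan); last exact: cvgy_atan.
  by apply: gt0_cvgMly; rewrite ?invr_gt0//; exact: cvg_id.
Qed.

End integral_ln.

Section sqrt_potential.
Context (R : realType).
Local Notation RR := (measurableTypeR R).
Local Notation leb := (@lebesgue_measure R).
Local Notation D := (`]0%R, +oo[%classic : set RR).

(** An index with tau i = 0 gives a Dirac mass at 0, since 0^-1 = 0. Integrals over the open
    half-line ignore it, in accordance with ln 1 = 0. *)
Definition atoms (tau : nat -> R) : {measure set RR -> \bar R} :=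
  mseries (fun i => dirac ((tau i)^-1 : RR)) 0.

Lemma measurable_ln1_div (x : R) : measurable_fun [set: RR] (fun t : RR => (ln (1 + x / t))%:E).
Proof.
apply/measurable_EFinP; apply: (@measurableT_comp _ _ _ _ _ _ (@ln R)); first exact: measurable_ln.
apply: measurable_funD => //; apply: measurable_funM => //; exact: measurable_invr.
Qed.

Lemma ln1_div_ge0 (x : R) t : 0 < x -> D t -> (0 <= (ln (1 + x / t))%:E)%E.
Proof.
by move=> x0; rewrite /= in_itv/= andbT => t0; rewrite lee_fin ln_ge0// lerDl ltW// divr_gt0.
Qed.

Lemma integral_atoms (tau : nat -> R) (x : R) : (forall i, 0 <= tau i) -> 0 < x ->
  (\int[atoms tau]_(t in D) (ln (1 + x / t))%:E = \sum_(i <oo) (ln (1 + tau i * x))%:E)%E.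
Proof.
move=> t0 x0; rewrite ge0_integral_measure_series//.
- apply: eq_eseriesr => i _; rewrite integral_dirac//; last first.
    by apply: measurable_funTS; exact: measurable_ln1_div.
  rewrite invrK diracE [x * _]mulrC mem_setE/= in_itv/= andbT invr_gt0.
  have := t0 i; rewrite le_eqVlt => /predU1P[<-|->]; last by rewrite mul1e.
  by rewrite ltxx mul0e mul0r addr0 ln1.
- by move=> t; exact: ln1_div_ge0.
- by apply: measurable_funTS; exact: measurable_ln1_div.
Qed.

Lemma sqrt_not_ggc (C alpha : R) (m : {measure set RR -> \bar R}) (tau sig : nat -> R)
    (f g : R -> R) : 0 < C ->
  (forall i, 0 <= tau i) -> (forall i, 0 <= sig i) -> (exists i, 0 < tau i) ->
  (forall x, 0 < x -> (\sum_(i <oo) (ln (1 + tau i * x))%:E = (f x)%:E)%E) ->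
  (forall x, 0 < x -> (\sum_(i <oo) (ln (1 + sig i * x))%:E = (g x)%:E)%E) ->
  (forall x, 0 < x -> (\int[m]_(t in D) (ln (1 + x / t))%:E =
     (C * Num.sqrt x - f x - g x - alpha * x)%:E)%E) -> False.
Proof.
move=> C0 t0 s0 [i ti] fE gE mE.
pose M : {measure set RR -> \bar R} := measure_add m (measure_add (atoms tau) (atoms sig)).
have mD : measurable D by exact: measurable_itv.
have ME (x : R) : 0 < x -> (\int[M]_(t in D) (ln (1 + x / t))%:E = (C * Num.sqrt x - alpha * x)%:E)%E.
  move=> x0; have mx := measurable_funTS (D := D) (measurable_ln1_div x).
  have x1 t := ln1_div_ge0 (t := t) x0.
  rewrite ge0_integral_measure_add// ge0_integral_measure_add//.
  by rewrite mE// !integral_atoms// fE// gE// -!EFinD; congr EFin; ring.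
(* Locations s^2 give the potential pi sqrt x, and locations (k s)^2 give pi sqrt x / k, which is to
   equal C sqrt x. *)
pose k := pi / C.
have k0 : 0 < k by rewrite divr_gt0// pi_gt0.
pose T (s : RR) : R := (k * s) ^+ 2.
have TE (x : R) : 0 < x -> (\int[leb]_(s in D) (ln (1 + x / T s))%:E = (C * Num.sqrt x)%:E)%E.
  move=> x0; have xk : 0 < x / k ^+ 2 by rewrite divr_gt0// exprn_gt0.
  have := integral_ln1_inv_sqr xk.
  have -> : pi * Num.sqrt (x / k ^+ 2) = C * Num.sqrt x.
    rewrite sqrtrM ?(ltW x0)// sqrtrV ?sqr_ge0// sqrtr_sqr gtr0_norm//.
    rewrite /k; have := pi_gt0 R; move: (pi : R) => p p0; field.
    by rewrite !lt0r_neq0.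
  move=> <-; apply: eq_integral => s _; rewrite /T exprMn invfM mulrA.
  by [].
have T0 s : D s -> 0 < T s.
  by rewrite /= in_itv/= andbT => s1; rewrite /T exprn_gt0// mulr_gt0.
have mT : measurable_fun D T.
  apply: measurable_funTS; apply: measurable_funX; apply: measurable_funM => //.
have c0 : 0 < (tau i)^-1 by rewrite invr_gt0.
have MT : M (D `&` id @^-1` [set (tau i)^-1]) = leb (D `&` T @^-1` [set (tau i)^-1]).
  apply: (@stieltjes_atom R _ _ RR RR M leb D D id T mD mD _ mT _ T0 _ _ alpha _ _ c0).
  - exact: measurable_id.
  - by move=> t; rewrite /= in_itv/= andbT.
  - by move=> x x0; rewrite ME// ltry.
  - by move=> x x0; rewrite TE// ltry.
  - by move=> x x0; rewrite /Rintegral TE// ME//= addrC subrK.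
have leb0 : leb (D `&` T @^-1` [set (tau i)^-1]) = 0%E.
  rewrite (_ : _ `&` _ = [set Num.sqrt (tau i)^-1 / k]) ?lebesgue_measure_set1//.
  apply/seteqP; split => [s []|s ->]/=; rewrite in_itv/= andbT.
    move=> s1; rewrite /T => <-; rewrite sqrtr_sqr (gtr0_norm (mulr_gt0 k0 s1)).
    by rewrite [k * s]mulrC mulfK// lt0r_neq0.
  split; first by rewrite divr_gt0// sqrtr_gt0.
  by rewrite /T [k * _]mulrC divfK ?lt0r_neq0// sqr_sqrtr// ltW.
have : (1 <= M (D `&` id @^-1` [set (tau i)^-1%R]))%E.
  have MA A : M A = (m A + (atoms tau A + atoms sig A))%E.
    exact: etrans (measure_addE _ _ _) (congr1 _ (measure_addE _ _ _)).
  rewrite MA (_ : 1%E = 0 + (1 + 0))%E; last by rewrite add0e adde0.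
  apply: leeD => //; apply: leeD => //.
  rewrite /atoms/= /mseries (nneseriesD1 (n := i))//.
  have dE (t : RR) A : A t -> (dirac t A : \bar R) = 1%E by move=> At; rewrite diracE mem_set.
  rewrite [X in (X + _)%E](_ : _ = 1%E); last first.
    by apply: dE; split => //=; rewrite in_itv/= c0.
  by rewrite leeDl// nneseries_ge0.
by rewrite MT leb0 leNgt lte_fin ltr01.
Qed.

End sqrt_potential.

(** * The gamma and Bessel functions *)

Section gamma.
Context (R : realType).
Local Notation leb := (@lebesgue_measure R).
Local Notation RR := (measurableTypeR R).
Local Notation D := (`]0%R, +oo[%classic : set RR).

Lemma powR_exp_bound (p : R) : 0 <= p -> exists2 K : R, 0 <= K &
  forall t, 0 < t -> t `^ p * expR (- t) <= K * expR (- (2^-1 * t)).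
Proof.
move=> p0; pose n := (Num.truncn p).+1.
have pn : p <= n%:R by exact/ltW/truncnS_gt.
(* With m = 2 n one has t^n <= (m e^(t / m))^n = m^n e^(t / 2). *)
pose m : R := 2 * n%:R.
have m1 : 1 <= m by rewrite /m -natrM ler1n muln_gt0.
have m0 : 0 < m by exact: lt_le_trans m1.
exists (m ^+ n); first by rewrite exprn_ge0// ltW.
move=> t t0.
have -> : expR (- (2^-1 * t)) = expR (t / 2) * expR (- t).
  by rewrite -expRD; congr expR; field.
rewrite mulrA; apply: ler_wpM2r; first exact: expR_ge0.
have mn1 : 1 <= m ^+ n by rewrite exprn_ege1.
have [t1|t1] := leP t 1.
  apply: (@le_trans _ _ 1).
    have := @ge0_ler_powR R p p0 t 1; rewrite powR1; apply; rewrite ?nnegrE ?(ltW t0)//.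
   
  by rewrite -[leLHS]mulr1 ler_pM// -expR0 ler_expR divr_ge0// ltW.
apply: (@le_trans _ _ (t `^ n%:R)); first by apply: ler_powR => //; exact: ltW.
rewrite powR_mulrn ?(ltW t0)//.
have tm : t / m <= expR (t / m).
  by apply: le_trans (expR_ge1Dx _); rewrite lerDr.
have -> : expR (t / 2) = expR (t / m) ^+ n.
  rewrite -expRM_natl; congr expR; rewrite /m; field.
  by rewrite pnatr_eq0.
rewrite -exprMn lerXn2r ?nnegrE ?(ltW t0)//; first by rewrite mulr_ge0 ?expR_ge0// ltW.
by rewrite mulrC -ler_pdivrMr.
Qed.

Let h (s t : R) : R := t `^ (s - 1) * expR (- t).

Let h0 s t : 0 <= h s t. Proof. by rewrite mulr_ge0 ?powR_ge0 ?expR_ge0. Qed.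

Let hc s t : 0 < t -> {for t, continuous (h s)}.
Proof.
move=> t0; apply: continuousM.
  exact: (is_derive_continuous (is_derive1_powR (s - 1) t0)).
have d := der_comp (is_derive_expR (- t)) (derN (derId t)).
exact: is_derive_continuous d.
Qed.

Let mh s : measurable_fun D (fun t => (h s t)%:E).
Proof.
apply/measurable_EFinP; apply: open_continuous_measurable_fun => //.
by move=> t /set_mem/=; rewrite in_itv/= andbT; exact: hc.
Qed.

Let mexp (A : set RR) c : measurable_fun A (fun t : RR => (expR (- (c * t)))%:E).
Proof.
apply: measurable_funTS; apply: (measurable_expRM (X := fun t : RR => t)).
exact: measurable_id.
Qed.

Let int_exp2 : (\int[leb]_(t in D) (expR (- (2^-1 * t)))%:E = 2%:E)%E.
Proof.
have := @integral_exp_tail R 0 2^-1 (ltac:(by rewrite invr_gt0)).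
rewrite mulr0 oppr0 expR0.
under eq_integral do rewrite EFinM.
rewrite ge0_integralZl//.
move=> e; have := congr1 (fun z => 2%:E * z)%E e.
by rewrite muleA -EFinM mulfV// mul1e mule1.
Qed.

Lemma Gamma_EFin (s : R) : 1 <= s -> (\int[leb]_(t in D) (t `^ (s - 1) * expR (- t))%:E = (Gamma s)%:E)%E.
Proof.
move=> s1; have s0 : 0 <= s - 1 by rewrite subr_ge0.
have [K K0 KP] := powR_exp_bound s0.
rewrite /Gamma /Rintegral fineK// ge0_fin_numE; last first.
  by apply: integral_ge0 => t _; rewrite lee_fin; exact: (h0 s t).
apply: (@le_lt_trans _ _ (\int[leb]_(t in D) (K%:E * (expR (- (2^-1 * t)))%:E))%E).
  apply: ge0_le_integral => //.
  - by move=> t _; rewrite lee_fin; exact: (h0 s t).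
  - exact: mh.
  - by apply: emeasurable_funM => //; exact: mexp.
  - by move=> t; rewrite /= in_itv/= andbT => t0; rewrite lee_fin KP.
rewrite ge0_integralZl//.
by rewrite int_exp2 -EFinM ltry.
Qed.

Lemma Gamma_gt0 (s : R) : 1 <= s -> 0 < Gamma s.
Proof.
move=> s1; rewrite -lte_fin -Gamma_EFin//.
apply: (@lt_le_trans _ _ (expR (- (1 * 1)))%:E); first by rewrite lte_fin expR_gt0.
rewrite -(@integral_exp_tail R 1 1 ltr01).
apply: le_trans (_ : (_ <= \int[leb]_(t in `]1%R, +oo[) (h s t)%:E)%E) _.
  apply: ge0_le_integral => //.
  - exact: (measurable_funeM 1%:E (@mexp _ 1)).
  - apply: measurable_funS (mh s) => //.
    by apply: subset_itvr; rewrite bnd_simp.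
  - move=> t; rewrite /= in_itv/= andbT => t1.
    rewrite lee_fin mul1r mul1r /h ler_peMl ?expR_ge0//.
    by rewrite -[leLHS](powRr0 t); apply: ler_powR; rewrite ?subr_ge0 ?(ltW t1).
apply: ge0_subset_integral => //.
  by move=> t _; rewrite lee_fin h0.
by apply: subset_itvr; rewrite bnd_simp.
Qed.

Lemma GammaS (s : R) : 1 <= s -> Gamma (s + 1) = s * Gamma s.
Proof.
move=> s1; have s0 : 0 < s by exact: lt_le_trans s1.
have s10 : 0 <= s - 1 by rewrite subr_ge0.
have [K K0 KP] := powR_exp_bound s10.
have [K' K'0 K'P] := powR_exp_bound (ltW s0).
pose C := s * K.
have C0 : 0 <= C by rewrite mulr_ge0// ltW.
(* The term C e^(-t/2) only serves to make the derivative of G nonnegative. *)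
pose f (t : R) : R := h (s + 1) t - s * h s t + C * expR (- (2^-1 * t)).
pose G (t : R) : R := - (t `^ s * expR (- t)) - 2 * C * expR (- (2^-1 * t)).
have f0 t : 0 < t -> 0 <= f t.
  move=> t0; rewrite /f -addrA addr_ge0// addrC subr_ge0 /C -mulrA.
  by rewrite ler_wpM2l ?(ltW s0)// KP.
have ce (t : R) : {for t, continuous (fun t : R => expR (- (2^-1 * t)))}.
  have d := der_comp (g := fun t => - (2^-1 * t)) (is_derive_expR _) (derN (derZ 2^-1 (derId t))).
  exact: is_derive_continuous d.
have fc t : 0 < t -> {for t, continuous f}.
  move=> t0; apply: continuousD; last by apply: continuousM; [exact: cvg_cst|exact: ce].
  apply: continuousB; first exact: hc.
  by apply: continuousM; [exact: cvg_cst|exact: hc].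
have I : (\int[leb]_(t in D) (f t)%:E = (0 - (- (2 * C)))%:E)%E.
  apply: (ge0_FTC_oy (F := G) f0 fc).
  - move=> t t0.
    have d1 := derM (is_derive1_powR s t0) (der_comp (is_derive_expR (- t)) (derN (derId t))).
    have d2 := derZ (2 * C) (der_comp (g := fun t => - (2^-1 * t)) (is_derive_expR _) (derN (derZ 2^-1 (derId t)))).
    apply: (der_eq (derB (derN d1) d2)).
    by rewrite /f /h addrK; field.
  - have -> : - (2 * C) = - (0 * expR (- 0)) - 2 * C * expR (- (2^-1 * 0)).
      by rewrite mulr0 oppr0 expR0; ring.
    apply: cvgB.
      apply: cvgN; apply: cvgM; first exact: powR_cvg0.
      apply: cvg_at_right_filter.
      exact: is_derive_continuous (der_comp (is_derive_expR (- 0)) (derN (derId 0))).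
    apply: cvgM; first exact: cvg_cst.
    exact/cvg_at_right_filter/ce.
  - have e2 : expR (- (2^-1 * t)) @[t --> +oo] --> (0 : R).
      apply: (cvg_comp (fun t => 2^-1 * t) (fun t => expR (- t)) _ (@cvgr_expR R)).
      by apply: gt0_cvgMry; rewrite ?invr_gt0//; exact: cvg_id.
    have e3 (c : R) : c * expR (- (2^-1 * t)) @[t --> +oo] --> (0 : R).
      by rewrite -[X in _ --> X](mulr0 c); apply: cvgM; [exact: cvg_cst|exact: e2].
    rewrite -[X in _ --> X](subr0 0) -{1}oppr0; apply: cvgB; last exact: e3.
    apply: cvgN; apply: (squeeze_cvgr _ (@cvg_cst _ (0 : R) _ _ _) (e3 K')).
    near=> t; have t0 : 0 < t by near: t; exact: nbhs_pinfty_gt.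
    by rewrite mulr_ge0 ?powR_ge0 ?expR_ge0//= K'P.
rewrite sub0r opprK in I.
have s2 : 1 <= s + 1 by rewrite (le_trans s1)// lerDl.
have mf : measurable_fun D (fun t => (f t)%:E).
  apply/measurable_EFinP; apply: open_continuous_measurable_fun => //.
  by move=> t /set_mem/=; rewrite in_itv/= andbT; exact: fc.
have C1 : (\int[leb]_(t in D) (C * expR (- (2^-1 * t)))%:E = (2 * C)%:E)%E.
  under eq_integral do rewrite EFinM.
  by rewrite ge0_integralZl// int_exp2 -EFinM mulrC.
have C2 : (\int[leb]_(t in D) (s * h s t)%:E = (s * Gamma s)%:E)%E.
  under eq_integral do rewrite EFinM.
  rewrite ge0_integralZl//; first by rewrite Gamma_EFin// -EFinM.
    by move=> t _; rewrite lee_fin.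
  by rewrite lee_fin ltW.
have : (\int[leb]_(t in D) ((f t)%:E + (s * h s t)%:E) =
    \int[leb]_(t in D) ((h (s + 1) t)%:E + (C * expR (- (2^-1 * t)))%:E))%E.
  by apply: eq_integral => t _; rewrite -!EFinD /f; congr EFin; ring.
have D0 t : D t -> 0 < t by rewrite /= in_itv/= andbT.
rewrite ge0_integralD//; first last.
- exact: (measurable_funeM s%:E (@mh s)).
- by move=> t _; rewrite lee_fin mulr_ge0// ltW.
- by move=> t /D0 t0; rewrite lee_fin f0.
rewrite ge0_integralD//; first last.
- exact: (measurable_funeM C%:E (@mexp _ 2^-1)).
- by move=> t _; rewrite lee_fin mulr_ge0// expR_ge0.
- by move=> t _; rewrite lee_fin.
rewrite I C1 C2 Gamma_EFin// -!EFinD => -[].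
lra.
Unshelve. all: by end_near. Qed.

End gamma.

Section bessel.
Context (R : realType).

Lemma Gamma_bcoef (mu : R) k : 1 / 2 < mu ->
  bcoef mu k * (k`!%:R * Gamma (k%:R + mu + 1)) * 4 ^+ k = Gamma (mu + 1).
Proof.
move=> mu2; have mu0 : 0 < mu by apply: lt_trans mu2; rewrite divr_gt0.
elim: k => [|k IH]; first by rewrite /bcoef big_ord0 fact0 expr0 !mul1r add0r mulr1.
have p : 0 < mu + 1 + k%:R by rewrite ltr_wpDr// addr_gt0.
rewrite bcoefS (_ : k.+1%:R + mu + 1 = (k%:R + mu + 1) + 1); last by rewrite -natr1; ring.
rewrite (@GammaS _ (k%:R + mu + 1)); last by rewrite lerDr addr_ge0// ltW.
have k0 : k.+1%:R != 0 :> R by rewrite pnatr_eq0.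
rewrite factS natrM -IH exprS; move: (Gamma _) (k`!%:R) (4 ^+ k) (k.+1%:R) k0 => g f q n n0.
by field; rewrite n0 gt_eqF.
Qed.

Lemma besselIE (mu z : R) : 1 / 2 < mu -> 0 < z ->
  besselI mu z = (z / 2) `^ mu / Gamma (mu + 1) * besselF mu (z ^+ 2).
Proof.
move=> mu2 z0; have mu0 : 0 < mu by apply: lt_trans mu2; rewrite divr_gt0.
have z2 : 0 < z / 2 by rewrite divr_gt0.
have G0 : Gamma (mu + 1) != 0 by rewrite gt_eqF// Gamma_gt0// lerDr ltW.
apply/cvg_lim; first exact: norm_hausdorff.
rewrite (_ : series _ = fun n => (z / 2) `^ mu / Gamma (mu + 1) * pseries (bcoef mu) (z ^+ 2) n).
  apply: cvgM; first exact: cvg_cst.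
  exact: psum_cvg (exp_bounded_bcoef mu2).
apply/funext => n; rewrite /pseries /series/= mulr_sumr; apply: eq_bigr => k _.
have Gk : Gamma (k%:R + mu + 1) != 0.
  by rewrite gt_eqF// Gamma_gt0// lerDr addr_ge0// ltW.
have k0 : k`!%:R != 0 :> R by rewrite pnatr_eq0 -lt0n fact_gt0.
rewrite -(Gamma_bcoef k mu2) addrC powRD; last by rewrite (gt_eqF z2) implybT.
rewrite -natrM powR_mulrn ?(ltW z2)//.
have b0 : bcoef mu k != 0 by rewrite gt_eqF// bcoef_gt0.
rewrite exprM expr_div_n exprMn (_ : (2 ^+ 2)^-1 ^+ k = (4 ^+ k)^-1); last first.
  by rewrite exprVn -natrX.
have q0 : 4 ^+ k != 0 :> R by rewrite expf_neq0// pnatr_eq0.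
move: (_ `^ mu) (z ^+ 2 ^+ k) (bcoef mu k) (k`!%:R) (Gamma _) (4 ^+ k) b0 k0 Gk q0 => p q c f g e c0 f0 g0 e0.
by field; rewrite c0 f0 g0 e0.
Qed.

Lemma zetaE (mu nu a b x : R) : 1 / 2 < mu -> 1 / 2 < nu -> 0 < a -> 0 < b -> 0 < x ->
  zeta mu nu a b x = expR (- (a * Num.sqrt x)) * besselF mu (a ^+ 2 * x) *
    (expR (- (b * Num.sqrt x)) * besselF nu (b ^+ 2 * x)).
Proof.
move=> mu2 nu2 a0 b0 x0.
have s0 : 0 < Num.sqrt x by rewrite sqrtr_gt0.
rewrite /zeta !besselIE ?mulr_gt0// !exprMn !sqr_sqrtr ?(ltW x0)//.
have pw (c m : R) : 0 < c -> (c * Num.sqrt x / 2) `^ m = c `^ m * x `^ (m / 2) / 2 `^ m.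
  move=> c0; rewrite powRM ?mulr_ge0 ?invr_ge0 ?sqrtr_ge0 ?(ltW c0)//.
  rewrite powRM ?sqrtr_ge0 ?(ltW c0)// -powR12_sqrt ?(ltW x0)// -powRrM.
  have -> : 2^-1 `^ m = (2 `^ m)^-1 :> R by rewrite -powRN -mulN1r powRrM powR_inv1.
  by rewrite [2^-1 * m]mulrC.
have mu0 : 0 < mu by apply: lt_trans mu2; rewrite divr_gt0.
have nu0 : 0 < nu by apply: lt_trans nu2; rewrite divr_gt0.
have Gm : Gamma (mu + 1) != 0 by rewrite gt_eqF// Gamma_gt0// lerDr ltW.
have Gn : Gamma (nu + 1) != 0 by rewrite gt_eqF// Gamma_gt0// lerDr ltW.
rewrite !pw// [(a + b) * _]mulrDl opprD expRD.
have -> : x `^ (- ((mu + nu) / 2)) = (x `^ (mu / 2))^-1 * (x `^ (nu / 2))^-1.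
  by rewrite powRN mulrDl powRD ?invfM// (gt_eqF x0) implybT.
rewrite (@powRD _ 2); last by rewrite pnatr_eq0 implybT.
have pn (c m : R) : 0 < c -> c `^ m != 0 by move=> c0; rewrite gt_eqF// powR_gt0.
have := pn a mu a0; have := pn b nu b0; have := pn x (mu / 2) x0; have := pn x (nu / 2) x0.
have := pn 2 mu (ltr0n _ 2); have := pn 2 nu (ltr0n _ 2).
move: Gm Gn (2 `^ mu) (2 `^ nu) (a `^ mu) (b `^ nu) (x `^ (mu / 2)) (x `^ (nu / 2)).
move: (Gamma (mu + 1)) (Gamma (nu + 1)) (expR (- (a * _))) (expR (- (b * _))).
move: (besselF mu _) (besselF nu _) => f g G H e e' G0 H0 p q r s t u h1 h2 h3 h4 h5 h6.
by field; rewrite G0 H0 h1 h2 h3 h4 h5 h6.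
Qed.

End bessel.

(** * Infinite divisibility and the exclusion of generalized gamma convolutions *)

Section main.
Context (R : realType).
Local Notation RR := (measurableTypeR R).

Lemma laplace_abs (Q : probability RR R) (x y : R) : Q `[0%R, +oo[%classic = 1%E ->
  (\int[Q]_t (expR (- (x * `|t|%R)))%:E = y%:E)%E -> laplace Q x = y.
Proof.
move=> Q1 Qy; rewrite /laplace /Rintegral.
have mD : measurable (`[0%R, +oo[%classic : set RR) by exact: measurable_itv.
have mf (A : set RR) : measurable_fun A (fun t : RR => (expR (- (x * `|t|)))%:E).
  by apply: measurable_funTS; apply: measurable_expRM; exact: normr_measurable.
rewrite (eq_integral (fun t : RR => (expR (- (x * `|t|)))%:E)); last first.
  by move=> t; rewrite inE/= in_itv/= andbT => t0; rewrite ger0_norm.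
move: Qy; rewrite -(setUv (`[0%R, +oo[%classic : set RR)) ge0_integral_setU//; last first.
- by apply/disj_set2P; rewrite setICr.
- exact: measurableC.
rewrite [X in (_ + X)%E](_ : _ = 0%E) ?adde0; first by move=> ->.
apply: null_set_integral => //; first exact: measurableC.
by have := probability_setC Q mD; rewrite [X in (1 - X)%E]Q1 subee.
Qed.

(** Positivity allows logarithms to be taken; the upper bound tends to 0 at infinity, which excludes
    an atom of the law at 0. *)
Lemma zeta_bounds (mu nu a b x : R) : 1 / 2 < mu -> 1 / 2 < nu -> 0 < a -> 0 < b -> 0 < x ->
  0 < zeta mu nu a b x <= (1 + a * Num.sqrt x)^-1.
Proof.
move=> mu2 nu2 a0 b0 x0; rewrite zetaE//.
have F0 (c m : R) : 0 < c -> 1 / 2 < m -> 0 < expR (- (c * Num.sqrt x)) * besselF m (c ^+ 2 * x).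
  move=> c0 m2; rewrite mulr_gt0 ?expR_gt0// besselF_gt0//.
  by rewrite mulr_ge0 ?sqr_ge0 ?(ltW x0).
have F1 (c m : R) : 0 < c -> 1 / 2 < m ->
    expR (- (c * Num.sqrt x)) * besselF m (c ^+ 2 * x) <= (1 + c * Num.sqrt x)^-1.
  move=> c0 m2; have z0 : 0 <= c * Num.sqrt x by rewrite mulr_ge0 ?sqrtr_ge0 ?(ltW c0).
  have p : 0 < 1 + c * Num.sqrt x by rewrite ltr_wpDr.
  have := besselF_le_exp m2 z0; rewrite exprMn sqr_sqrtr ?(ltW x0)// => le.
  rewrite expRN -[leRHS]mul1r ler_pdivlMr// -mulrA mulrC ler_pdivrMr ?expR_gt0//.
  by rewrite mul1r mulrC.
rewrite mulr_gt0 ?F0//=; apply: le_trans (F1 a mu a0 mu2).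
rewrite -[leRHS]mulr1 ler_wpM2l ?(ltW (F0 _ _ _ _))//; apply: le_trans (F1 b nu b0 nu2) _.
by rewrite invf_le1 ?lerDl ?ltr_wpDr// mulr_ge0 ?sqrtr_ge0 ?(ltW b0).
Qed.

Lemma zeta_root (mu nu a b : R) n : 1 / 2 < mu -> 1 / 2 < nu -> 0 < a -> 0 < b -> (0 < n)%N ->
  exists2 h : R -> R, is_laplace h & forall x, 0 < x -> h x ^+ n = zeta mu nu a b x.
Proof.
move=> mu2 nu2 a0 b0 n0.
have [f Lf fE] := besselF_root mu2 a0 n0.
have [g Lg gE] := besselF_root nu2 b0 n0.
exists (fun x => f x * g x); first exact: is_laplaceM.
by move=> x x0; rewrite exprMn fE// gE// zetaE.
Qed.

Lemma ln_besselF_series (mu a : R) : 1 / 2 < mu -> 0 < a -> exists tau : nat -> R,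
  [/\ forall i, 0 <= tau i, exists i, 0 < tau i &
   forall x, 0 < x -> (\sum_(i <oo) (ln (1 + tau i * x))%:E =
     (ln (besselF mu (a ^+ 2 * x)))%:E)%E].
Proof.
move=> mu2 a0; have [tau [tau0 cF _]] := besselF_zeros mu2.
have t0 i : 0 <= tau i by have /andP[] := tau0 i.
have a20 : 0 < a ^+ 2 by rewrite exprn_gt0.
exists (fun i => tau i * a ^+ 2); split.
- by move=> i; rewrite mulr_ge0// ltW.
(* If every tau i were 0, the product would give F 1 = 1, against F 1 >= 1 + b_1. *)
- apply: contrapT => /forallNP tau_le0.
  have tauE i : tau i = 0.
    by apply/le_anti; rewrite t0 andbT leNgt; apply/negP => ti; apply: (tau_le0 i); rewrite mulr_gt0.
  have c1 := cF 1 ler01.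
  have : besselF mu 1 = 1.
    apply: (cvg_unique _ c1); first exact: norm_hausdorff.
    apply: cvg_near_cst; apply: nearW => n; rewrite big1// => i _.
    by rewrite tauE mul0r addr0.
  have := besselF_ge1 mu2 (@ler01 R); have := bcoef_gt0 mu2 1; lra.
- move=> x x0; apply: eseries_EFin.
  under eq_fun do rewrite -mulrA.
  have a2x : 0 <= a ^+ 2 * x by rewrite mulr_ge0// ltW.
  exact: (series_ln_prod t0 a2x (besselF_gt0 mu2 a2x) (cF _ a2x)).
Qed.

Lemma zeta_not_ggc (mu nu a b : R) (P : probability RR R) :
  1 / 2 < mu -> 1 / 2 < nu -> 0 < a -> 0 < b ->
  (forall x, 0 < x -> zeta mu nu a b x = laplace P x) ->
  ~ generalized_gamma_convolution P.
Proof.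
move=> mu2 nu2 a0 b0 zE [_ [alpha [m [alpha0 mE]]]].
have [tau [t0 tp tE]] := ln_besselF_series mu2 a0.
have [sig [s0 _ sE]] := ln_besselF_series nu2 b0.
apply: (@sqrt_not_ggc R (a + b) alpha m tau sig _ _ _ t0 s0 tp tE sE); first by rewrite addr_gt0.
move=> x x0; have := mE x (ltW x0).
rewrite -zE// => /(congr1 (@lne R)); rewrite expeRK.
have /andP[z0 _] := zeta_bounds mu2 nu2 a0 b0 x0.
rewrite lne_EFin//.
have -> : (\int[m]_(t in `]0%R, +oo[) (ln (t / (x + t)))%:E =
    - \int[m]_(t in `]0%R, +oo[) (ln (1 + x / t))%:E)%E.
  rewrite -integral_ge0N; last by move=> t; exact: ln1_div_ge0.
  apply: eq_integral => t; rewrite inE/= in_itv/= andbT => t1.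
  have -> : t / (x + t) = (1 + x / t)^-1 by field; rewrite !gt_eqF// addr_gt0.
  by rewrite lnV// posrE addr_gt0// divr_gt0.
have x1 : 0 <= a ^+ 2 * x by rewrite mulr_ge0 ?sqr_ge0 ?(ltW x0).
have x2 : 0 <= b ^+ 2 * x by rewrite mulr_ge0 ?sqr_ge0 ?(ltW x0).
have F1 := besselF_gt0 mu2 x1; have F2 := besselF_gt0 nu2 x2.
rewrite zetaE// !lnM ?posrE ?mulr_gt0 ?expR_gt0// !expRK.
(* The integral against [m] is not known to be finite beforehand; an infinite value contradicts the
   finite left side. *)
case: (integral _ _ _) => [r||]//= [e]; congr EFin.
by move: e; lra.
Qed.

End main.

Theorem theorem18 (R : realType) (a b mu nu : R)
    (ha : 0 < a) (hb : 0 < b) (hmu : 1 / 2 < mu) (hnu : 1 / 2 < nu) :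
  exists P : probability (measurableTypeR R) R,
    P `]0, +oo[%classic = 1%E /\
    (forall x : R, 0 < x -> zeta mu nu a b x = laplace P x) /\
    infinitely_divisible P /\
    ~ generalized_gamma_convolution P.
Proof.
(* The root of order 1 is zeta itself. *)
have [h Lh hE] := zeta_root hmu hnu ha hb (ltn0Sn 0).
have [P [P1 PE]] := is_laplace_real Lh.
have zE x : 0 < x -> zeta mu nu a b x = laplace P x.
  by move=> x0; rewrite (laplace_abs P1 (PE x x0)) -hE.
exists P; split; last split; last split.
- have mI (A : interval R) : measurable ([set` A] : set (measurableTypeR R)) by exact: measurable_itv.
  (* The mass r of the point 0 is at most the transform at every x, hence at most 1 / (1 + a sqrt
     x), and must vanish. *)
  pose r := fine (P [set 0]).
  have rE : P [set 0] = r%:E by rewrite /r fineK// fin_num_measure.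
  have r0 : 0 <= r by rewrite fine_ge0.
  have rx x : 0 < x -> r <= (1 + a * Num.sqrt x)^-1.
    move=> x0; have /andP[_] := zeta_bounds hmu hnu ha hb x0; apply: le_trans.
    rewrite -hE// expr1 -lee_fin -PE// -rE.
    apply: (@le_trans _ _ (\int[P]_(t in [set 0%R]) (expR (- (x * `|t|)))%:E)%E).
      rewrite (eq_integral (cst 1%E)); first by rewrite integral_cst// mul1e.
      by move=> t; rewrite inE/= => ->; rewrite normr0 mulr0 oppr0 expR0.
    apply: ge0_subset_integral => //.
    by apply: measurable_expRM; exact: normr_measurable.
  have r00 : r = 0.
    apply/le_anti; rewrite r0 andbT leNgt; apply/negP => rp.
    (* Taking sqrt x = 1 / (a r) turns the bound into r + 1 <= 1. *)
    pose y := (a * r)^-1.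
    have y0 : 0 < y by rewrite invr_gt0 mulr_gt0.
    have := rx (y ^+ 2); rewrite exprn_gt0// sqrtr_sqr gtr0_norm// => /(_ isT).
    rewrite -[leRHS]mul1r ler_pdivlMr; last by rewrite addr_gt0// mulr_gt0.
    rewrite (_ : r * (1 + a * y) = r + 1); last by rewrite /y; field; rewrite !gt_eqF.
    by rewrite gerDr leNgt rp.
  move: P1; rewrite -(@setU1itv _ _ +oo%O 0 false)// measureU//.
  + by rewrite [X in (X + _)%E](_ : _ = 0%E) ?add0e//; apply: etrans rE _; rewrite r00.
  + by apply/seteqP; split => // t [/= ->]; rewrite in_itv/= ltxx.
- exact: zE.
- split=> // n n0.
  have [g Lg gE] := zeta_root hmu hnu ha hb n0.
  have [Pn [Pn1 PnE]] := is_laplace_real Lg.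
  exists Pn; split=> // x x0.
  by rewrite (laplace_abs Pn1 (PnE x x0)) -zE// gE.
- exact: zeta_not_ggc zE.
Qed.
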